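(* Let $f(z)=z+\sum_{n=2}^{\infty}a_nz^n$ be typically real in $\mathbb{D}$, let $\Phi:[0,1]\to[0,\infty)$ be a continuous increasing function and let $\omega$ be a Schwarz function. Let $R$ be the unique root in $(0,1)$ of $F(r)=0$, where $$F(r)=\frac{r}{(1-r)^2}+\Phi(r)\frac{r^2(1+4r^2+r^4)}{(1-r^2)^4}-\frac14.$$ Then $$|\omega(z)|+\sum_{n=2}^{\infty}|a_n||\omega(z)|^n+\Phi(|\omega(z)|)\frac{S_r}{\pi}\le d(0,\partial f(\mathbb{D}))$$ for all $z\in\mathbb{D}$ with $|z|=r\le R$. The radius $R$ is sharp.
   Context: $\mathbb{D}=\{z\in\mathbb{C}:|z|<1\}$. An analytic function $f(z)=z+\sum_{n\ge2}a_nz^n$ on $\mathbb{D}$ is typically real if $\operatorname{Im} f(z)\cdot\operatorname{Im} z>0$ for all non-real $z\in\mathbb{D}$. A Schwarz function is an analytic $\omega:\mathbb{D}\to\mathbb{D}$ with $\omega(0)=0$. $d(0,\partial f(\mathbb{D}))$ is the Euclidean distance from $0$ to $\partial f(\mathbb{D})$. For $0<r<1$, $S_r=\int_{|z|<r}|f'(z)|^2\,dA(z)=\pi\sum_{n=1}^{\infty}n|a_n|^2r^{2n}$ (with $a_1=1$). *)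

(* Defs.v *)
From Stdlib Require Import Reals.
From Coquelicot Require Import Coquelicot.
Open Scope R_scope.

Definition in_disc (z : C) : Prop := Cmod z < 1.

(* f(z) = sum_n a_n z^n on D, normalized: a_0 = 0, a_1 = 1 (f(z) = z + sum_{n>=2} a_n z^n).
   Being given by a power series convergent on D, f is analytic on D. *)
Definition normalized_analytic (a : nat -> C) (f : C -> C) : Prop :=
  a 0%nat = 0%C /\ a 1%nat = 1%C /\
  forall z : C, in_disc z -> @is_pseries C_AbsRing C_NormedModule a z (f z).

Definition typically_real (a : nat -> C) (f : C -> C) : Prop :=
  normalized_analytic a f /\
  forall z : C, in_disc z -> Im z <> 0 -> Im (f z) * Im z > 0.

Definition schwarz (w : C -> C) : Prop :=
  (forall z : C, in_disc z -> @ex_derive C_AbsRing C_NormedModule w z) /\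
  (forall z : C, in_disc z -> in_disc (w z)) /\
  w 0%C = 0%C.

Definition in_image (f : C -> C) (w : C) : Prop := exists z, in_disc z /\ f z = w.
Definition in_closure_image (f : C -> C) (w : C) : Prop :=
  forall eps : R, eps > 0 -> exists z, in_disc z /\ Cmod (f z - w) < eps.
Definition in_interior_image (f : C -> C) (w : C) : Prop :=
  exists eps : R, eps > 0 /\ forall u : C, Cmod (u - w) < eps -> in_image f u.
Definition in_boundary_image (f : C -> C) (w : C) : Prop :=
  in_closure_image f w /\ ~ in_interior_image f w.

Definition dist0_boundary (f : C -> C) : Rbar :=
  Glb_Rbar (fun d => exists w, in_boundary_image f w /\ d = Cmod w).

Definition S_area (a : nat -> C) (r : R) : R :=
  PI * Series (fun n => INR n * (Cmod (a n)) ^ 2 * r ^ (2 * n)).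

Definition F_fun (Phi : R -> R) (r : R) : R :=
  r / (1 - r) ^ 2 + Phi r * (r ^ 2 * (1 + 4 * r ^ 2 + r ^ 4) / (1 - r ^ 2) ^ 4) - 1 / 4.

Definition lhs_sum (Phi : R -> R) (a : nat -> C) (w : C -> C) (z : C) : R :=
  Cmod (w z)
  + Series (fun n => Cmod (a (n + 2)%nat) * Cmod (w z) ^ (n + 2))
  + Phi (Cmod (w z)) * (S_area a (Cmod z) / PI).

Definition admissible_Phi (Phi : R -> R) : Prop :=
  (forall x, 0 <= x <= 1 -> 0 <= Phi x) /\
  (forall x y, 0 <= x <= 1 -> 0 <= y <= 1 -> x <= y -> Phi x <= Phi y) /\
  (forall x, 0 <= x <= 1 -> forall eps, eps > 0 -> exists delta, delta > 0 /\
     forall y, 0 <= y <= 1 -> Rabs (y - x) < delta -> Rabs (Phi y - Phi x) < eps).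

(* Main.v *)
Require Import Defs.
From Stdlib Require Import Reals Lra Lia Classical ClassicalEpsilon Ranalysis5.
From Coquelicot Require Import Coquelicot.
Open Scope R_scope.

(** A typically real [f = sum a_n z^n] has real coefficients, and
    [Im f (r e^{it}) = sum a_n r^n sin (n t)] is nonnegative on [0, pi]. Pairing it with another
    nonnegative sine series [sum c_n sin (n t)] gives [sum c_n a_n r^n >= 0] by orthogonality;
    [c = n sin t +- sin (n t)] yields Rogosinski's bound [|a_n| <= n].

    The image of [f] contains the disc of radius 1/4 (after Goodman). If [f] omits a nonreal [c],
    it omits [conj c] as well, and [g = -i log ((f - c) / (f - conj c))] is, up to normalization,
    again typically real. On the real axis [g] is an explicit arctangent, so the sum of its total
    variations on the two halves of (-1, 1) is at most [2 pi], while the positivity of the pairing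
    bounds [1/g(x) - 1/g(-x)] from above by [2 (x + 1/x) / g'(0)]. Together these force [|c| >= 1/4].
    Expanding [g'] in a power series needs Cauchy's formula, and the Schwarz lemma is needed for a
    function that is only assumed to be complex differentiable, hence Goursat's lemma.

    With [|a_n| <= n] and [|w z| <= |z|] the left-hand side is at most [F |z| + 1/4], and the Koebe
    function [z / (1 - z)^2], whose image has -1/4 on its boundary, attains this value. *)

(** * Complex derivatives and curves *)

(** A logarithm of a complex function would need a branch, so [g] is not formed as one. Its
    derivative is rational in [f] and [f'], hence holomorphic once [c] and [conj c] are omitted; [g]
    is the termwise primitive of a Taylor expansion of that derivative. Differentiation along rays
    recovers the rest: [Im g] is a difference of real logarithms of moduli, nonnegative where [Im f]
    is because such a value is no nearer to [conj c] than to [c], and [g] on the axis is an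
    arctangent. The bound on reciprocals is used in a dual, linear form. Put [q = Im c],
    [psi = atan (Re c / q)], [A = PI - 2 psi], [B = PI + 2 psi]. On the axis [g] lies between [- A]
    and [B]; the kernels at [x] and [- x] get the weights [A^2] and [B^2], for which inserting these
    bounds gives [1/A + 1/B <= 2 (x + 1/x) / g'(0)]. As [x] tends to 1 this becomes
    [PI q / |c|^2 <= A B = PI^2 - 4 psi^2]. The right-hand side is at most
    [4 PI cos psi = 4 PI q / |c|], whence the constant 1/4. *)

Definition cderiv (h : C -> C) (z l : C) : Prop :=
  forall eps, 0 < eps -> exists delta, 0 < delta /\
    forall u, Cmod (u - z) < delta ->
      Cmod (h u - h z - l * (u - z)) <= eps * Cmod (u - z).

Lemma C_ext (z w : C) : Re z = Re w -> Im z = Im w -> z = w.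
Proof. destruct z, w; simpl; intros; subst; reflexivity. Qed.

Lemma Cmod_sub_le (z w : C) : Cmod (z - w) <= Cmod z + Cmod w.
Proof. unfold Cminus; rewrite <- (Cmod_opp w); apply Cmod_triangle. Qed.

Lemma im_le_Cmod (z : C) : Rabs (Im z) <= Cmod z.
Proof. eapply Rle_trans; [apply Rmax_r | apply Rmax_Cmod]. Qed.

Lemma Cmod_le_parts (z : C) : Cmod z <= Rabs (Re z) + Rabs (Im z).
Proof.
  replace z with (RtoC (Re z) + Ci * RtoC (Im z))%C at 1
    by (apply C_ext; unfold Re, Im; simpl; ring).
  eapply Rle_trans; [apply Cmod_triangle|].
  rewrite Cmod_mult, Cmod_Ci, !Cmod_R; lra.
Qed.

Lemma cderiv_const (c z : C) : cderiv (fun _ => c) z 0.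
Proof.
  intros e He; exists 1; split; [lra|]; intros u _.
  replace (c - c - 0 * (u - z))%C with (RtoC 0) by ring.
  rewrite Cmod_0; apply Rmult_le_pos; [lra | apply Cmod_ge_0].
Qed.

Lemma cderiv_id (z : C) : cderiv (fun u => u) z 1.
Proof.
  intros e He; exists 1; split; [lra|]; intros u _.
  replace (u - z - 1 * (u - z))%C with (RtoC 0) by ring.
  rewrite Cmod_0; apply Rmult_le_pos; [lra | apply Cmod_ge_0].
Qed.

Lemma cderiv_lip (h : C -> C) (z l : C) : cderiv h z l ->
  exists delta, 0 < delta /\ forall u, Cmod (u - z) < delta ->
    Cmod (h u - h z) <= (Cmod l + 1) * Cmod (u - z).
Proof.
  intros H; destruct (H 1 Rlt_0_1) as [d [Hd Hu]]; exists d; split; auto.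
  intros u Huz; specialize (Hu u Huz).
  replace (h u - h z)%C with ((h u - h z - l * (u - z)) + l * (u - z))%C by ring.
  eapply Rle_trans; [apply Cmod_triangle|]; rewrite Cmod_mult; lra.
Qed.

Lemma cderiv_continuous (h : C -> C) (z l : C) : cderiv h z l ->
  forall eps, 0 < eps -> exists delta, 0 < delta /\
    forall u, Cmod (u - z) < delta -> Cmod (h u - h z) < eps.
Proof.
  intros H e He; destruct (cderiv_lip h z l H) as [d [Hd Hu]].
  assert (Hl : 0 < Cmod l + 1) by (pose proof (Cmod_ge_0 l); lra).
  exists (Rmin d (e / (Cmod l + 1))); split.
  - apply Rmin_pos; auto; apply Rdiv_lt_0_compat; auto.
  - intros u Huz; eapply Rle_lt_trans.
    + apply Hu; eapply Rlt_le_trans; [exact Huz | apply Rmin_l].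
    + replace e with ((Cmod l + 1) * (e / (Cmod l + 1))) by (field; lra).
      apply Rmult_lt_compat_l; auto.
      eapply Rlt_le_trans; [exact Huz | apply Rmin_r].
Qed.

Lemma cderiv_plus (f g : C -> C) (z l m : C) :
  cderiv f z l -> cderiv g z m -> cderiv (fun u => f u + g u)%C z (l + m).
Proof.
  intros Hf Hg e He.
  destruct (Hf (e / 2)) as [d1 [Hd1 H1]]; [lra|].
  destruct (Hg (e / 2)) as [d2 [Hd2 H2]]; [lra|].
  exists (Rmin d1 d2); split; [apply Rmin_pos; auto|]; intros u Hu.
  specialize (H1 u (Rlt_le_trans _ _ _ Hu (Rmin_l _ _))).
  specialize (H2 u (Rlt_le_trans _ _ _ Hu (Rmin_r _ _))).
  replace (f u + g u - (f z + g z) - (l + m) * (u - z))%C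
    with ((f u - f z - l * (u - z)) + (g u - g z - m * (u - z)))%C by ring.
  eapply Rle_trans; [apply Cmod_triangle|]; lra.
Qed.

Lemma cderiv_sub (a u : C) : cderiv (fun u => (u - a)%C) u 1.
Proof.
  replace (RtoC 1) with (1 + 0)%C by ring.
  apply (cderiv_plus (fun u => u) (fun _ => (- a)%C)); [apply cderiv_id | apply cderiv_const].
Qed.

Lemma cderiv_mult (f g : C -> C) (z l m : C) :
  cderiv f z l -> cderiv g z m ->
  cderiv (fun u => f u * g u)%C z (l * g z + f z * m).
Proof.
  intros Hf Hg e He.
  pose proof (Cmod_ge_0 (f z)) as Pf; pose proof (Cmod_ge_0 (g z)) as Pg; pose proof (Cmod_ge_0 l) as Pl.
  set (K := Cmod (f z) + Cmod (g z) + Cmod l + 2).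
  assert (HK : 0 < K) by (unfold K; lra).
  assert (HeK : 0 < e / K) by (apply Rdiv_lt_0_compat; lra).
  destruct (Hf (e / K) HeK) as [d1 [Hd1 H1]].
  destruct (Hg (e / K) HeK) as [d2 [Hd2 H2]].
  destruct (cderiv_lip f z l Hf) as [d3 [Hd3 H3]].
  destruct (cderiv_continuous g z m Hg (Rmin 1 (e / K))) as [d4 [Hd4 H4]];
    [apply Rmin_pos; lra|].
  exists (Rmin (Rmin d1 d2) (Rmin d3 d4)); split; [repeat apply Rmin_pos; auto|].
  intros u Hu.
  apply Rmin_Rgt in Hu; destruct Hu as [Hu Hu'].
  apply Rmin_Rgt in Hu; apply Rmin_Rgt in Hu'.
  specialize (H1 u (proj1 Hu)); specialize (H2 u (proj2 Hu)).
  specialize (H3 u (proj1 Hu')); specialize (H4 u (proj2 Hu')).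
  assert (H4' : Cmod (g u - g z) <= e / K)
    by (pose proof (Rmin_r 1 (e / K)); lra).
  replace (f u * g u - f z * g z - (l * g z + f z * m) * (u - z))%C
    with ((f u - f z - l * (u - z)) * g z + f z * (g u - g z - m * (u - z))
          + (f u - f z) * (g u - g z))%C by ring.
  eapply Rle_trans; [apply Cmod_triangle|].
  eapply Rle_trans; [apply Rplus_le_compat_r, Cmod_triangle|].
  rewrite !Cmod_mult.
  set (D := Cmod (u - z)) in *; assert (0 <= D) by apply Cmod_ge_0.
  replace (e * D) with (K * (e / K * D)) by (field; lra).
  set (k := e / K) in *.
  assert (Cmod (f u - f z) * Cmod (g u - g z) <= (Cmod l + 1) * D * k).
  { apply Rmult_le_compat; auto using Cmod_ge_0. }
  assert (Cmod (f u - f z - l * (u - z)) * Cmod (g z) <= k * D * Cmod (g z))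
    by (apply Rmult_le_compat_r; auto).
  assert (Cmod (f z) * Cmod (g u - g z - m * (u - z)) <= Cmod (f z) * (k * D))
    by (apply Rmult_le_compat_l; auto).
  assert (0 <= k * D) by (apply Rmult_le_pos; lra).
  unfold K; nra.
Qed.

Lemma cderiv_inv (f : C -> C) (z l : C) : f z <> 0 ->
  cderiv f z l -> cderiv (fun u => / f u)%C z (- l / (f z * f z)).
Proof.
  intros Hz Hf e He.
  assert (Hm : 0 < Cmod (f z)) by (apply Cmod_gt_0; auto).
  set (m := Cmod (f z)) in *.
  pose proof (Cmod_ge_0 l) as Pl.
  (* Where [|f u| > m / 2], the denominator [f u * f z ^ 2] of the increment has modulus at least
     [m ^ 3 / 2]. The two tolerances below give each of the two terms of the numerator half of [e]
     times this bound. *)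
  assert (Hm2 : 0 < m * m / 2) by nra.
  destruct (Hf (e / 2 * (m * m / 2))) as [d1 [Hd1 H1]]; [nra|].
  set (q := e / 2 * (m * m / 2) * m / (Cmod l + 1)).
  assert (Hq : 0 < q).
  { unfold q; apply Rdiv_lt_0_compat; [|lra]. repeat apply Rmult_lt_0_compat; lra. }
  destruct (cderiv_continuous f z l Hf (Rmin (m / 2) q)) as [d2 [Hd2 H2]];
    [apply Rmin_pos; lra|].
  exists (Rmin d1 d2); split; [apply Rmin_pos; auto|]; intros u Hu.
  specialize (H1 u (Rlt_le_trans _ _ _ Hu (Rmin_l _ _))).
  specialize (H2 u (Rlt_le_trans _ _ _ Hu (Rmin_r _ _))).
  assert (Hmu : m / 2 < Cmod (f u)).
  { pose proof (Rmin_l (m / 2) q).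
    assert (m <= Cmod (f u) + Cmod (f u - f z)).
    { unfold m; replace (f z) with (f u - (f u - f z))%C at 1 by ring; apply Cmod_sub_le. }
    lra. }
  assert (Hu0 : f u <> 0) by (intro E; rewrite E, Cmod_0 in Hmu; lra).
  replace (/ f u - / f z - - l / (f z * f z) * (u - z))%C
    with ((l * (u - z) * (f u - f z) - f z * (f u - f z - l * (u - z)))
            / (f u * (f z * f z)))%C by (field; auto).
  rewrite Cmod_div by (repeat apply Cmult_neq_0; auto).
  set (D := Cmod (u - z)) in *; assert (0 <= D) by apply Cmod_ge_0.
  assert (Hden : m * m / 2 * m <= Cmod (f u * (f z * f z))).
  { rewrite !Cmod_mult; fold m; nra. }
  assert (Hd0 : 0 < m * m / 2 * m) by nra.
  apply Rmult_le_reg_r with (Cmod (f u * (f z * f z))); [lra|].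
  unfold Rdiv at 1; rewrite Rmult_assoc, Rinv_l, Rmult_1_r by lra.
  eapply Rle_trans; [apply Cmod_sub_le|]; rewrite !Cmod_mult; fold m D.
  apply Rle_trans with (e * D * (m * m / 2 * m));
    [|rewrite !Cmod_mult in Hden; apply Rmult_le_compat_l; [nra | exact Hden]].
  assert (m * Cmod (f u - f z - l * (u - z)) <= m * (e / 2 * (m * m / 2) * D))
    by (apply Rmult_le_compat_l; lra).
  assert (Cmod l * D * Cmod (f u - f z) <= e / 2 * (m * m / 2) * m * D).
  { pose proof (Rmin_r (m / 2) q).
    apply Rle_trans with ((Cmod l + 1) * D * q).
    - apply Rmult_le_compat; [nra | apply Cmod_ge_0 | nra | lra].
    - unfold q; right; field; lra. }
  lra.
Qed.

(** The value of the derivative is left open: powers serve only for continuity on circles and for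
    the power trick in the Schwarz lemma. *)
Lemma cderiv_pow (f : C -> C) (z l : C) (n : nat) : cderiv f z l ->
  exists m, cderiv (fun u => (f u) ^ n)%C z m.
Proof.
  intros Hf; induction n as [|n [m IH]].
  - exists 0%C; exact (cderiv_const 1%C z).
  - eexists; exact (cderiv_mult f _ z l m Hf IH).
Qed.

(** * Curves in the plane, by components and by estimates of the modulus *)

Lemma is_derive_parts (g : R -> C) (t : R) (l : C) :
  is_derive (fun s => Re (g s)) t (Re l) -> is_derive (fun s => Im (g s)) t (Im l) ->
  is_derive (V := C_R_NormedModule) g t l.
Proof.
  intros H1 H2.
  apply is_derive_Reals in H1; apply is_derive_Reals in H2.
  split; [apply (is_linear_scal_l (V := C_R_NormedModule))|].
  intros x Hx; apply (is_filter_lim_locally_unique (V := R_NormedModule)) in Hx; subst x.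
  intros e.
  assert (He : 0 < e / 2) by (destruct e; simpl; lra).
  destruct (H1 (e / 2) He) as [d1 Hd1]; destruct (H2 (e / 2) He) as [d2 Hd2].
  assert (Hd : 0 < Rmin d1 d2) by (apply Rmin_pos; [apply d1 | apply d2]).
  exists (mkposreal _ Hd); intros y Hy; change R in (type of y).
  change (Rabs (y - t) < Rmin d1 d2) in Hy.
  rewrite <- Cmod_norm, scal_R_Cmult.
  change (Cmod (g y - g t - RtoC (y - t) * l) <= e * Rabs (y - t)).
  destruct (Req_dec (y - t) 0) as [E|E].
  { rewrite E, Rabs_R0, Rmult_0_r; apply Rminus_diag_uniq in E; rewrite E.
    replace (g t - g t - 0 * l)%C with (RtoC 0) by ring.
    rewrite Cmod_0; lra. }
  eapply Rle_trans; [apply Cmod_le_parts|].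
  specialize (Hd1 (y - t) E (Rlt_le_trans _ _ _ Hy (Rmin_l _ _))).
  specialize (Hd2 (y - t) E (Rlt_le_trans _ _ _ Hy (Rmin_r _ _))).
  replace (t + (y - t)) with y in Hd1, Hd2 by ring.
  assert (P : forall A b h, h <> 0 -> Rabs (A / h - b) < e / 2 -> Rabs (A - h * b) <= e / 2 * Rabs h).
  { intros A b h Hh HA; replace (A - h * b) with ((A / h - b) * h) by (field; auto).
    rewrite Rabs_mult; apply Rmult_le_compat_r; [apply Rabs_pos | lra]. }
  apply P in Hd1; apply P in Hd2; auto.
  replace (Re (g y - g t - RtoC (y - t) * l))
    with (Re (g y) - Re (g t) - (y - t) * Re l) by (unfold Re, Im; simpl; ring).
  replace (Im (g y - g t - RtoC (y - t) * l))
    with (Im (g y) - Im (g t) - (y - t) * Im l) by (unfold Re, Im; simpl; ring).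
  lra.
Qed.

Lemma is_derive_Cestimate (g : R -> C) (t : R) (l : C) :
  is_derive (V := C_R_NormedModule) g t l ->
  forall eps, 0 < eps -> exists delta, 0 < delta /\ forall s, Rabs (s - t) < delta ->
    Cmod (g s - g t - RtoC (s - t) * l) <= eps * Rabs (s - t).
Proof.
  intros [_ H] e He.
  destruct (H t (fun P HP => HP) (mkposreal e He)) as [d Hd].
  exists d; split; [apply d|]; intros s Hs; specialize (Hd s Hs).
  rewrite <- Cmod_norm, scal_R_Cmult in Hd; exact Hd.
Qed.

Lemma Cestimate_is_derive (g : R -> C) (t : R) (l : C) :
  (forall eps, 0 < eps -> exists delta, 0 < delta /\ forall s, Rabs (s - t) < delta ->
    Cmod (g s - g t - RtoC (s - t) * l) <= eps * Rabs (s - t)) ->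
  is_derive (V := C_R_NormedModule) g t l.
Proof.
  intros H.
  split; [apply (is_linear_scal_l (V := C_R_NormedModule))|].
  intros x Hx; apply (is_filter_lim_locally_unique (V := R_NormedModule)) in Hx; subst x.
  intros e; destruct (H e (cond_pos e)) as [d [Hd Hs]].
  exists (mkposreal d Hd); intros s Hst; specialize (Hs s Hst).
  rewrite <- Cmod_norm, scal_R_Cmult; exact Hs.
Qed.

Lemma is_derive_re_im (g : R -> C) (t : R) (l : C) :
  is_derive (V := C_R_NormedModule) g t l ->
  is_derive (fun s => Re (g s)) t (Re l) /\ is_derive (fun s => Im (g s)) t (Im l).
Proof.
  intros H; pose proof (is_derive_Cestimate g t l H) as E.
  split; (split; [apply @is_linear_scal_l|]);
    intros x Hx; apply (is_filter_lim_locally_unique (V := R_NormedModule)) in Hx; subst x;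
    intros e; destruct (E e (cond_pos e)) as [d [Hd Hs]];
    exists (mkposreal d Hd); intros s Hst; specialize (Hs s Hst).
  - eapply Rle_trans; [|exact Hs].
    eapply Rle_trans; [|apply re_le_Cmod]. right.
    change (Rabs (Re (g s) - Re (g t) - (s - t) * Re l) = Rabs (Re (g s - g t - RtoC (s - t) * l))).
    f_equal; unfold Re, Im; simpl; ring.
  - eapply Rle_trans; [|exact Hs].
    eapply Rle_trans; [|apply im_le_Cmod]. right.
    change (Rabs (Im (g s) - Im (g t) - (s - t) * Im l) = Rabs (Im (g s - g t - RtoC (s - t) * l))).
    f_equal; unfold Re, Im; simpl; ring.
Qed.

Lemma is_derive_comp_curve (h : C -> C) (g : R -> C) (t : R) (l p : C) :
  cderiv h (g t) l -> is_derive (V := C_R_NormedModule) g t p ->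
  is_derive (V := C_R_NormedModule) (fun s => h (g s)) t (l * p)%C.
Proof.
  intros Hh Hg; apply Cestimate_is_derive; intros e He.
  pose proof (Cmod_ge_0 l) as Pl; pose proof (Cmod_ge_0 p) as Pp.
  (* The bound 1 makes [g] Lipschitz at [t] with constant [Cmod p + 1]; the other bound keeps the
     error of [g], multiplied by [l], within [e / 2]. *)
  set (e1 := Rmin 1 (e / 2 / (Cmod l + 1))).
  assert (He1 : 0 < e1) by (apply Rmin_pos; [lra | repeat apply Rdiv_lt_0_compat; lra]).
  assert (Hl1 : Cmod l * e1 <= e / 2).
  { apply Rle_trans with ((Cmod l + 1) * (e / 2 / (Cmod l + 1))); [|right; field; lra].
    apply Rmult_le_compat; try lra; apply Rmin_r. }
  assert (H11 : e1 <= 1) by apply Rmin_l.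
  destruct (is_derive_Cestimate g t p Hg e1 He1) as [d1 [Hd1 H1]].
  destruct (Hh (e / 2 / (Cmod p + 1))) as [d2 [Hd2 H2]]; [repeat apply Rdiv_lt_0_compat; lra|].
  exists (Rmin d1 (d2 / (Cmod p + 1))); split.
  { apply Rmin_pos; auto; apply Rdiv_lt_0_compat; lra. }
  intros s Hs; apply Rmin_Rgt in Hs; destruct Hs as [Hs1 Hs2].
  specialize (H1 s Hs1).
  set (D := Rabs (s - t)) in *; assert (0 <= D) by apply Rabs_pos.
  assert (Hgs : Cmod (g s - g t) <= (Cmod p + 1) * D).
  { replace (g s - g t)%C with ((g s - g t - RtoC (s - t) * p) + RtoC (s - t) * p)%C by ring.
    eapply Rle_trans; [apply Cmod_triangle|]; rewrite Cmod_mult, Cmod_R; fold D; nra. }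
  assert (Hgd : Cmod (g s - g t) < d2).
  { eapply Rle_lt_trans; [exact Hgs|].
    replace d2 with ((Cmod p + 1) * (d2 / (Cmod p + 1))) by (field; lra).
    apply Rmult_lt_compat_l; lra. }
  specialize (H2 (g s) Hgd).
  replace (h (g s) - h (g t) - RtoC (s - t) * (l * p))%C
    with ((h (g s) - h (g t) - l * (g s - g t)) + l * (g s - g t - RtoC (s - t) * p))%C by ring.
  eapply Rle_trans; [apply Cmod_triangle|]; rewrite Cmod_mult.
  assert (Cmod l * Cmod (g s - g t - RtoC (s - t) * p) <= Cmod l * (e1 * D))
    by (apply Rmult_le_compat_l; lra).
  assert (e / 2 / (Cmod p + 1) * Cmod (g s - g t) <= e / 2 * D).
  { apply Rle_trans with (e / 2 / (Cmod p + 1) * ((Cmod p + 1) * D)); [|right; field; lra].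
    apply Rmult_le_compat_l; auto. left; repeat apply Rdiv_lt_0_compat; lra. }
  nra.
Qed.

(** The uniform structure of the plane is that of a product, so its balls are boxes; comparing them
    with the balls of the norm turns continuity into estimates of [Cmod]. *)
Lemma continuous_Cestimate (g : R -> C) (t : R) :
  continuous (U := C_R_NormedModule) g t <->
  forall eps, 0 < eps -> exists delta, 0 < delta /\ forall s, Rabs (s - t) < delta ->
    Cmod (g s - g t) < eps.
Proof.
  split.
  - intros H e He.
    assert (L : locally (g t) (fun y : C_R_NormedModule => Cmod (y - g t) < e)).
    { apply (locally_le_locally_norm (V := C_R_NormedModule)).
      exists (mkposreal e He); intros y Hy; unfold ball_norm in Hy.
      rewrite <- Cmod_norm in Hy; exact Hy. }
    destruct (H _ L) as [d Hd]; exists d; split; [apply d | exact Hd].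
  - intros H P HP.
    apply (locally_norm_le_locally (V := C_R_NormedModule)) in HP.
    destruct HP as [e He]; destruct (H e (cond_pos e)) as [d [Hd Hs]].
    exists (mkposreal d Hd); intros s Hst; apply He; unfold ball_norm.
    rewrite <- Cmod_norm; exact (Hs s Hst).
Qed.

Lemma continuous_Cmult (f g : R -> C) (t : R) :
  continuous (U := C_R_NormedModule) f t -> continuous (U := C_R_NormedModule) g t ->
  continuous (U := C_R_NormedModule) (fun s => f s * g s)%C t.
Proof.
  rewrite !continuous_Cestimate; intros Hf Hg e He.
  pose proof (Cmod_ge_0 (f t)) as Pf; pose proof (Cmod_ge_0 (g t)) as Pg.
  set (k := e / (Cmod (f t) + Cmod (g t) + 1)).
  assert (Hk : 0 < k) by (apply Rdiv_lt_0_compat; lra).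
  destruct (Hf (Rmin 1 k)) as [d1 [Hd1 H1]]; [apply Rmin_pos; lra|].
  destruct (Hg k) as [d2 [Hd2 H2]]; [auto|].
  exists (Rmin d1 d2); split; [apply Rmin_pos; auto|]; intros s Hs.
  specialize (H1 s (Rlt_le_trans _ _ _ Hs (Rmin_l _ _))).
  specialize (H2 s (Rlt_le_trans _ _ _ Hs (Rmin_r _ _))).
  apply Rmin_Rgt in H1; destruct H1 as [H1 H1'].
  replace (f s * g s - f t * g t)%C
    with (f t * (g s - g t) + (f s - f t) * g t + (f s - f t) * (g s - g t))%C by ring.
  eapply Rle_lt_trans; [apply Cmod_triangle|].
  eapply Rle_lt_trans; [apply Rplus_le_compat_r, Cmod_triangle|]; rewrite !Cmod_mult.
  pose proof (Cmod_ge_0 (f s - f t)); pose proof (Cmod_ge_0 (g s - g t)).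
  replace e with ((Cmod (f t) + Cmod (g t) + 1) * k) by (unfold k; field; lra).
  nra.
Qed.

Lemma continuous_comp_curve (h : C -> C) (g : R -> C) (t : R) (l : C) :
  cderiv h (g t) l -> continuous (U := C_R_NormedModule) g t ->
  continuous (U := C_R_NormedModule) (fun s => h (g s)) t.
Proof.
  rewrite !continuous_Cestimate; intros Hh Hg e He.
  destruct (cderiv_continuous h _ l Hh e He) as [d1 [Hd1 H1]].
  destruct (Hg d1 Hd1) as [d [Hd H]]; exists d; split; auto.
Qed.

(** The integral is linear over the reals only, so a complex factor is treated through real and
    imaginary parts. *)
Lemma is_RInt_Cmult_l (f : R -> C) (a b : R) (c l : C) :
  is_RInt (V := C_R_NormedModule) f a b l ->
  is_RInt (V := C_R_NormedModule) (fun x => c * f x)%C a b (c * l)%C.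
Proof.
  intros H.
  pose proof (is_RInt_fct_extend_fst (U := R_NormedModule) (V := R_NormedModule) f a b l H) as H1.
  pose proof (is_RInt_fct_extend_snd (U := R_NormedModule) (V := R_NormedModule) f a b l H) as H2.
  apply (is_RInt_fct_extend_pair (U := R_NormedModule) (V := R_NormedModule)
     (fun x => c * f x)%C a b (fst (c * l)%C) (snd (c * l)%C)).
  - apply (is_RInt_minus (V := R_NormedModule));
      apply (is_RInt_scal (V := R_NormedModule)); auto.
  - apply (is_RInt_plus (V := R_NormedModule));
      apply (is_RInt_scal (V := R_NormedModule)); auto.
Qed.

(** * Goursat's lemma *)

(** An interval of stage [k] is encoded by its left endpoint and the length [l / 2 ^ k]. The common
    point is the supremum of the left endpoints, since every left endpoint stays below every right
    one. *)
Lemma nested_intervals (a : nat -> R) (l : R) : 0 <= l ->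
  (forall k, a k <= a (S k) <= a k + l / 2 ^ S k) ->
  exists u, forall k, a k <= u <= a k + l / 2 ^ k.
Proof.
  intros Hl H.
  assert (P2 : forall k, 0 < 2 ^ k) by (intro; apply pow_lt; lra).
  assert (Hh : forall k, l / 2 ^ k = l / 2 ^ S k + l / 2 ^ S k)
    by (intro k; simpl; specialize (P2 k); field; lra).
  assert (Hq : forall k, 0 <= l / 2 ^ k)
    by (intro k; apply Rdiv_le_0_compat; auto).
  assert (Hup : forall j k, a (k + j)%nat + l / 2 ^ (k + j) <= a k + l / 2 ^ k).
  { induction j as [|j IH]; intro k; [rewrite Nat.add_0_r; lra|].
    rewrite Nat.add_succ_r; specialize (IH k); specialize (H (k + j)%nat).
    rewrite (Hh (k + j)%nat) in IH; lra. }
  assert (Hlo : forall j k, a k <= a (k + j)%nat).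
  { induction j as [|j IH]; intro k; [rewrite Nat.add_0_r; lra|].
    rewrite Nat.add_succ_r; specialize (IH k); specialize (H (k + j)%nat); lra. }
  assert (Hle : forall j k, a j <= a k + l / 2 ^ k).
  { intros j k; destruct (Nat.le_ge_cases j k) as [E|E].
    - replace k with (j + (k - j))%nat by lia.
      specialize (Hlo (k - j)%nat j); specialize (Hq (j + (k - j))%nat); lra.
    - replace j with (k + (j - k))%nat by lia.
      specialize (Hup (j - k)%nat k); specialize (Hq (k + (j - k))%nat); lra. }
  destruct (completeness (fun x => exists k, x = a k)) as [u [Hu1 Hu2]].
  - exists (a 0%nat + l / 2 ^ 0); intros x [k ->]; apply Hle.
  - exists (a 0%nat), 0%nat; reflexivity.
  - exists u; intro k; split.
    + apply Hu1; exists k; reflexivity.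
    + apply Hu2; intros x [j ->]; apply Hle.
Qed.

(** Goursat's bisection, for an arbitrary additive function of rectangles. If the value on the whole
    were not 0, one of four quarters would keep at least a fourth of the modulus at each stage. The
    chosen rectangles shrink to a point, where the local bound, quadratic in the perimeter with an
    arbitrarily small factor, is violated. *)
Lemma rectangle_bisection (B : R -> R -> R -> R -> C) (a0 b0 c0 d0 : R) :
  a0 <= b0 -> c0 <= d0 ->
  (forall a m b c d, a0 <= a -> a <= m -> m <= b -> b <= b0 -> c0 <= c -> c <= d -> d <= d0 ->
     B a b c d = (B a m c d + B m b c d)%C) ->
  (forall a b c m d, a0 <= a -> a <= b -> b <= b0 -> c0 <= c -> c <= m -> m <= d -> d <= d0 ->
     B a b c d = (B a b c m + B a b m d)%C) ->
  (forall u v, a0 <= u <= b0 -> c0 <= v <= d0 -> forall eps, 0 < eps ->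
     exists delta, 0 < delta /\ forall a b c d,
       a0 <= a -> a <= u <= b -> b <= b0 -> c0 <= c -> c <= v <= d -> d <= d0 ->
       b - a < delta -> d - c < delta ->
       Cmod (B a b c d) <= eps * ((b - a) + (d - c)) ^ 2) ->
  B a0 b0 c0 d0 = 0%C.
Proof.
  intros Hab Hcd Hs1 Hs2 Hloc.
  apply NNPP; intro Hne.
  set (eta := Cmod (B a0 b0 c0 d0)).
  assert (Heta : 0 < eta) by (apply Cmod_gt_0; auto).
  set (l := b0 - a0); set (m := d0 - c0).
  assert (P2 : forall k, 0 < 2 ^ k) by (intro; apply pow_lt; lra).
  set (Inv := fun (k : nat) (p : R * R) =>
     a0 <= fst p /\ fst p + l / 2 ^ k <= b0 /\ c0 <= snd p /\ snd p + m / 2 ^ k <= d0 /\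
     eta <= 4 ^ k * Cmod (B (fst p) (fst p + l / 2 ^ k) (snd p) (snd p + m / 2 ^ k))).
  assert (Step : forall k p, Inv k p -> exists q, Inv (S k) q /\
     (fst p <= fst q <= fst p + l / 2 ^ S k) /\ (snd p <= snd q <= snd p + m / 2 ^ S k)).
  { intros k [a c] (H1 & H2 & H3 & H4 & H5); simpl fst in *; simpl snd in *.
    assert (Hl : 0 <= l / 2 ^ S k) by (apply Rdiv_le_0_compat; [unfold l; lra | auto]).
    assert (Hm : 0 <= m / 2 ^ S k) by (apply Rdiv_le_0_compat; [unfold m; lra | auto]).
    replace (l / 2 ^ k) with (l / 2 ^ S k + l / 2 ^ S k) in *
      by (simpl; specialize (P2 k); field; lra).
    replace (m / 2 ^ k) with (m / 2 ^ S k + m / 2 ^ S k) in *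
      by (simpl; specialize (P2 k); field; lra).
    set (x := l / 2 ^ S k) in *; set (y := m / 2 ^ S k) in *.
    (* If all four quarters fell below the required size, their sum would too, against
       additivity. *)
    apply NNPP; intro HN.
    assert (K : forall i j, a <= i <= a + x -> c <= j <= c + y ->
              4 * 4 ^ k * Cmod (B i (i + x) j (j + y)) < eta).
    { intros i j Hi Hj; apply Rnot_le_lt; intro Hc; apply HN.
      exists (i, j); split; [|simpl; auto].
      unfold Inv; simpl fst; simpl snd; fold x y; repeat split; try lra. exact Hc. }
    pose proof (K a c ltac:(lra) ltac:(lra)) as K1.
    pose proof (K (a + x) c ltac:(lra) ltac:(lra)) as K2.
    pose proof (K a (c + y) ltac:(lra) ltac:(lra)) as K3.
    pose proof (K (a + x) (c + y) ltac:(lra) ltac:(lra)) as K4.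
    rewrite (Hs1 a (a + x)) in H5 by lra.
    rewrite (Hs2 a (a + x) c (c + y)), (Hs2 (a + x) (a + (x + x)) c (c + y)) in H5 by lra.
    replace (a + (x + x)) with (a + x + x) in H5 by ring.
    replace (c + (y + y)) with (c + y + y) in H5 by ring.
    assert (T : forall p q r s : C, Cmod (p + q + (r + s)) <= Cmod p + Cmod q + Cmod r + Cmod s).
    { intros p q r s. eapply Rle_trans; [apply Cmod_triangle|].
      pose proof (Cmod_triangle p q); pose proof (Cmod_triangle r s); lra. }
    assert (P4 : 0 < 4 ^ k) by (apply pow_lt; lra).
    pose proof (Rle_trans _ _ _ H5 (Rmult_le_compat_l (4 ^ k) _ _ (Rlt_le _ _ P4) (T _ _ _ _))). lra. }
  set (next := fun k (s : {p | Inv k p}) =>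
     let (q, Hq) := constructive_indefinite_description _ (Step k (proj1_sig s) (proj2_sig s)) in
     exist (Inv (S k)) q (proj1 Hq)).
  assert (I0 : Inv 0%nat (a0, c0)).
  { unfold Inv; simpl fst; simpl snd; rewrite !pow_O.
    replace (a0 + l / 1) with b0 by (unfold l; field).
    replace (c0 + m / 1) with d0 by (unfold m; field).
    repeat split; try lra. fold eta; lra. }
  set (sq := nat_rect (fun k => {p | Inv k p}) (exist _ _ I0) next).
  assert (Hsq : forall k,
     (fst (proj1_sig (sq k)) <= fst (proj1_sig (sq (S k))) <= fst (proj1_sig (sq k)) + l / 2 ^ S k) /\
     (snd (proj1_sig (sq k)) <= snd (proj1_sig (sq (S k))) <= snd (proj1_sig (sq k)) + m / 2 ^ S k)).
  { intro k; change (sq (S k)) with (next k (sq k)); unfold next.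
    destruct (constructive_indefinite_description _ _) as [q Hq]; simpl proj1_sig; tauto. }
  destruct (nested_intervals (fun k => fst (proj1_sig (sq k))) l) as [u Hu];
    [unfold l; lra | intro; apply Hsq |].
  destruct (nested_intervals (fun k => snd (proj1_sig (sq k))) m) as [v Hv];
    [unfold m; lra | intro; apply Hsq |].
  assert (Inq : forall k, Inv k (proj1_sig (sq k))) by (intro k; exact (proj2_sig (sq k))).
  cbv beta in Hu, Hv.
  set (L := (l + m) ^ 2).
  assert (HL : 0 <= L) by apply pow2_ge_0.
  (* The half perimeter at stage [k] is [(l + m) / 2 ^ k], with square [L / 4 ^ k], so this
     tolerance yields [eta <= eta * L / (L + 1)], which is absurd. *)
  destruct (Hloc u v) with (eps := eta / (L + 1)) as [dl [Hdl HB]].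
  - specialize (Hu 0%nat); destruct (Inq 0%nat) as (I1 & I2 & I3 & I4 & _); lra.
  - specialize (Hv 0%nat); destruct (Inq 0%nat) as (I1 & I2 & I3 & I4 & _); lra.
  - apply Rdiv_lt_0_compat; lra.
  - assert (HM : exists k, Rabs l / 2 ^ k < dl /\ Rabs m / 2 ^ k < dl).
    { destruct (pow_lt_1_zero (1 / 2)) with (y := dl / (Rabs l + Rabs m + 1)) as [N HN].
      - rewrite Rabs_pos_eq; lra.
      - apply Rdiv_lt_0_compat; [lra|]; pose proof (Rabs_pos l); pose proof (Rabs_pos m); lra.
      - exists N; specialize (HN N (Nat.le_refl _)).
        pose proof (Rabs_pos l) as A1; pose proof (Rabs_pos m) as A2.
        assert (E : (1 / 2) ^ N = / 2 ^ N) by (unfold Rdiv; rewrite Rmult_1_l, pow_inv; auto).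
        rewrite E, Rabs_pos_eq in HN by (left; apply Rinv_0_lt_compat; auto).
        assert (Q : / 2 ^ N * (Rabs l + Rabs m + 1) < dl).
        { apply Rmult_lt_compat_r with (r := Rabs l + Rabs m + 1) in HN; [|lra].
          unfold Rdiv in HN; rewrite Rmult_assoc, Rinv_l in HN; lra. }
        assert (0 < / 2 ^ N) by (apply Rinv_0_lt_compat; auto).
        unfold Rdiv; split; nra. }
    destruct HM as [k [Hk1 Hk2]].
    rewrite Rabs_pos_eq in Hk1 by (unfold l; lra).
    rewrite Rabs_pos_eq in Hk2 by (unfold m; lra).
    destruct (Inq k) as (I1 & I2 & I3 & I4 & I5).
    specialize (Hu k); specialize (Hv k).
    set (a := fst (proj1_sig (sq k))) in *; set (c := snd (proj1_sig (sq k))) in *.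
    specialize (HB a (a + l / 2 ^ k) c (c + m / 2 ^ k) I1 Hu I2 I3 Hv I4 ltac:(lra) ltac:(lra)).
    replace ((a + l / 2 ^ k - a + (c + m / 2 ^ k - c)) ^ 2) with (L / 4 ^ k) in HB.
    2: { unfold L; replace 4 with (2 * 2) by ring; rewrite Rpow_mult_distr.
         field; specialize (P2 k); lra. }
    assert (P4 : 0 < 4 ^ k) by (apply pow_lt; lra).
    eapply (Rmult_le_compat_l (4 ^ k)) in HB; [|lra].
    pose proof (Rle_trans _ _ _ I5 HB) as H.
    replace (4 ^ k * (eta / (L + 1) * (L / 4 ^ k))) with (eta * L / (L + 1)) in H by (field; lra).
    assert (eta * L / (L + 1) < eta).
    { apply Rmult_lt_reg_r with (L + 1); [lra|].
      unfold Rdiv; rewrite Rmult_assoc, Rinv_l; nra. }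
    lra.
Qed.

(** * Integrals of complex functions of a real variable *)

Definition CInt (f : R -> C) (a b : R) : C := RInt (V := C_R_CompleteNormedModule) f a b.

Lemma CInt_unique (f : R -> C) (a b : R) (l : C) :
  is_RInt (V := C_R_NormedModule) f a b l -> CInt f a b = l.
Proof. exact (is_RInt_unique (V := C_R_CompleteNormedModule) f a b l). Qed.

Lemma CInt_cont (f : R -> C) (a b : R) : a <= b ->
  (forall x, a <= x <= b -> continuous (U := C_R_NormedModule) f x) ->
  is_RInt (V := C_R_NormedModule) f a b (CInt f a b).
Proof.
  intros Hab H; apply (RInt_correct (V := C_R_CompleteNormedModule)).
  apply ex_RInt_continuous; intros z Hz; rewrite Rmin_left, Rmax_right in Hz by lra.
  exact (H z Hz).
Qed.

Lemma CInt_Chasles (f : R -> C) (a m b : R) : a <= m -> m <= b ->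
  (forall x, a <= x <= b -> continuous (U := C_R_NormedModule) f x) ->
  CInt f a b = (CInt f a m + CInt f m b)%C.
Proof.
  intros H1 H2 H; symmetry; apply (RInt_Chasles (V := C_R_CompleteNormedModule));
    eexists; apply CInt_cont; auto; intros; apply H; lra.
Qed.

Lemma CInt_ext (f g : R -> C) (a b : R) : (forall x, f x = g x) -> CInt f a b = CInt g a b.
Proof. intros E; apply (RInt_ext (V := C_R_CompleteNormedModule)); intros; apply E. Qed.

Lemma CInt_plus (f g : R -> C) (a b : R) : a <= b ->
  (forall x, a <= x <= b -> continuous (U := C_R_NormedModule) f x) ->
  (forall x, a <= x <= b -> continuous (U := C_R_NormedModule) g x) ->
  CInt (fun x => f x + g x)%C a b = (CInt f a b + CInt g a b)%C.
Proof.
  intros; apply (RInt_plus (V := C_R_CompleteNormedModule)); eexists; apply CInt_cont; auto.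
Qed.

Lemma CInt_mult_l (f : R -> C) (c : C) (a b : R) : a <= b ->
  (forall x, a <= x <= b -> continuous (U := C_R_NormedModule) f x) ->
  CInt (fun x => c * f x)%C a b = (c * CInt f a b)%C.
Proof.
  intros; apply CInt_unique, is_RInt_Cmult_l, CInt_cont; auto.
Qed.

Lemma CInt_le (f : R -> C) (a b M : R) : a <= b ->
  (forall x, a <= x <= b -> continuous (U := C_R_NormedModule) f x) ->
  (forall x, a <= x <= b -> Cmod (f x) <= M) ->
  Cmod (CInt f a b) <= (b - a) * M.
Proof.
  intros Hab Hc HM; rewrite Cmod_norm.
  eapply (norm_RInt_le_const (V := C_R_NormedModule)); [exact Hab | | apply CInt_cont; auto].
  intros x Hx; rewrite <- Cmod_norm; auto.
Qed.

Section Goursat.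

Variables (gam P Q : R -> R -> C) (h dh : C -> C) (a0 b0 c0 d0 L : R).
Hypothesis Hab : a0 <= b0.
Hypothesis Hcd : c0 <= d0.
Hypothesis HL : 0 <= L.
Hypothesis gam_t : forall t s, is_derive (V := C_R_NormedModule) (fun x => gam x s) t (P t s).
Hypothesis gam_s : forall t s, is_derive (V := C_R_NormedModule) (fun x => gam t x) s (Q t s).
Hypothesis P_cont : forall t s, continuous (U := C_R_NormedModule) (fun x => P x s) t.
Hypothesis Q_cont : forall t s, continuous (U := C_R_NormedModule) (fun x => Q t x) s.
Hypothesis P_bd : forall t s, a0 <= t <= b0 -> c0 <= s <= d0 -> Cmod (P t s) <= L.
Hypothesis Q_bd : forall t s, a0 <= t <= b0 -> c0 <= s <= d0 -> Cmod (Q t s) <= L.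
Hypothesis gam_lip : forall t s t' s', a0 <= t <= b0 -> c0 <= s <= d0 ->
  a0 <= t' <= b0 -> c0 <= s' <= d0 ->
  Cmod (gam t s - gam t' s') <= L * (Rabs (t - t') + Rabs (s - s')).
Hypothesis h_diff : forall t s, a0 <= t <= b0 -> c0 <= s <= d0 ->
  cderiv h (gam t s) (dh (gam t s)).

(** The contour integral of [k] along the image under [gam] of the counterclockwise boundary of a
    rectangle, with [P] and [Q] the partial derivatives of [gam]. The rectangle lies in the
    parameters rather than in the plane, so that a homotopy of circles is treated without cutting it
    into pieces. *)
Definition boundary_int (k : C -> C) (a b c d : R) : C :=
  (CInt (fun t => k (gam t c) * P t c) a b + CInt (fun s => k (gam b s) * Q b s) c d
   - CInt (fun t => k (gam t d) * P t d) a b - CInt (fun s => k (gam a s) * Q a s) c d)%C.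

Lemma edge_t_cont (k dk : C -> C) (t s : R) : cderiv k (gam t s) (dk (gam t s)) ->
  continuous (U := C_R_NormedModule) (fun x => k (gam x s) * P x s)%C t.
Proof.
  intro Hk; apply continuous_Cmult; auto.
  eapply (continuous_comp_curve k (fun x => gam x s)); [exact Hk|].
  apply (ex_derive_continuous (V := C_R_NormedModule)); eexists; apply gam_t.
Qed.

Lemma edge_s_cont (k dk : C -> C) (t s : R) : cderiv k (gam t s) (dk (gam t s)) ->
  continuous (U := C_R_NormedModule) (fun x => k (gam t x) * Q t x)%C s.
Proof.
  intro Hk; apply continuous_Cmult; auto.
  eapply (continuous_comp_curve k (fun x => gam t x)); [exact Hk|].
  apply (ex_derive_continuous (V := C_R_NormedModule)); eexists; apply gam_s.
Qed.

(** Each edge contributes the difference of [K] at two corners, and around the rectangle these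
    cancel. Differentiability of [k] supplies the continuity of the integrands. *)
Lemma boundary_int_primitive (k K dk : C -> C) (a b c d : R) : a <= b -> c <= d ->
  (forall z, cderiv K z (k z)) -> (forall z, cderiv k z (dk z)) ->
  boundary_int k a b c d = 0%C.
Proof.
  intros H1 H2 HK Hk; unfold boundary_int.
  assert (E1 : forall s, CInt (fun t => k (gam t s) * P t s)%C a b = (K (gam b s) - K (gam a s))%C).
  { intro s; apply CInt_unique.
    apply (is_RInt_derive (V := C_R_CompleteNormedModule) (fun t => K (gam t s))).
    - intros t _; apply (is_derive_comp_curve K (fun x => gam x s)); auto.
    - intros t _; apply (edge_t_cont k dk); auto. }
  assert (E2 : forall t, CInt (fun s => k (gam t s) * Q t s)%C c d = (K (gam t d) - K (gam t c))%C).
  { intro t; apply CInt_unique.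
    apply (is_RInt_derive (V := C_R_CompleteNormedModule) (fun s => K (gam t s))).
    - intros s _; apply (is_derive_comp_curve K (fun x => gam t x)); auto.
    - intros s _; apply (edge_s_cont k dk); auto. }
  rewrite !E1, !E2; ring.
Qed.

Lemma edge_diff_le (k : C -> C) (f : R -> C) (w : R -> C) (a b e : R) (A B z0 : C) : a <= b ->
  (forall x, a <= x <= b -> continuous (U := C_R_NormedModule) (fun x => k (f x) * w x)%C x) ->
  (forall x, a <= x <= b -> continuous (U := C_R_NormedModule) (fun x => (A + B * (f x - z0)) * w x)%C x) ->
  (forall x, a <= x <= b -> Cmod (k (f x) - A - B * (f x - z0)) <= e) ->
  (forall x, a <= x <= b -> Cmod (w x) <= L) -> 0 <= e ->
  Cmod (CInt (fun x => k (f x) * w x)%C a b - CInt (fun x => (A + B * (f x - z0)) * w x)%C a b)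
    <= (b - a) * (e * L).
Proof.
  intros H1 C1 C2 He Hw He0.
  pose proof (is_RInt_minus (V := C_R_NormedModule) _ _ _ _ _ _
    (CInt_cont _ a b H1 C1) (CInt_cont _ a b H1 C2)) as I.
  rewrite Cmod_norm; eapply (norm_RInt_le_const (V := C_R_NormedModule)); [exact H1| |exact I].
  intros x Hx; rewrite <- Cmod_norm.
  change (Cmod (k (f x) * w x - (A + B * (f x - z0)) * w x) <= e * L).
  replace (k (f x) * w x - (A + B * (f x - z0)) * w x)%C
    with ((k (f x) - A - B * (f x - z0)) * w x)%C by ring.
  rewrite Cmod_mult; apply Rmult_le_compat; auto using Cmod_ge_0.
Qed.

(** Near a point [h] is compared with its first-order expansion [k], which has the quadratic
    primitive [K] and thus integral 0. What survives is the remainder, small compared with the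
    diameter, integrated over edges of comparable length: a quadratic bound with a small factor. *)
Lemma goursat : boundary_int h a0 b0 c0 d0 = 0%C.
Proof.
  apply (rectangle_bisection (boundary_int h)); auto.
  - intros a m b c d A1 A2 A3 A4 A5 A6 A7; unfold boundary_int.
    rewrite (CInt_Chasles (fun t => h (gam t c) * P t c)%C a m b),
      (CInt_Chasles (fun t => h (gam t d) * P t d)%C a m b); auto; [ring| |];
      intros x Hx; apply (edge_t_cont h dh), h_diff; lra.
  - intros a b c m d A1 A2 A3 A4 A5 A6 A7; unfold boundary_int.
    rewrite (CInt_Chasles (fun s => h (gam a s) * Q a s)%C c m d),
      (CInt_Chasles (fun s => h (gam b s) * Q b s)%C c m d); auto; [ring| |];
      intros x Hx; apply (edge_s_cont h dh), h_diff; lra.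
  - intros u v Hu Hv e He.
    set (z0 := gam u v).
    (* The remainder is at most [e' * (L * dd)], the speed at most [L] and the edges have total
       parameter length [2 * dd], which gives [2 * L * L * e' * dd ^ 2]. *)
    set (e' := e / (2 * (L * L) + 1)).
    assert (HLL : 0 <= L * L) by (apply Rmult_le_pos; auto).
    assert (He' : 0 < e') by (apply Rdiv_lt_0_compat; lra).
    destruct (h_diff u v Hu Hv e' He') as [dl [Hdl Hh]]; fold z0 in Hh.
    exists (dl / (2 * L + 1)); split; [apply Rdiv_lt_0_compat; lra|].
    intros a b c d A1 A2 A3 A4 A5 A6 A7 A8.
    set (A := h z0) in *; set (B := dh z0) in *.
    set (k := fun z => (A + B * (z - z0))%C).
    set (K := fun z => (A * (z - z0) + B * / 2 * ((z - z0) * (z - z0)))%C).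
    assert (Dsub : forall z, cderiv (fun z => (z - z0)%C) z 1).
    { intro z; replace (RtoC 1) with (1 + 0)%C by ring.
      apply (cderiv_plus (fun z => z) (fun _ => (- z0)%C)); [apply cderiv_id | apply cderiv_const]. }
    assert (HK : forall z, cderiv K z (k z)).
    { intro z; unfold K, k.
      replace (A + B * (z - z0))%C with
        ((0 * (z - z0) + A * 1) + (0 * ((z - z0) * (z - z0)) + B * / 2 * (1 * (z - z0) + (z - z0) * 1)))%C.
      - apply (cderiv_plus (fun z => A * (z - z0))%C (fun z => B * / 2 * ((z - z0) * (z - z0)))%C).
        + apply (cderiv_mult (fun _ => A) (fun z => z - z0)%C); [apply cderiv_const | auto].
        + apply (cderiv_mult (fun _ => B * / 2)%C (fun z => (z - z0) * (z - z0))%C);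
            [apply cderiv_const | apply (cderiv_mult (fun z => z - z0)%C (fun z => z - z0)%C); auto].
      - field. }
    assert (Hk : forall z, cderiv k z (0 + (0 * (z - z0) + B * 1))%C).
    { intro z; unfold k.
      apply (cderiv_plus (fun _ => A) (fun z => B * (z - z0))%C); [apply cderiv_const|].
      apply (cderiv_mult (fun _ => B) (fun z => z - z0)%C); [apply cderiv_const | auto]. }
    pose proof (boundary_int_primitive k K (fun z => 0 + (0 * (z - z0) + B * 1))%C a b c d ltac:(lra) ltac:(lra) HK Hk) as Z.
    set (dd := (b - a) + (d - c)).
    assert (Hdd : 0 <= dd) by (unfold dd; lra).
    assert (Hest : forall t s, a <= t <= b -> c <= s <= d ->
       Cmod (h (gam t s) - A - B * (gam t s - z0)) <= e' * (L * dd)).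
    { intros t s Ht Hs.
      assert (G : Cmod (gam t s - z0) <= L * dd).
      { eapply Rle_trans; [apply gam_lip; lra|]; apply Rmult_le_compat_l; auto.
        unfold dd; apply Rplus_le_compat; apply Rabs_le; lra. }
      eapply Rle_trans; [apply Hh|].
      - eapply Rle_lt_trans; [exact G|].
        apply Rle_lt_trans with (L * (2 * (dl / (2 * L + 1)))).
        + apply Rmult_le_compat_l; auto; unfold dd; lra.
        + apply Rmult_lt_reg_r with (2 * L + 1); [lra|].
          replace (L * (2 * (dl / (2 * L + 1))) * (2 * L + 1)) with (2 * L * dl) by (field; lra). nra.
      - apply Rmult_le_compat_l; lra. }
    assert (HeL : 0 <= e' * (L * dd)) by (apply Rmult_le_pos; [lra | apply Rmult_le_pos; auto]).
    assert (Et : forall s, c <= s <= d ->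
      Cmod (CInt (fun t => h (gam t s) * P t s)%C a b - CInt (fun t => k (gam t s) * P t s)%C a b)
      <= (b - a) * (e' * (L * dd) * L)).
    { intros s Hs.
      apply (edge_diff_le h (fun t => gam t s) (fun t => P t s) a b (e' * (L * dd)) A B z0);
        auto; try lra.
      - intros x Hx; apply (edge_t_cont h dh), h_diff; lra.
      - intros x Hx; exact (edge_t_cont k (fun z => 0 + (0 * (z - z0) + B * 1))%C x s (Hk _)).
      - intros x Hx; apply P_bd; lra. }
    assert (Es : forall t, a <= t <= b ->
      Cmod (CInt (fun s => h (gam t s) * Q t s)%C c d - CInt (fun s => k (gam t s) * Q t s)%C c d)
      <= (d - c) * (e' * (L * dd) * L)).
    { intros t Ht.
      apply (edge_diff_le h (fun s => gam t s) (fun s => Q t s) c d (e' * (L * dd)) A B z0);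
        auto; try lra.
      - intros x Hx; apply (edge_s_cont h dh), h_diff; lra.
      - intros x Hx; exact (edge_s_cont k (fun z => 0 + (0 * (z - z0) + B * 1))%C t x (Hk _)).
      - intros x Hx; apply Q_bd; lra. }
    pose proof (Et c ltac:(lra)) as T1; pose proof (Et d ltac:(lra)) as T2.
    pose proof (Es a ltac:(lra)) as T3; pose proof (Es b ltac:(lra)) as T4.
    replace (boundary_int h a b c d) with (boundary_int h a b c d - boundary_int k a b c d)%C
      by (rewrite Z; ring).
    unfold boundary_int.
    match goal with |- Cmod (?h1 + ?h2 - ?h3 - ?h4 - (?k1 + ?k2 - ?k3 - ?k4)) <= _ =>
      replace (h1 + h2 - h3 - h4 - (k1 + k2 - k3 - k4))%C
      with (((h1 - k1) - (h3 - k3)) + ((h2 - k2) - (h4 - k4)))%C by ring end.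
    eapply Rle_trans; [apply Cmod_triangle|].
    eapply Rle_trans; [apply Rplus_le_compat; apply Cmod_sub_le|].
    apply Rle_trans with (2 * dd * (e' * (L * dd) * L)); [unfold dd in *; lra|].
    fold dd; replace (2 * dd * (e' * (L * dd) * L)) with (e' * (2 * (L * L)) * dd ^ 2) by ring.
    apply Rmult_le_compat_r; [apply pow2_ge_0|].
    apply Rle_trans with (e' * (2 * (L * L) + 1)); [nra | unfold e'; right; field; lra].
Qed.

End Goursat.

(** * Cauchy's integral formula *)

(** Convergence is stated by real and imaginary parts, so that real series can be used throughout;
    [is_pseries_Cseries] relates it to complex power series. *)
Definition is_Cseries (u : nat -> C) (l : C) : Prop :=
  is_series (fun n => Re (u n)) (Re l) /\ is_series (fun n => Im (u n)) (Im l).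

Fixpoint Csum (u : nat -> C) (N : nat) : C :=
  match N with O => u O | S n => (Csum u n + u (S n))%C end.

Lemma Csum_O (u : nat -> C) : Csum u 0 = u 0%nat.
Proof. reflexivity. Qed.

Lemma Csum_S (u : nat -> C) (n : nat) : Csum u (S n) = (Csum u n + u (S n))%C.
Proof. reflexivity. Qed.

Definition circ (s : R) : C := (cos s, sin s).

Lemma Cmod_circ (s : R) : Cmod (circ s) = 1.
Proof.
  unfold Cmod, circ; simpl fst; simpl snd.
  rewrite <- !Rsqr_pow2, Rplus_comm, sin2_cos2; apply sqrt_1.
Qed.

Lemma circ_neq_0 (s : R) : circ s <> 0.
Proof. apply Cmod_gt_0; rewrite Cmod_circ; lra. Qed.

Lemma is_derive_circ (s : R) :
  is_derive (V := C_R_NormedModule) circ s (Ci * circ s)%C.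
Proof.
  apply is_derive_parts; unfold circ, Re, Im; simpl; auto_derive; auto; ring.
Qed.

Lemma circ_2PI : circ (2 * PI) = circ 0.
Proof. unfold circ; rewrite cos_2PI, sin_2PI, cos_0, sin_0; reflexivity. Qed.

Lemma circ_inv_pow (n : nat) (s : R) : ((/ circ s) ^ n)%C = (cos (INR n * s), (- sin (INR n * s))%R).
Proof.
  assert (E : (/ circ s)%C = (cos s, (- sin s)%R)).
  { replace (RtoC 1) with (circ s * (cos s, (- sin s)%R))%C.
    - assert (A : (circ s * (cos s, (- sin s)%R))%C = 1).
      { apply C_ext; unfold circ, Re, Im; simpl; [|ring].
        replace (cos s * cos s - sin s * - sin s) with (Rsqr (sin s) + Rsqr (cos s))
          by (unfold Rsqr; ring); apply sin2_cos2. }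
      rewrite <- (Cmult_1_l (cos s, (- sin s)%R)), <- (Cinv_l (circ s)) by apply circ_neq_0.
      rewrite <- Cmult_assoc, A; ring.
    - apply C_ext; unfold circ, Re, Im; simpl; [|ring].
      replace (cos s * cos s - sin s * - sin s) with (Rsqr (sin s) + Rsqr (cos s))
          by (unfold Rsqr; ring); apply sin2_cos2. }
  rewrite E; clear E; induction n as [|n IH].
  - simpl; rewrite Rmult_0_l, cos_0, sin_0, Ropp_0; reflexivity.
  - rewrite Cpow_S, IH, S_INR, Rmult_plus_distr_r, Rmult_1_l, cos_plus, sin_plus.
    apply C_ext; unfold Re, Im; simpl; ring.
Qed.

Definition full_turn (n : nat) : C := match n with O => RtoC (2 * PI) | _ => RtoC 0 end.

Lemma circ_inv_pow_RInt (n : nat) :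
  is_RInt (V := C_R_NormedModule) (fun s => (/ circ s) ^ n)%C 0 (2 * PI)
    (full_turn n).
Proof.
  destruct n as [|n]; unfold full_turn.
  - apply (is_RInt_ext (V := C_R_NormedModule) (fun _ => RtoC 1)); [reflexivity|].
    replace (RtoC (2 * PI)) with (scal (V := C_R_NormedModule) (2 * PI - 0) (RtoC 1)).
    + apply (is_RInt_const (V := C_R_NormedModule)).
    + rewrite scal_R_Cmult, Rminus_0_r; apply Cmult_1_r.
  - assert (Hn : INR (S n) <> 0) by (apply not_0_INR; lia).
    apply (is_RInt_ext (V := C_R_NormedModule)
      (fun s => (cos (INR (S n) * s), (- sin (INR (S n) * s))%R) : C)).
    { intros s _; rewrite circ_inv_pow; reflexivity. }
    replace (RtoC 0) with (Cminus (sin (INR (S n) * (2 * PI)) / INR (S n), cos (INR (S n) * (2 * PI)) / INR (S n))%R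
      (sin (INR (S n) * 0) / INR (S n), cos (INR (S n) * 0) / INR (S n))%R).
    2: { rewrite Rmult_0_r; replace (INR (S n) * (2 * PI)) with (0 + 2 * INR (S n) * PI) by ring.
         rewrite sin_period, cos_period; ring. }
    generalize (INR (S n)), Hn; intros k Hk.
    apply (is_RInt_derive (V := C_R_CompleteNormedModule)
      (fun s => (sin (k * s) / k, cos (k * s) / k) : C)).
    + intros s _; apply is_derive_parts; unfold Re, Im; cbn [fst snd]; auto_derive; auto; field; auto.
    + intros s _; apply (ex_derive_continuous (V := C_R_NormedModule)).
      exists ((- k * sin (k * s))%R, (- k * cos (k * s))%R).
      apply is_derive_parts; unfold Re, Im; cbn [fst snd]; auto_derive; auto; ring.
Qed.

Lemma PI2_pos : 0 <= 2 * PI.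
Proof. pose proof PI_RGT_0; lra. Qed.

Lemma circ_lip (s s' : R) : Cmod (circ s - circ s') <= 2 * Rabs (s - s').
Proof.
  assert (A : forall f df : R -> R, (forall x, is_derive f x (df x)) -> (forall x, Rabs (df x) <= 1) ->
            Rabs (f s - f s') <= Rabs (s - s')).
  { intros f df Hf Hd; destruct (MVT_gen f s' s df) as [c [_ Hc]].
    - intros; apply Hf.
    - intros x _; apply derivable_continuous_pt; exists (df x); apply is_derive_Reals, Hf.
    - rewrite Hc, Rabs_mult; pose proof (Rabs_pos (s - s')); specialize (Hd c); nra. }
  eapply Rle_trans; [apply Cmod_le_parts|].
  replace (Re (circ s - circ s')) with (cos s - cos s') by (unfold circ, Re; simpl; ring).
  replace (Im (circ s - circ s')) with (sin s - sin s') by (unfold circ, Im; simpl; ring).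
  pose proof (A cos (fun x => - sin x)) as A1; pose proof (A sin cos) as A2.
  assert (Rabs (cos s - cos s') <= Rabs (s - s')).
  { apply A1; intro x; [auto_derive; auto; ring|].
    rewrite Rabs_Ropp; apply Rabs_le, SIN_bound. }
  assert (Rabs (sin s - sin s') <= Rabs (s - s')).
  { apply A2; intro x; [auto_derive; auto; ring|]; apply Rabs_le, COS_bound. }
  lra.
Qed.

(** Turns a geometric remainder estimate valid for every [N] into an exact equality. *)
Lemma geometric_rest_0 (A x c : R) : 0 <= c -> 0 <= x < 1 ->
  (forall N, A <= c * x ^ S N) -> A <= 0.
Proof.
  intros Hc Hx HA; apply Rnot_lt_le; intro HA0.
  destruct (pow_lt_1_zero x) with (y := A / (c + 1)) as [N HN].
  - rewrite Rabs_pos_eq; lra.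
  - apply Rdiv_lt_0_compat; lra.
  - specialize (HN (S N) ltac:(lia)); specialize (HA N).
    assert (0 <= x ^ S N) by (apply pow_le; lra).
    rewrite Rabs_pos_eq in HN by auto.
    apply Rmult_lt_compat_r with (r := c + 1) in HN; [|lra].
    unfold Rdiv in HN; rewrite Rmult_assoc, Rinv_l in HN by lra; nra.
Qed.

Section Cauchy.

Variables (H dH : C -> C) (rho r : R) (z : C).
Hypothesis H_diff : forall u, Cmod u < rho -> cderiv H u (dH u).
Hypothesis Hr : r < rho.
Hypothesis Hz : Cmod z < r.

Let w (s : R) : C := (RtoC r * circ s)%C.
(** The Cauchy kernel in the angle: on the circle [dw = i w ds], so [dw / (w - z)] is
    [i * K (w s) ds], and the factor [i] is dropped. *)
Let K (u : C) : C := (u / (u - z))%C.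

Lemma r_pos : 0 < r.
Proof. pose proof (Cmod_ge_0 z); lra. Qed.

Lemma w_mod (s : R) : Cmod (w s) = r.
Proof. unfold w; rewrite Cmod_mult, Cmod_R, Cmod_circ, Rabs_pos_eq; [ring | left; apply r_pos]. Qed.

Lemma w_neq_0 (s : R) : w s <> 0.
Proof. apply Cmod_gt_0; rewrite w_mod; apply r_pos. Qed.

Lemma wz_ge (s : R) : r - Cmod z <= Cmod (w s - z).
Proof.
  pose proof (Cmod_triangle (w s - z) z) as T.
  replace (w s - z + z)%C with (w s) in T by ring; rewrite w_mod in T; lra.
Qed.

Lemma wz_neq_0 (s : R) : (w s - z)%C <> 0.
Proof. apply Cmod_gt_0; pose proof (wz_ge s); lra. Qed.

Lemma w_derive (s : R) : is_derive (V := C_R_NormedModule) w s (Ci * w s)%C.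
Proof.
  replace (Ci * w s)%C with ((0 * circ s + RtoC r * 1) * (Ci * circ s))%C by (unfold w; ring).
  apply (is_derive_comp_curve (fun u => RtoC r * u)%C circ).
  - apply (cderiv_mult (fun _ => RtoC r) (fun u => u)); [apply cderiv_const | apply cderiv_id].
  - apply is_derive_circ.
Qed.

Lemma w_cont (s : R) : continuous (U := C_R_NormedModule) w s.
Proof. apply (ex_derive_continuous (V := C_R_NormedModule)); eexists; apply w_derive. Qed.

Lemma K_cont (s : R) : continuous (U := C_R_NormedModule) (fun s => K (w s)) s.
Proof.
  eapply (continuous_comp_curve K w); [|apply w_cont].
  apply (cderiv_mult (fun u => u) (fun u => / (u - z))%C); [apply cderiv_id|].
  apply (cderiv_inv (fun u => u - z)%C); [apply wz_neq_0 | apply cderiv_sub].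
Qed.

Lemma K_le (s : R) : Cmod (K (w s)) <= r / (r - Cmod z).
Proof.
  unfold K; rewrite Cmod_div, w_mod by apply wz_neq_0.
  apply Rmult_le_compat_l; [left; apply r_pos|].
  apply Rinv_le_contravar; [lra | apply wz_ge].
Qed.

Lemma inv_pow_cont (n : nat) (s : R) :
  continuous (U := C_R_NormedModule) (fun s => (/ w s) ^ n)%C s.
Proof.
  destruct (cderiv_pow (fun u => / u)%C (w s) (- (1) / (w s * w s))%C n) as [m Hm].
  - apply (cderiv_inv (fun u => u)); [apply w_neq_0 | apply cderiv_id].
  - eapply (continuous_comp_curve (fun u => (/ u) ^ n)%C w); [exact Hm | apply w_cont].
Qed.

Lemma inv_pow_RInt (n : nat) : CInt (fun s => (/ w s) ^ n)%C 0 (2 * PI)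
    = full_turn n.
Proof.
  apply CInt_unique.
  pose proof (is_RInt_Cmult_l _ _ _ ((/ RtoC r) ^ n)%C _ (circ_inv_pow_RInt n)) as I.
  assert (E : ((/ RtoC r) ^ n * full_turn n)%C
    = full_turn n).
  { destruct n; [apply Cmult_1_l | apply Cmult_0_r]. }
  rewrite E in I.
  revert I; apply (is_RInt_ext (V := C_R_NormedModule)); intros s _.
  rewrite <- Cpow_mult_l; f_equal; unfold w; field; split.
  - apply circ_neq_0.
  - intro E0; apply RtoC_inj in E0; pose proof r_pos; lra.
Qed.

(** The identity [K (w) = 1 + (z / w) * K (w)], iterated, is the geometric expansion with explicit
    remainder [(z / w) ^ (N + 1) * K (w)]. The constant [F = 1] gives [K_RInt], and [F = H] on the
    circle gives the Taylor expansion. *)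
Lemma geometric_expansion (F : R -> C) (M : R) (N : nat) :
  (forall s, continuous (U := C_R_NormedModule) F s) ->
  (forall s, 0 <= s <= 2 * PI -> Cmod (F s) <= M) ->
  Cmod (CInt (fun s => F s * K (w s))%C 0 (2 * PI)
        - Csum (fun n => CInt (fun s => F s * (/ w s) ^ n)%C 0 (2 * PI) * z ^ n)%C N)
    <= 2 * PI * (M * ((Cmod z / r) ^ S N * (r / (r - Cmod z)))).
Proof.
  intros HF HM.
  set (J := fun n => CInt (fun s => z ^ n * (F s * (/ w s) ^ n * K (w s)))%C 0 (2 * PI)).
  assert (Hc : forall n s, continuous (U := C_R_NormedModule) (fun s => F s * (/ w s) ^ n * K (w s))%C s).
  { intros n s; apply continuous_Cmult; [|apply K_cont].
    apply continuous_Cmult; [apply HF | apply inv_pow_cont]. }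
  assert (Hc' : forall n s, continuous (U := C_R_NormedModule) (fun s => F s * (/ w s) ^ n)%C s).
  { intros n s; apply continuous_Cmult; [apply HF | apply inv_pow_cont]. }
  assert (Cc : forall (c : C) s, continuous (U := C_R_NormedModule) (fun _ : R => c) s)
    by (intros c s; apply continuous_const).
  assert (Step : forall n, J n = (CInt (fun s => F s * (/ w s) ^ n)%C 0 (2 * PI) * z ^ n + J (S n))%C).
  { intro n; unfold J.
    rewrite (Cmult_comm _ (z ^ n)), <- CInt_mult_l by (auto using PI2_pos).
    rewrite <- CInt_plus; [|apply PI2_pos| |];
      try (intros s _; apply (continuous_Cmult (fun _ => _)); auto).
    apply CInt_ext; intro s; unfold K; rewrite !Cpow_S.
    pose proof (w_neq_0 s); pose proof (wz_neq_0 s); field; auto. }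
  assert (Sum : J 0%nat = (Csum
     (fun n => CInt (fun s => F s * (/ w s) ^ n)%C 0 (2 * PI) * z ^ n)%C N + J (S N))%C).
  { induction N as [|N IH].
    - rewrite Csum_O; apply Step.
    - rewrite Csum_S, IH, (Step (S N)); ring. }
  replace (CInt (fun s => F s * K (w s))%C 0 (2 * PI)) with (J 0%nat).
  2: { apply CInt_ext; intro s; simpl; ring. }
  rewrite Sum.
  match goal with |- Cmod (?a + ?b - ?a) <= _ => replace (a + b - a)%C with b by ring end.
  unfold J; eapply Rle_trans; [apply (CInt_le _ _ _ (M * ((Cmod z / r) ^ S N * (r / (r - Cmod z)))))|].
  - apply PI2_pos.
  - intros s _; apply (continuous_Cmult (fun _ => _)); auto.
  - intros s Hs.
    replace (z ^ S N * (F s * (/ w s) ^ S N * K (w s)))%C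
      with (F s * ((z * / w s) ^ S N * K (w s)))%C by (rewrite Cpow_mult_l; ring).
    rewrite !Cmod_mult; apply Rmult_le_compat; auto using Cmod_ge_0.
    { apply Rmult_le_pos; apply Cmod_ge_0. }
    apply Rmult_le_compat; auto using Cmod_ge_0, K_le.
    rewrite Cmod_pow, Cmod_mult, Cmod_inv, w_mod by apply w_neq_0; apply Rle_refl.
  - rewrite Rminus_0_r; apply Rle_refl.
Qed.

Lemma z_over_r : 0 <= Cmod z / r < 1.
Proof.
  pose proof r_pos; pose proof (Cmod_ge_0 z); split; [apply Rdiv_le_0_compat; lra|].
  apply Rmult_lt_reg_r with r; auto; unfold Rdiv; rewrite Rmult_assoc, Rinv_l; lra.
Qed.

(** The winding number about [z], also when [z] is not the centre: every term of the expansion but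
    that of index 0 integrates to 0. *)
Lemma K_RInt : CInt (fun s => K (w s)) 0 (2 * PI) = RtoC (2 * PI).
Proof.
  apply Ceq_minus, Cmod_eq_0, Rle_antisym; [|apply Cmod_ge_0].
  pose proof r_pos; pose proof PI2_pos.
  assert (Hrz : 0 < r / (r - Cmod z)) by (apply Rdiv_lt_0_compat; lra).
  apply (geometric_rest_0 _ (Cmod z / r) (2 * PI * (1 * (r / (r - Cmod z)))));
    [apply Rmult_le_pos; lra | apply z_over_r |].
  intro N.
  eapply Rle_trans; [|eapply Rle_trans; [apply (geometric_expansion (fun _ => RtoC 1) 1 N)|right; ring]].
  - right; f_equal; f_equal.
    + apply CInt_ext; intro s; ring.
    + f_equal.
      induction N as [|N IH].
      * rewrite Csum_O.
        rewrite (CInt_ext _ (fun s => (/ w s) ^ 0)%C) by (intro; ring).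
        rewrite inv_pow_RInt; simpl; ring.
      * rewrite Csum_S, <- IH.
        rewrite (CInt_ext _ (fun s => (/ w s) ^ S N)%C) by (intro; ring).
        rewrite inv_pow_RInt. unfold full_turn; ring.
  - intro s; apply continuous_const.
  - intros s _; rewrite Cmod_1; lra.
Qed.

Lemma gam_mod (t s : R) : 0 <= t <= 1 -> Cmod (z + RtoC t * (w s - z)) < rho.
Proof.
  intros Ht.
  replace (z + RtoC t * (w s - z))%C with (RtoC (1 - t) * z + RtoC t * w s)%C
    by (rewrite RtoC_minus; ring).
  eapply Rle_lt_trans; [apply Cmod_triangle|].
  rewrite !Cmod_mult, !Cmod_R, w_mod, !Rabs_pos_eq by lra.
  pose proof (Cmod_ge_0 z); nra.
Qed.

Lemma w_lip (s s' : R) : Cmod (w s - w s') <= 2 * r * Rabs (s - s').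
Proof.
  unfold w; replace (RtoC r * circ s - RtoC r * circ s')%C with (RtoC r * (circ s - circ s'))%C by ring.
  pose proof r_pos; rewrite Cmod_mult, Cmod_R, Rabs_pos_eq by lra.
  rewrite (Rmult_comm 2), Rmult_assoc; apply Rmult_le_compat_l; [lra | apply circ_lip].
Qed.

Lemma Hgam_cont (t s : R) : 0 <= t <= 1 ->
  continuous (U := C_R_NormedModule) (fun s => H (z + RtoC t * (w s - z))%C) s.
Proof.
  intro Ht; eapply (continuous_comp_curve (fun u => H (z + RtoC t * (u - z))%C) w); [|apply w_cont].
  assert (E : cderiv (fun u => z + RtoC t * (u - z))%C (w s) (0 + (0 * (w s - z) + RtoC t * 1))).
  { apply (cderiv_plus (fun _ => z) (fun u => RtoC t * (u - z))%C); [apply cderiv_const|].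
    apply (cderiv_mult (fun _ => RtoC t) (fun u => (u - z)%C)); [apply cderiv_const | apply cderiv_sub]. }
  intros e He.
  destruct (H_diff _ (gam_mod t s Ht) e He) as [d [Hd Hu]].
  exists d; split; auto; intros u Huw.
  set (l := dH (z + RtoC t * (w s - z))%C) in *.
  assert (F : Cmod (RtoC t * (u - w s)) <= Cmod (u - w s)).
  { rewrite Cmod_mult, Cmod_R, Rabs_pos_eq by lra; pose proof (Cmod_ge_0 (u - w s)); nra. }
  specialize (Hu (z + RtoC t * (u - z))%C).
  replace (z + RtoC t * (u - z) - (z + RtoC t * (w s - z)))%C with (RtoC t * (u - w s))%C in Hu by ring.
  replace (l * (RtoC t * (u - w s)))%C with (l * RtoC t * (u - w s))%C in Hu by ring.
  eapply Rle_trans; [apply Hu; lra|]; apply Rmult_le_compat_l; lra.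
Qed.

(** Goursat's lemma for [H u / (u - z)] along the contraction of the circle towards [z], on the
    parameters [tau <= t <= 1] and [0 <= s <= 2 PI]. Since [gam t s - z] is [t] times [w s - z], the
    factor [t] cancels in the integrand, and [tau > 0] keeps the contraction away from [z]. *)
Lemma homotopy_const (tau : R) : 0 < tau <= 1 ->
  CInt (fun s => H (z + RtoC tau * (w s - z)) * K (w s))%C 0 (2 * PI)
  = CInt (fun s => H (w s) * K (w s))%C 0 (2 * PI).
Proof.
  intros Ht.
  set (gam := fun t s => (z + RtoC t * (w s - z))%C).
  set (P := fun (t s : R) => (w s - z)%C).
  set (Q := fun (t s : R) => (RtoC t * (Ci * w s))%C).
  set (h := fun u => (H u * / (u - z))%C).
  set (dh := fun u => (dH u * / (u - z) + H u * (- (1) / ((u - z) * (u - z))))%C).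
  pose proof r_pos as Rp.
  assert (Kg : forall t s, (gam t s - z)%C = (RtoC t * (w s - z))%C) by (intros; unfold gam; ring).
  assert (Ktn : forall t s, tau <= t -> (gam t s - z)%C <> 0).
  { intros t s Hts; rewrite Kg; apply Cmult_neq_0; [|apply wz_neq_0].
    intro E; apply RtoC_inj in E; lra. }
  assert (W : forall s, Cmod (w s - z) <= 2 * r).
  { intro s; eapply Rle_trans; [apply Cmod_sub_le|]; rewrite w_mod; lra. }
  assert (G : boundary_int gam P Q h tau 1 0 (2 * PI) = 0%C).
  { apply (goursat gam P Q h dh tau 1 0 (2 * PI) (2 * r)); try lra; try apply PI2_pos.
    - intros t s; apply is_derive_parts; unfold gam, P, Re, Im; simpl; auto_derive; auto; ring.
    - intros t s; unfold gam, Q.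
      replace (RtoC t * (Ci * w s))%C with ((0 + (0 * (w s - z) + RtoC t * 1)) * (Ci * w s))%C by ring.
      apply (is_derive_comp_curve (fun u => z + RtoC t * (u - z))%C w); [|apply w_derive].
      apply (cderiv_plus (fun _ => z) (fun u => RtoC t * (u - z))%C); [apply cderiv_const|].
      apply (cderiv_mult (fun _ => RtoC t) (fun u => (u - z)%C)); [apply cderiv_const | apply cderiv_sub].
    - intros t s; apply continuous_const.
    - intros t s; apply (continuous_Cmult (fun _ => RtoC t)); [apply continuous_const|].
      apply (continuous_Cmult (fun _ => Ci)); [apply continuous_const | apply w_cont].
    - intros t s Ht' _; apply W.
    - intros t s Ht' _; unfold Q; rewrite !Cmod_mult, Cmod_R, Cmod_Ci, w_mod, Rabs_pos_eq; nra.
    - intros t s t' s' T1 _ T2 _.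
      replace (gam t s - gam t' s')%C with (RtoC (t - t') * (w s - z) + RtoC t' * (w s - w s'))%C
        by (unfold gam; rewrite RtoC_minus; ring).
      eapply Rle_trans; [apply Cmod_triangle|]; rewrite !Cmod_mult, !Cmod_R, (Rabs_pos_eq t') by lra.
      pose proof (w_lip s s'); specialize (W s); pose proof (Rabs_pos (t - t')).
      pose proof (Cmod_ge_0 (w s - w s')); nra.
    - intros t s T1 _; apply (cderiv_mult H (fun u => / (u - z))%C).
      + apply H_diff, gam_mod; lra.
      + apply (cderiv_inv (fun u => u - z)%C); [apply Ktn; lra | apply cderiv_sub]. }
  assert (E : forall t, tau <= t <= 1 -> CInt (fun s => h (gam t s) * Q t s)%C 0 (2 * PI)
     = (Ci * CInt (fun s => H (gam t s) * K (w s)) 0 (2 * PI))%C).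
  { intros t Ht'; rewrite <- CInt_mult_l; [|apply PI2_pos|].
    - apply CInt_ext; intro s; unfold h, Q; rewrite Kg; unfold K; field.
      split; [apply wz_neq_0 | intro E0; apply RtoC_inj in E0; lra].
    - intros s _; apply continuous_Cmult; [apply Hgam_cont; lra | apply K_cont]. }
  unfold boundary_int in G.
  (* The edges [s = 0] and [s = 2 PI] trace the same segment, so their contributions cancel and only
     the two closed curves remain. *)
  rewrite (CInt_ext (fun t => h (gam t (2 * PI)%R) * P t (2 * PI)%R)%C (fun t => h (gam t 0) * P t 0)%C) in G.
  2: { intro t; unfold gam, P, w; rewrite circ_2PI; reflexivity. }
  rewrite !E in G by lra.
  assert (G2 : (Ci * (CInt (fun s => H (gam 1%R s) * K (w s)) 0 (2 * PI)
                      - CInt (fun s => H (gam tau s) * K (w s)) 0 (2 * PI)) = 0)%C)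
    by (rewrite <- G; ring).
  assert (G3 : (CInt (fun s => H (gam 1%R s) * K (w s)) 0 (2 * PI)
                - CInt (fun s => H (gam tau s) * K (w s)) 0 (2 * PI) = 0)%C).
  { replace (CInt (fun s => H (gam 1%R s) * K (w s)) 0 (2 * PI)
                - CInt (fun s => H (gam tau s) * K (w s)) 0 (2 * PI))%C
      with (- Ci * (Ci * (CInt (fun s => H (gam 1%R s) * K (w s)) 0 (2 * PI)
                      - CInt (fun s => H (gam tau s) * K (w s)) 0 (2 * PI))))%C;
      [rewrite G2; ring|].
    rewrite Cmult_assoc; replace (- Ci * Ci)%C with (RtoC 1); [ring|].
    apply C_ext; unfold Re, Im; simpl; ring. }
  apply Ceq_minus in G3; symmetry.
  eapply eq_trans; [|exact G3].
  apply CInt_ext; intro s; unfold gam; do 2 f_equal; ring.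
Qed.

(** The integral does not change along the contraction, while [H] on the contracted curve tends
    uniformly to [H z]; [K_RInt] evaluates the limit. *)
Lemma cauchy_formula :
  CInt (fun s => H (w s) * K (w s))%C 0 (2 * PI) = (RtoC (2 * PI) * H z)%C.
Proof.
  apply Ceq_minus, Cmod_eq_0, Rle_antisym; [|apply Cmod_ge_0].
  pose proof r_pos as Rp; pose proof PI2_pos as Pp.
  set (k := r / (r - Cmod z)).
  assert (Hk : 0 < k) by (apply Rdiv_lt_0_compat; lra).
  apply Rnot_lt_le; intro Hpos.
  set (A := Cmod (CInt (fun s => H (w s) * K (w s))%C 0 (2 * PI)%R - RtoC (2 * PI) * H z)) in *.
  (* With [|K| <= k] on the circle, an error below [e] in [H] bounds [A] by [2 PI * k * e], which is
     less than [A]. *)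
  set (e := A / (2 * PI * k + 1)).
  assert (Hpk : 0 <= 2 * PI * k) by (apply Rmult_le_pos; lra).
  assert (He : 0 < e) by (apply Rdiv_lt_0_compat; lra).
  destruct (cderiv_continuous H z _ (H_diff z ltac:(lra)) e He) as [d [Hd Hu]].
  set (tau := Rmin 1 (d / (2 * r + 1))).
  assert (Ht : 0 < tau <= 1)
    by (split; [apply Rmin_pos; [lra | apply Rdiv_lt_0_compat; lra] | apply Rmin_l]).
  assert (B : A <= (2 * PI - 0) * (e * k)).
  { unfold A; rewrite <- (homotopy_const tau Ht), <- K_RInt, Cmult_comm.
    rewrite <- CInt_mult_l by (auto using K_cont).
    replace (CInt (fun s => H (z + RtoC tau * (w s - z)) * K (w s))%C 0 (2 * PI)%R
             - CInt (fun s => H z * K (w s))%C 0 (2 * PI)%R)%C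
      with (CInt (fun s => (H (z + RtoC tau * (w s - z)) + - H z) * K (w s))%C 0 (2 * PI)%R)%C.
    - apply CInt_le; auto.
      + intros s _; apply continuous_Cmult; [|apply K_cont].
        apply (continuous_plus (V := C_R_NormedModule)); [apply Hgam_cont; lra | apply continuous_const].
      + intros s _; rewrite Cmod_mult; apply Rmult_le_compat; auto using Cmod_ge_0, K_le.
        left; apply Hu.
        replace (z + RtoC tau * (w s - z) - z)%C with (RtoC tau * (w s - z))%C by ring.
        rewrite Cmod_mult, Cmod_R, Rabs_pos_eq by lra.
        apply Rle_lt_trans with (d / (2 * r + 1) * (2 * r)).
        * apply Rmult_le_compat; try lra; try apply Cmod_ge_0; [apply Rmin_r|].
          eapply Rle_trans; [apply Cmod_sub_le|]; rewrite w_mod; lra.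
        * apply Rmult_lt_reg_r with (2 * r + 1); [lra|].
          replace (d / (2 * r + 1) * (2 * r) * (2 * r + 1)) with (d * (2 * r)) by (field; lra). nra.
    - symmetry; apply Ceq_minus.
      rewrite (CInt_ext (fun s => (H (z + RtoC tau * (w s - z)) + - H z) * K (w s))%C
        (fun s => H (z + RtoC tau * (w s - z)) * K (w s) + (- (1)) * (H z * K (w s)))%C)
        by (intro; ring).
      assert (C1 : forall s, continuous (U := C_R_NormedModule) (fun s => H z * K (w s))%C s)
        by (intro s; apply (continuous_Cmult (fun _ => H z)); [apply continuous_const | apply K_cont]).
      rewrite CInt_plus, (CInt_mult_l (fun s => H z * K (w s))%C); auto; [ring| |].
      + intros s _; apply continuous_Cmult; [apply Hgam_cont; lra | apply K_cont].
      + intros s _; apply (continuous_Cmult (fun _ => (- (1))%C)); [apply continuous_const | apply C1]. }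
  assert (A = e * (2 * PI * k + 1)) by (unfold e; field; lra).
  nra.
Qed.

Lemma Hw_cont (s : R) : continuous (U := C_R_NormedModule) (fun s => H (w s)) s.
Proof.
  eapply (continuous_comp_curve H w); [apply H_diff; rewrite w_mod; lra | apply w_cont].
Qed.

Lemma cauchy_estimate (M : R) : (forall u, Cmod u = r -> Cmod (H u) <= M) ->
  Cmod (H z) <= M * (r / (r - Cmod z)).
Proof.
  intros HM; pose proof r_pos as Rp; pose proof PI_RGT_0 as Pp.
  assert (B : Cmod (RtoC (2 * PI) * H z) <= (2 * PI - 0) * (M * (r / (r - Cmod z)))).
  { rewrite <- cauchy_formula; apply CInt_le; [lra| |].
    - intros s _; apply continuous_Cmult; [apply Hw_cont | apply K_cont].
    - intros s _; rewrite Cmod_mult; apply Rmult_le_compat; auto using Cmod_ge_0, K_le.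
      apply HM, w_mod. }
  rewrite Cmod_mult, Cmod_R, Rabs_pos_eq, Rminus_0_r in B by lra.
  apply Rmult_le_reg_l in B; lra.
Qed.

Lemma taylor_remainder (M : R) (N : nat) :
  (forall s, 0 <= s <= 2 * PI -> Cmod (H (w s)) <= M) ->
  Cmod (H z - Csum (fun n =>
      / RtoC (2 * PI) * CInt (fun s => H (w s) * (/ w s) ^ n)%C 0 (2 * PI) * z ^ n)%C N)
    <= M * (r / (r - Cmod z)) * (Cmod z / r) ^ S N.
Proof.
  intros HM; pose proof r_pos as Rp; pose proof PI_RGT_0 as Pp.
  assert (P0 : RtoC (2 * PI) <> 0) by (intro E; apply RtoC_inj in E; lra).
  pose proof (geometric_expansion (fun s => H (w s)) M N Hw_cont HM) as G.
  cbv beta in G; rewrite cauchy_formula in G.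
  assert (E : (RtoC (2 * PI) * Csum (fun n =>
      / RtoC (2 * PI) * CInt (fun s => H (w s) * (/ w s) ^ n)%C 0 (2 * PI)%R * z ^ n) N
     = Csum (fun n => CInt (fun s => H (w s) * (/ w s) ^ n)%C 0 (2 * PI)%R * z ^ n) N)%C).
  { clear G; induction N as [|N IH].
    - rewrite !Csum_O; field; auto.
    - rewrite !Csum_S, <- IH.
      field; auto. }
  rewrite <- E in G.
  match type of G with Cmod (?p * ?a - ?p * ?b) <= _ =>
    replace (p * a - p * b)%C with (p * (a - b))%C in G by ring end.
  rewrite Cmod_mult, Cmod_R, Rabs_pos_eq in G by lra.
  apply Rmult_le_reg_l in G; [|lra].
  eapply Rle_trans; [exact G | right; ring].
Qed.

Lemma taylor_coeff_le (M : R) (n : nat) :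
  (forall s, 0 <= s <= 2 * PI -> Cmod (H (w s)) <= M) ->
  Cmod (/ RtoC (2 * PI) * CInt (fun s => H (w s) * (/ w s) ^ n)%C 0 (2 * PI)) * r ^ n <= M.
Proof.
  intros HM; pose proof r_pos as Rp; pose proof PI_RGT_0 as Pp.
  assert (P0 : RtoC (2 * PI) <> 0) by (intro E; apply RtoC_inj in E; lra).
  assert (B : Cmod (CInt (fun s => H (w s) * (/ w s) ^ n)%C 0 (2 * PI)) <= (2 * PI - 0) * (M * (/ r) ^ n)).
  { apply CInt_le; [lra| |].
    - intros s _; apply continuous_Cmult; [apply Hw_cont | apply inv_pow_cont].
    - intros s Hs; rewrite Cmod_mult, Cmod_pow, Cmod_inv, w_mod by apply w_neq_0.
      apply Rmult_le_compat_r; auto; apply pow_le; left; apply Rinv_0_lt_compat; auto. }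
  rewrite Cmod_mult, Cmod_inv, Cmod_R, Rabs_pos_eq by (auto; lra).
  assert (0 < r ^ n) by (apply pow_lt; auto).
  rewrite pow_inv in B.
  apply Rmult_le_reg_l with (2 * PI * / r ^ n).
  { apply Rmult_lt_0_compat; [lra | apply Rinv_0_lt_compat; auto]. }
  eapply Rle_trans; [|eapply Rle_trans; [exact B|]]; right; field; repeat split; lra.
Qed.

Lemma circle_max : exists M, forall s, 0 <= s <= 2 * PI -> Cmod (H (w s)) <= M.
Proof.
  destruct (continuity_ab_maj (fun s => Cmod (H (w s))) 0 (2 * PI)) as [s0 [Hs0 _]].
  - apply PI2_pos.
  - intros c _; apply continuity_pt_filterlim.
    apply (continuous_ext (fun s => norm (V := C_R_NormedModule) (H (w s)))).
    { intro s; rewrite <- Cmod_norm; reflexivity. }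
    apply (continuous_comp (U := R_UniformSpace) (V := C_R_NormedModule) (W := R_UniformSpace)
      (fun s => H (w s)) (norm (V := C_R_NormedModule))); [apply Hw_cont|].
    apply (filterlim_norm (V := C_R_NormedModule)).
  - exists (Cmod (H (w s0))); exact Hs0.
Qed.

End Cauchy.

(** * Complex power series and the Schwarz lemma *)

(** Taking moduli brings the real theory of the radius of convergence to complex coefficients. *)
Definition crad (a : nat -> C) : Rbar := CV_radius (fun n => Cmod (a n)).

(** [Series] has a value even for a divergent series; [Cps_correct] makes this the sum inside
    [crad]. *)
Definition Cps (a : nat -> C) (z : C) : C :=
  (Series (fun n => Re (a n * z ^ n)), Series (fun n => Im (a n * z ^ n))).

Definition CPS_derive (a : nat -> C) (n : nat) : C := (RtoC (INR (S n)) * a (S n))%C.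

Lemma is_Cseries_unique (u : nat -> C) (l m : C) : is_Cseries u l -> is_Cseries u m -> l = m.
Proof.
  intros [H1 H2] [H3 H4]; apply C_ext.
  - rewrite <- (is_series_unique _ _ H1); apply is_series_unique; auto.
  - rewrite <- (is_series_unique _ _ H2); apply is_series_unique; auto.
Qed.

Lemma is_Cseries_ext (u v : nat -> C) (l : C) : (forall n, u n = v n) ->
  is_Cseries u l -> is_Cseries v l.
Proof.
  intros E [H1 H2]; split; eapply is_series_ext; eauto; intro n; simpl; rewrite E; auto.
Qed.

Lemma is_Cseries_scal (c : C) (u : nat -> C) (l : C) :
  is_Cseries u l -> is_Cseries (fun n => c * u n)%C (c * l)%C.
Proof.
  intros [H1 H2]; split.
  - eapply is_series_ext; [|apply (is_series_minus _ _ _ _ (is_series_scal (Re c) _ _ H1) (is_series_scal (Im c) _ _ H2))].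
    intro n; rewrite re_mult; reflexivity.
  - eapply is_series_ext; [|apply (is_series_plus _ _ _ _ (is_series_scal (Re c) _ _ H2) (is_series_scal (Im c) _ _ H1))].
    intro n; rewrite im_mult; reflexivity.
Qed.

Lemma is_Cseries_minus (u v : nat -> C) (l m : C) : is_Cseries u l -> is_Cseries v m ->
  is_Cseries (fun n => u n - v n)%C (l - m)%C.
Proof.
  intros [H1 H2] [H3 H4]; split.
  - exact (is_series_minus _ _ _ _ H1 H3).
  - exact (is_series_minus _ _ _ _ H2 H4).
Qed.

Lemma is_Cseries_shift (u : nat -> C) (l : C) : u 0%nat = 0%C ->
  is_Cseries (fun n => u (S n)) l <-> is_Cseries u l.
Proof.
  intros E; split; intros [H1 H2]; split.
  - apply is_series_decr_1.
    apply (eq_ind (Re l) (fun x => is_series (fun n => Re (u (S n))) x) H1).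
    rewrite E; change (Re l = Re l + - 0); ring.
  - apply is_series_decr_1.
    apply (eq_ind (Im l) (fun x => is_series (fun n => Im (u (S n))) x) H2).
    rewrite E; change (Im l = Im l + - 0); ring.
  - apply (is_series_incr_1 (fun n => Re (u n))).
    apply (eq_ind (Re l) (fun x => is_series (fun n => Re (u n)) x) H1).
    rewrite E; change (Re l = Re l + 0); ring.
  - apply (is_series_incr_1 (fun n => Im (u n))).
    apply (eq_ind (Im l) (fun x => is_series (fun n => Im (u n)) x) H2).
    rewrite E; change (Im l = Im l + 0); ring.
Qed.

Lemma is_series_ge_0 (v : nat -> R) (s : R) : is_series v s -> (forall n, 0 <= v n) -> 0 <= s.
Proof.
  intros Hv H.
  apply (is_lim_seq_le (fun _ => 0) (sum_n v) 0 s); auto; [|apply is_lim_seq_const].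
  intro N; induction N as [|N IH]; [rewrite sum_O; auto|].
  rewrite sum_Sn; apply Rplus_le_le_0_compat; auto.
Qed.

(** Multiplication by the conjugate of [l] makes the limit [|l|^2] real, so comparing the real parts
    with [|l| * v n] is enough. *)
Lemma is_Cseries_le (u : nat -> C) (v : nat -> R) (l : C) (s : R) :
  is_Cseries u l -> is_series v s -> (forall n, Cmod (u n) <= v n) -> Cmod l <= s.
Proof.
  intros Hu Hv Huv.
  assert (Hs : 0 <= s).
  { apply (is_series_ge_0 v); auto.
    intro n; eapply Rle_trans; [apply Cmod_ge_0 | apply Huv]. }
  destruct (Req_dec (Cmod l) 0) as [E|E]; [lra|].
  pose proof (Cmod_ge_0 l) as Hl.
  pose proof (is_Cseries_scal (Cconj l) u l Hu) as [H1 _].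
  assert (R : Re (Cconj l * l) = Cmod l * Cmod l).
  { rewrite Cmult_comm, <- Cmod2_conj, re_RtoC; ring. }
  rewrite R in H1.
  pose proof (is_series_scal (Cmod l) _ _ Hv) as H2.
  assert (L : Cmod l * Cmod l <= Cmod l * s).
  { change (Cmod l * s) with (scal (Cmod l) s).
    apply (is_lim_seq_le (sum_n (fun n => Re (Cconj l * u n))) (sum_n (fun n => scal (Cmod l) (v n)))
             (Cmod l * Cmod l) (scal (Cmod l) s)); auto.
    intro N; apply sum_n_m_le; intro n.
    eapply Rle_trans; [apply Rle_abs|]; eapply Rle_trans; [apply re_le_Cmod|].
    rewrite Cmod_mult, Cmod_conj; apply Rmult_le_compat_l; auto. }
  apply Rmult_le_reg_l in L; lra.
Qed.

Lemma Cps_correct (a : nat -> C) (z : C) : Rbar_lt (Cmod z) (crad a) ->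
  is_Cseries (fun n => a n * z ^ n)%C (Cps a z).
Proof.
  intros H.
  assert (E : ex_series (fun n => Cmod (a n * z ^ n))).
  { apply (ex_series_ext (fun n => Rabs (Cmod (a n) * Cmod z ^ n))).
    - intro n; rewrite Cmod_mult, Cmod_pow; apply Rabs_pos_eq.
      apply Rmult_le_pos; [apply Cmod_ge_0 | apply pow_le, Cmod_ge_0].
    - apply CV_disk_inside; rewrite Rabs_pos_eq; auto using Cmod_ge_0. }
  split; apply Series_correct; eapply (ex_series_le (V := R_CompleteNormedModule)); try exact E;
    intro n; [apply re_le_Cmod | apply im_le_Cmod].
Qed.

Lemma crad_derive (a : nat -> C) : crad (CPS_derive a) = crad a.
Proof.
  unfold crad; rewrite <- (CV_radius_derive (fun n => Cmod (a n))).
  apply CV_radius_ext; intro n; unfold CPS_derive, PS_derive.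
  rewrite Cmod_mult, Cmod_R, Rabs_pos_eq; auto; apply pos_INR.
Qed.

(** The square of the exponent replaces the binomial coefficient, at no cost since polynomial
    weights leave the radius of convergence unchanged. Dividing by [rho ^ 2] avoids the exponent
    [n - 1], which would be truncated at [n = 0]. *)
Lemma pow_taylor2 (z h : C) (rho : R) (n : nat) : 0 < rho -> Cmod z <= rho -> Cmod (z + h) <= rho ->
  Cmod ((z + h) ^ S n - z ^ S n - RtoC (INR (S n)) * z ^ n * h)
    <= (INR (S n)) ^ 2 * rho ^ S n * (Cmod h ^ 2 / rho ^ 2).
Proof.
  intros Hr Hz Hzh; induction n as [|n IH].
  - simpl (INR 1); replace ((z + h) ^ 1 - z ^ 1 - 1 * z ^ 0 * h)%C with (RtoC 0) by (simpl; ring).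
    rewrite Cmod_0; apply Rmult_le_pos; [rewrite pow1; simpl; lra|].
    apply Rdiv_le_0_compat; [apply pow2_ge_0 | apply pow_lt; auto].
  - replace ((z + h) ^ S (S n) - z ^ S (S n) - RtoC (INR (S (S n))) * z ^ S n * h)%C
      with ((z + h) * ((z + h) ^ S n - z ^ S n - RtoC (INR (S n)) * z ^ n * h)
            + RtoC (INR (S n)) * z ^ n * (h * h))%C
      by (rewrite (S_INR (S n)), RtoC_plus, !Cpow_S; ring).
    eapply Rle_trans; [apply Cmod_triangle|]; rewrite !Cmod_mult, Cmod_R, Cmod_pow.
    rewrite Rabs_pos_eq by apply pos_INR.
    set (D := Cmod ((z + h) ^ S n - z ^ S n - RtoC (INR (S n)) * z ^ n * h)) in *.
    set (k := Cmod h ^ 2 / rho ^ 2) in *.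
    assert (Hk : 0 <= k) by (apply Rdiv_le_0_compat; [apply pow2_ge_0 | apply pow_lt; auto]).
    assert (Hh : Cmod h * Cmod h = k * rho ^ 2) by (unfold k; field; lra).
    rewrite Hh.
    assert (HD : 0 <= D) by apply Cmod_ge_0.
    assert (A1 : Cmod (z + h) * D <= rho * (INR (S n) ^ 2 * rho ^ S n * k))
      by (apply Rmult_le_compat; auto using Cmod_ge_0).
    assert (A2 : Cmod z ^ n <= rho ^ n) by (apply pow_incr; split; auto using Cmod_ge_0).
    assert (A3 : INR (S n) * Cmod z ^ n * (k * rho ^ 2) <= INR (S n) * rho ^ n * (k * rho ^ 2)).
    { apply Rmult_le_compat_r; [apply Rmult_le_pos; auto; apply pow2_ge_0|].
      apply Rmult_le_compat_l; auto; apply pos_INR. }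
    eapply Rle_trans; [apply Rplus_le_compat; [exact A1 | exact A3]|].
    rewrite (S_INR (S n)).
    replace (rho * (INR (S n) ^ 2 * rho ^ S n * k) + INR (S n) * rho ^ n * (k * rho ^ 2))
      with ((INR (S n) ^ 2 + INR (S n)) * (rho ^ S (S n) * k)) by (simpl; ring).
    rewrite Rmult_assoc; apply Rmult_le_compat_r.
    + apply Rmult_le_pos; auto; apply pow_le; lra.
    + pose proof (pos_INR (S n)); nra.
Qed.

Lemma Rbar_between (x : R) (R0 : Rbar) : Rbar_lt x R0 -> exists rho, x < rho /\ Rbar_lt rho R0.
Proof.
  destruct R0 as [r| |]; simpl; intros H; try tauto.
  - exists ((x + r) / 2); lra.
  - exists (x + 1); split; [lra | auto].
Qed.

(** Multiplication by [n] is a formal derivative followed by a shift, and neither changes the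
    radius. *)
Lemma CV_radius_pow_weight (a : nat -> R) (k : nat) :
  CV_radius (fun n => INR n ^ k * a n) = CV_radius a.
Proof.
  induction k as [|k IH]; [apply CV_radius_ext; intro n; simpl; ring|].
  rewrite <- IH, <- (CV_radius_derive (fun n => INR n ^ k * a n)),
    <- (CV_radius_incr_1 (PS_derive (fun n => INR n ^ k * a n))).
  apply CV_radius_ext; intros [|n].
  - change (INR 0 ^ S k * a 0%nat = 0); simpl; ring.
  - change (INR (S n) ^ S k * a (S n) = INR (S n) * (INR (S n) ^ k * a (S n))); simpl; ring.
Qed.

Lemma ex_series_pow_weight (a : nat -> R) (rho : R) (k : nat) : 0 <= rho -> (forall n, 0 <= a n) ->
  Rbar_lt rho (CV_radius a) -> ex_series (fun n => a n * (INR n ^ k * rho ^ n)).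
Proof.
  intros Hr Ha H.
  assert (X : ex_series (fun n => Rabs (INR n ^ k * a n * rho ^ n)))
    by (apply CV_disk_inside; rewrite CV_radius_pow_weight, Rabs_pos_eq; auto).
  revert X; apply ex_series_ext; intro n.
  rewrite Rabs_pos_eq; [simpl; ring|].
  repeat apply Rmult_le_pos; auto; apply pow_le; auto using pos_INR.
Qed.

(** At a radius [rho] strictly between [|z|] and the radius of convergence, the sum [K] of
    [n^2 |a_n| rho^n] is finite. Summing [pow_taylor2] bounds the error of the linear approximation
    by [K |u - z|^2 / rho^2]. *)
Lemma cderiv_Cps (a : nat -> C) (z : C) : Rbar_lt (Cmod z) (crad a) ->
  cderiv (Cps a) z (Cps (CPS_derive a) z).
Proof.
  intros Hz e He.
  destruct (Rbar_between _ _ Hz) as [rho [Hr1 Hr2]].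
  assert (Hr0 : 0 < rho) by (pose proof (Cmod_ge_0 z); lra).
  destruct (ex_series_pow_weight (fun n => Cmod (a n)) rho 2) as [K HK];
    [lra | intro; apply Cmod_ge_0 | exact Hr2 |].
  assert (HK0 : 0 <= K).
  { eapply is_series_ge_0; [exact HK|].
    intro n; apply Rmult_le_pos; [apply Cmod_ge_0|].
    apply Rmult_le_pos; [apply pow2_ge_0 | apply pow_le; lra]. }
  assert (Hd : 0 < e / ((K + 1) / rho ^ 2)).
  { apply Rdiv_lt_0_compat; auto; apply Rdiv_lt_0_compat; [lra | apply pow_lt; auto]. }
  exists (Rmin (rho - Cmod z) (e / ((K + 1) / rho ^ 2))); split; [apply Rmin_pos; lra|].
  intros u Hu; apply Rmin_Rgt in Hu; destruct Hu as [Hu1 Hu2].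
  assert (Hur : Cmod u <= rho).
  { replace u with (z + (u - z))%C by ring; eapply Rle_trans; [apply Cmod_triangle|]; lra. }
  assert (Hu3 : Rbar_lt (Cmod u) (crad a))
    by (eapply Rbar_le_lt_trans; [|exact Hr2]; exact Hur).
  pose proof (Cps_correct a u Hu3) as S1; pose proof (Cps_correct a z Hz) as S2.
  (* The derivative series is shifted back and padded with 0, so that the derivative of the term of
     index [n] stands at index [n] and the three series subtract termwise. *)
  assert (S3 : is_Cseries (fun n => match n with O => 0 | S m => a (S m) * (RtoC (INR (S m)) * z ^ m * (u - z)) end)%C
                 (Cps (CPS_derive a) z * (u - z))%C).
  { apply is_Cseries_shift; [reflexivity|].
    rewrite Cmult_comm.
    apply (is_Cseries_ext (fun n => (u - z) * (CPS_derive a n * z ^ n))%C).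
    { intro n; unfold CPS_derive; ring. }
    apply is_Cseries_scal, Cps_correct; rewrite crad_derive; auto. }
  pose proof (is_Cseries_minus _ _ _ _ (is_Cseries_minus _ _ _ _ S1 S2) S3) as S4.
  pose proof (is_series_scal (Cmod (u - z) ^ 2 / rho ^ 2) _ _ HK) as S5.
  eapply Rle_trans; [apply (is_Cseries_le _ _ _ _ S4 S5)|].
  - intros [|n].
    + replace (a 0%nat * u ^ 0 - a 0%nat * z ^ 0 - 0)%C with (RtoC 0) by (simpl; ring).
      rewrite Cmod_0; apply Rmult_le_pos.
      * apply Rdiv_le_0_compat; [apply pow2_ge_0 | apply pow_lt; auto].
      * simpl; rewrite !Rmult_0_l, Rmult_0_r; lra.
    + replace (a (S n) * u ^ S n - a (S n) * z ^ S n - a (S n) * (RtoC (INR (S n)) * z ^ n * (u - z)))%C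
        with (a (S n) * ((z + (u - z)) ^ S n - z ^ S n - RtoC (INR (S n)) * z ^ n * (u - z)))%C
        by (replace (z + (u - z))%C with u by ring; ring).
      rewrite Cmod_mult.
      pose proof (pow_taylor2 z (u - z)%C rho n Hr0 ltac:(lra)) as T.
      replace (z + (u - z))%C with u in T |- * by ring.
      specialize (T Hur).
      eapply Rle_trans; [apply Rmult_le_compat_l; [apply Cmod_ge_0 | exact T]|].
      right; change (scal ?x ?y) with (x * y); ring.
  - change (scal ?x ?y) with (x * y).
    pose proof (Cmod_ge_0 (u - z)) as P.
    replace (Cmod (u - z) ^ 2 / rho ^ 2 * K) with (Cmod (u - z) * (K / rho ^ 2) * Cmod (u - z))
      by (field; lra).
    apply Rmult_le_compat_r; auto.
    assert (Q : 0 < / rho ^ 2) by (apply Rinv_0_lt_compat, pow_lt; auto).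
    assert (Q2 : 0 < (K + 1) / rho ^ 2) by (apply Rmult_lt_0_compat; lra).
    apply Rle_trans with (e / ((K + 1) / rho ^ 2) * ((K + 1) / rho ^ 2)).
    + apply Rmult_le_compat; [auto | | lra |].
      * apply Rmult_le_pos; lra.
      * apply Rmult_le_compat_r; lra.
    + right; field; split; lra.
Qed.

Definition holo (H : C -> C) (rho : R) : Prop :=
  forall u, Cmod u < rho -> exists l, cderiv H u l.

Lemma holo_choice (H : C -> C) (rho : R) : holo H rho ->
  exists dH, forall u, Cmod u < rho -> cderiv H u (dH u).
Proof.
  intros HH; exists (fun u => epsilon (inhabits (RtoC 0)) (fun l => cderiv H u l)).
  intros u Hu; apply epsilon_spec; auto.
Qed.

Lemma holo_bound (H : C -> C) (rho r M : R) (z : C) : holo H rho -> Cmod z < r -> r < rho ->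
  (forall u, Cmod u = r -> Cmod (H u) <= M) -> Cmod (H z) <= M * (r / (r - Cmod z)).
Proof.
  intros HH Hz Hr HM; destruct (holo_choice H rho HH) as [dH HdH].
  apply (cauchy_estimate H dH rho r z); auto.
Qed.

Lemma Csum_re (u : nat -> C) (N : nat) : Re (Csum u N) = sum_n (fun n => Re (u n)) N.
Proof.
  induction N as [|N IH]; [rewrite sum_O; reflexivity|].
  rewrite sum_Sn, Csum_S, re_plus, IH; reflexivity.
Qed.

Lemma Csum_im (u : nat -> C) (N : nat) : Im (Csum u N) = sum_n (fun n => Im (u n)) N.
Proof.
  induction N as [|N IH]; [rewrite sum_O; reflexivity|].
  rewrite sum_Sn, Csum_S, im_plus, IH; reflexivity.
Qed.

Lemma is_Cseries_Csum (u : nat -> C) (l : C) (e : nat -> R) : is_lim_seq e 0 ->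
  (forall N, Cmod (l - Csum u N) <= e N) -> is_Cseries u l.
Proof.
  intros He Hu.
  assert (A : forall (v : nat -> R) (m : R), (forall N, Rabs (m - v N) <= e N) -> is_lim_seq v m).
  { intros v m Hv.
    apply (is_lim_seq_le_le (fun N => m - e N) _ (fun N => m + e N)).
    - intro N; specialize (Hv N); apply Rabs_le_between in Hv; lra.
    - replace (Finite m) with (Finite (m - 0)) by (f_equal; ring).
      apply is_lim_seq_minus'; auto; apply is_lim_seq_const.
    - replace (Finite m) with (Finite (m + 0)) by (f_equal; ring).
      apply is_lim_seq_plus'; auto; apply is_lim_seq_const. }
  split; apply A; intro N.
  - rewrite <- Csum_re; eapply Rle_trans; [|apply Hu].
    eapply Rle_trans; [|apply re_le_Cmod]; right; f_equal; unfold Re; simpl; ring.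
  - rewrite <- Csum_im; eapply Rle_trans; [|apply Hu].
    eapply Rle_trans; [|apply im_le_Cmod]; right; f_equal; unfold Im; simpl; ring.
Qed.

(** The coefficients are integrals over the circle of radius [r], so the expansion is obtained for
    one [r < rho] at a time. *)
Lemma holo_taylor (H : C -> C) (rho r : R) : holo H rho -> 0 < r < rho ->
  exists b, Rbar_le r (crad b) /\
    forall z, Cmod z < r -> is_Cseries (fun n => b n * z ^ n)%C (H z).
Proof.
  intros HH [Hr0 Hr]; destruct (holo_choice H rho HH) as [dH HdH].
  (* The facts about the circle and the coefficients do not involve the point of evaluation; 0
     stands in for it. *)
  assert (H0 : Cmod 0 < r) by (rewrite Cmod_0; auto).
  destruct (circle_max H dH rho r 0 HdH Hr H0) as [M HM].
  exists (fun n => / RtoC (2 * PI) *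
     CInt (fun s => H (RtoC r * circ s) * (/ (RtoC r * circ s)) ^ n) 0 (2 * PI)%R)%C; split.
  - destruct (CV_radius_bounded (fun n => Cmod (/ RtoC (2 * PI) *
     CInt (fun s => H (RtoC r * circ s) * (/ (RtoC r * circ s)) ^ n) 0 (2 * PI)%R)%C)) as [B _].
    apply B; exists M; intro n; rewrite Rabs_pos_eq.
    + exact (taylor_coeff_le H dH rho r 0 HdH Hr H0 M n HM).
    + apply Rmult_le_pos; [apply Cmod_ge_0 | apply pow_le; lra].
  - intros z Hz.
    apply (is_Cseries_Csum _ _ (fun N => M * (r / (r - Cmod z)) * (Cmod z / r) ^ S N)).
    + replace (Finite 0) with (Rbar_mult (M * (r / (r - Cmod z))) (Finite 0)) by (simpl; f_equal; ring).
      apply is_lim_seq_scal_l; apply (is_lim_seq_incr_1 (fun n => (Cmod z / r) ^ n)), is_lim_seq_geom.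
      pose proof (z_over_r r z Hz); rewrite Rabs_pos_eq; lra.
    + intro N; exact (taylor_remainder H dH rho r z HdH Hr Hz M N HM).
Qed.

Lemma pow_bounded_le_1 (x c : R) : 0 <= x -> (forall k, x ^ k <= c) -> x <= 1.
Proof.
  intros Hx H; apply Rnot_lt_le; intro H1.
  destruct (Pow_x_infinity x) with (b := c + 1) as [N HN]; [rewrite Rabs_pos_eq; lra|].
  specialize (HN N (Nat.le_refl _)); specialize (H N).
  rewrite Rabs_pos_eq in HN by (apply pow_le; auto); lra.
Qed.

(** Write [w u = u * g u]. On the circle of radius [r] the modulus of [g] is at most [1 / r].
    Cauchy's estimate applied to [g ^ k] bounds [(r |g z|) ^ k] by [r / (r - |z|)] for every [k],
    which forces [r |g z| <= 1]: the powers take the place of the maximum principle. Then [r] tends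
    to 1. *)
Lemma schwarz_lemma (w : C -> C) : holo w 1 -> (forall z, Cmod z < 1 -> Cmod (w z) < 1) ->
  w 0 = 0 -> forall z, Cmod z < 1 -> Cmod (w z) <= Cmod z.
Proof.
  intros Hw Hb H0 z Hz.
  assert (Key : forall r, Cmod z < r -> r < 1 -> r * Cmod (w z) <= Cmod z).
  { intros r Hr1 Hr2; pose proof (Cmod_ge_0 z) as Pz.
    (* The expansion is taken on a disc larger than that of radius [r], so that it covers the circle
       of radius [r]. *)
    set (q := (1 + r) / 2).
    destruct (holo_taylor w 1 q Hw) as [b [Hbq Hser]]; [unfold q; lra|].
    assert (Hb0 : b 0%nat = 0%C).
    { assert (E : is_Cseries (fun n => b n * 0 ^ n)%C (b 0%nat)).
      { apply (is_Cseries_Csum _ _ (fun _ => 0)); [apply is_lim_seq_const|].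
        intro N.
        assert (ES : Csum (fun n => b n * 0 ^ n)%C N = b 0%nat).
        { induction N as [|N IH]; [apply Cmult_1_r|].
          rewrite Csum_S, IH, Cpow_S; ring. }
        rewrite ES; replace (b 0%nat - b 0%nat)%C with (RtoC 0) by ring.
        rewrite Cmod_0; lra. }
      rewrite <- H0; apply (is_Cseries_unique _ _ _ E), Hser; rewrite Cmod_0; unfold q; lra. }
    set (g := Cps (fun n => b (S n))).
    assert (Hrad : Rbar_le q (crad (fun n => b (S n)))).
    { unfold crad; rewrite <- (CV_radius_incr_1 (fun n => Cmod (b (S n)))).
      rewrite (CV_radius_ext _ (fun n => Cmod (b n))); [exact Hbq|].
      intros [|n]; [rewrite Hb0; symmetry; apply Cmod_0 | reflexivity]. }
    assert (Hg : forall u, Cmod u < q -> w u = (u * g u)%C).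
    { intros u Hu; apply (is_Cseries_unique (fun n => b n * u ^ n)%C); [apply Hser; auto|].
      apply is_Cseries_shift; [rewrite Hb0; ring|].
      apply (is_Cseries_ext (fun n => u * (b (S n) * u ^ n))%C); [intro n; rewrite Cpow_S; ring|].
      apply is_Cseries_scal, Cps_correct.
      eapply Rbar_lt_le_trans; [|exact Hrad]; exact Hu. }
    assert (Hgk : forall k, holo (fun u => g u ^ k)%C q).
    { intros k u Hu; eapply cderiv_pow, cderiv_Cps.
      eapply Rbar_lt_le_trans; [|exact Hrad]; exact Hu. }
    assert (Bd : r * Cmod (g z) <= 1).
    { apply (pow_bounded_le_1 _ (r / (r - Cmod z))).
      { apply Rmult_le_pos; [lra | apply Cmod_ge_0]. }
      intro k.
      pose proof (holo_bound _ q r ((/ r) ^ k) z (Hgk k) Hr1 ltac:(unfold q; lra)) as B.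
      cbv beta in B; rewrite Rpow_mult_distr; rewrite Cmod_pow in B.
      assert (Pr : 0 < r ^ k) by (apply pow_lt; lra).
      replace (r / (r - Cmod z)) with (r ^ k * ((/ r) ^ k * (r / (r - Cmod z))))
        by (rewrite pow_inv; field; lra).
      apply Rmult_le_compat_l; [lra|]; apply B.
      intros u Hu; rewrite Cmod_pow; apply pow_incr; split; [apply Cmod_ge_0|].
      apply Rmult_le_reg_l with r; [lra|]; rewrite Rinv_r by lra.
      rewrite <- Hu, <- Cmod_mult, <- Hg by (unfold q; lra).
      left; apply Hb; lra. }
    rewrite Hg, Cmod_mult by (unfold q; lra).
    pose proof (Cmod_ge_0 (g z)); nra. }
  apply Rnot_lt_le; intro Hlt.
  pose proof (Cmod_ge_0 z) as Pz; pose proof (Hb z Hz) as Hwz.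
  set (y := Cmod (w z)) in *; set (x := Cmod z) in *.
  (* If [y > x], this radius exceeds both [x] and [x / y] and is below 1, so [r * y > x] contradicts
     [Key]. *)
  set (r := Rmax ((1 + x) / 2) ((1 + x / y) / 2)).
  assert (Hxy : x / y < 1) by (apply Rmult_lt_reg_r with y; unfold Rdiv; [lra|]; rewrite Rmult_assoc, Rinv_l; lra).
  assert (R1 : x < r) by (eapply Rlt_le_trans; [|apply Rmax_l]; lra).
  assert (R2 : r < 1) by (apply Rmax_lub_lt; lra).
  assert (R3 : x / y < r) by (eapply Rlt_le_trans; [|apply Rmax_r]; lra).
  specialize (Key r R1 R2).
  assert (x < r * y); [|lra].
  apply Rmult_lt_compat_r with (r := y) in R3; [|lra].
  unfold Rdiv in R3; rewrite Rmult_assoc, Rinv_l in R3; lra.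
Qed.

(** * Positive sine series *)

Lemma is_RInt_ext_val (f g : R -> R) (a b l l' : R) :
  is_RInt f a b l -> (forall x, f x = g x) -> l = l' -> is_RInt g a b l'.
Proof. intros H E <-; revert H; apply is_RInt_ext; intros; apply E. Qed.

Lemma sin_INR_PI (n : nat) : sin (INR n * PI) = 0.
Proof.
  induction n as [|n IH]; [simpl; rewrite Rmult_0_l; apply sin_0|].
  rewrite S_INR, Rmult_plus_distr_r, Rmult_1_l, neg_sin, IH; ring.
Qed.

Lemma cos_RInt (k : R) : k <> 0 -> sin (k * PI) = 0 ->
  is_RInt (fun t => cos (k * t)) 0 PI 0.
Proof.
  intros Hk E.
  replace 0 with (minus (sin (k * PI) / k) (sin (k * 0) / k)) at 2.
  - apply (is_RInt_derive (fun t => sin (k * t) / k)).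
    + intros x _; auto_derive; auto; field; auto.
    + intros x _; apply (ex_derive_continuous (V := R_NormedModule)); auto_derive; auto.
  - rewrite E, Rmult_0_r, sin_0; change (0 / k - 0 / k = 0); field; auto.
Qed.

Lemma sin_orthogonal (n m : nat) : (0 < m)%nat ->
  is_RInt (fun t => sin (INR n * t) * sin (INR m * t)) 0 PI
    (if Nat.eqb n m then PI / 2 else 0).
Proof.
  intros Hm.
  assert (Pm : 0 < INR m) by (apply lt_0_INR; auto).
  pose proof (pos_INR n) as Pn.
  assert (Ep : sin ((INR n + INR m) * PI) = 0).
  { rewrite Rmult_plus_distr_r, sin_plus, !sin_INR_PI; ring. }
  pose proof (cos_RInt (INR n + INR m) ltac:(lra) Ep) as I1.
  destruct (Nat.eqb_spec n m) as [E|E].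
  - subst n.
    pose proof (is_RInt_const (V := R_NormedModule) 0 PI 1) as I0.
    pose proof (is_RInt_scal (V := R_NormedModule) _ _ _ (/ 2) _ (is_RInt_minus (V := R_NormedModule) _ _ _ _ _ _ I0 I1)) as I.
    apply (is_RInt_ext_val _ _ _ _ _ _ I); [intro t | change (/ 2 * ((PI - 0) * 1 - 0) = PI / 2); field].
   
    change (/ 2 * (1 - cos ((INR m + INR m) * t)) = sin (INR m * t) * sin (INR m * t)).
    rewrite Rmult_plus_distr_r, cos_plus.
    pose proof (sin2_cos2 (INR m * t)) as S; unfold Rsqr in S; lra.
  - assert (Em : sin ((INR n - INR m) * PI) = 0).
    { rewrite Rmult_minus_distr_r, sin_minus, !sin_INR_PI; ring. }
    assert (Hd : INR n - INR m <> 0) by (intro H; apply E, INR_eq; lra).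
    pose proof (cos_RInt (INR n - INR m) Hd Em) as I0.
    pose proof (is_RInt_scal (V := R_NormedModule) _ _ _ (/ 2) _ (is_RInt_minus (V := R_NormedModule) _ _ _ _ _ _ I0 I1)) as I.
    apply (is_RInt_ext_val _ _ _ _ _ _ I); [intro t | change (/ 2 * (0 - 0) = 0); ring].
   
    change (/ 2 * (cos ((INR n - INR m) * t) - cos ((INR n + INR m) * t)) = sin (INR n * t) * sin (INR m * t)).
    rewrite Rmult_plus_distr_r, Rmult_minus_distr_r, cos_plus, cos_minus; field.
Qed.

Definition sine_sum (c : nat -> R) (N : nat) (t : R) : R :=
  sum_n (fun n => c n * sin (INR n * t)) N.

Lemma sine_sum_S (c : nat -> R) (N : nat) (t : R) :
  sine_sum c (S N) t = sine_sum c N t + c (S N) * sin (INR (S N) * t).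
Proof. unfold sine_sum; rewrite sum_Sn; reflexivity. Qed.

Lemma sine_sum_0 (c : nat -> R) (t : R) : sine_sum c 0 t = 0.
Proof. unfold sine_sum; rewrite sum_O; simpl; rewrite Rmult_0_l, sin_0; ring. Qed.

Lemma sine_coeff (g : nat -> R) (N m : nat) : (0 < m)%nat ->
  is_RInt (fun t => sine_sum g N t * sin (INR m * t)) 0 PI
    (if Nat.leb m N then g m * (PI / 2) else 0).
Proof.
  intros Hm; induction N as [|N IH].
  - destruct m as [|m]; [lia|].
    pose proof (is_RInt_const (V := R_NormedModule) 0 PI 0) as I0.
    apply (is_RInt_ext_val _ _ _ _ _ _ I0); [intro t | change ((PI - 0) * 0 = 0); ring].
    rewrite sine_sum_0; ring.
  - pose proof (is_RInt_plus (V := R_NormedModule) _ _ _ _ _ _ IH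
      (is_RInt_scal (V := R_NormedModule) _ _ _ (g (S N)) _ (sin_orthogonal (S N) m Hm))) as I.
    assert (E : plus (if (m <=? N)%nat then g m * (PI / 2) else 0)
          (scal (g (S N)) (if (S N =? m)%nat then PI / 2 else 0))
       = (if (m <=? S N)%nat then g m * (PI / 2) else 0)).
    { change ((if (m <=? N)%nat then g m * (PI / 2) else 0)
          + (g (S N)) * (if (S N =? m)%nat then PI / 2 else 0)
          = (if (m <=? S N)%nat then g m * (PI / 2) else 0)).
      destruct (Nat.leb_spec m N), (Nat.eqb_spec (S N) m), (Nat.leb_spec m (S N)); try lia; subst; ring. }
    apply (is_RInt_ext_val _ _ _ _ _ _ I); [intro t | exact E].
    rewrite sine_sum_S.
    change (sine_sum g N t * sin (INR m * t) + g (S N) * (sin (INR (S N) * t) * sin (INR m * t))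
      = (sine_sum g N t + g (S N) * sin (INR (S N) * t)) * sin (INR m * t)); ring.
Qed.

(** Separate orders [N] and [M] allow induction on the second factor with the first held fixed. The
    term of index 0 is invisible to a sine sum; [g 0 = 0] removes it from the sum of products as
    well. *)
Lemma sine_parseval (g c : nat -> R) (N M : nat) : g 0%nat = 0 -> (M <= N)%nat ->
  is_RInt (fun t => sine_sum g N t * sine_sum c M t) 0 PI
    (PI / 2 * sum_n (fun n => g n * c n) M).
Proof.
  intros Hg; induction M as [|M IH]; intros HM.
  - rewrite sum_O, Hg.
    pose proof (is_RInt_const (V := R_NormedModule) 0 PI 0) as I0.
    apply (is_RInt_ext_val _ _ _ _ _ _ I0); [intro t | change ((PI - 0) * 0 = PI / 2 * (0 * c 0%nat)); ring].
    rewrite sine_sum_0; ring.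
  - pose proof (is_RInt_plus (V := R_NormedModule) _ _ _ _ _ _ (IH ltac:(lia))
      (is_RInt_scal (V := R_NormedModule) _ _ _ (c (S M)) _ (sine_coeff g N (S M) ltac:(lia)))) as I.
    destruct (Nat.leb_spec (S M) N) as [_|]; [|lia].
    assert (E : plus (PI / 2 * sum_n (fun n => g n * c n) M) (scal (c (S M)) (g (S M) * (PI / 2)))
       = PI / 2 * sum_n (fun n => g n * c n) (S M)).
    { rewrite sum_Sn.
      change (PI / 2 * sum_n (fun n => g n * c n) M + c (S M) * (g (S M) * (PI / 2))
       = PI / 2 * (sum_n (fun n => g n * c n) M + g (S M) * c (S M))); ring. }
    apply (is_RInt_ext_val _ _ _ _ _ _ I); [intro t | exact E].
    rewrite (sine_sum_S c).
    change (sine_sum g N t * sine_sum c M t + c (S M) * (sine_sum g N t * sin (INR (S M) * t))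
      = sine_sum g N t * (sine_sum c M t + c (S M) * sin (INR (S M) * t))); ring.
Qed.

Definition tail (c : nat -> R) (N : nat) : R :=
  Series (fun n => Rabs (c n)) - sum_n (fun n => Rabs (c n)) N.

Lemma tail_lim (c : nat -> R) : ex_series (fun n => Rabs (c n)) -> is_lim_seq (tail c) 0.
Proof.
  intros Hc; unfold tail.
  replace (Finite 0) with (Finite (Series (fun n => Rabs (c n)) - Series (fun n => Rabs (c n))))
    by (f_equal; ring).
  apply is_lim_seq_minus'; [apply is_lim_seq_const | exact (Series_correct _ Hc)].
Qed.

Lemma partial_sum_le (v : nat -> R) (N : nat) : (forall n, 0 <= v n) -> ex_series v ->
  sum_n v N <= Series v.
Proof.
  intros Hv He.
  apply (is_lim_seq_incr_compare (sum_n v) (Series v)).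
  - exact (Series_correct _ He).
  - intro n; rewrite sum_Sn; change (sum_n v n <= sum_n v n + v (S n)); specialize (Hv (S n)); lra.
Qed.

Lemma sine_abs_le (c : nat -> R) (t : R) (n : nat) : Rabs (c n * sin (INR n * t)) <= Rabs (c n).
Proof.
  rewrite Rabs_mult; pose proof (Rabs_pos (c n)).
  assert (Rabs (sin (INR n * t)) <= 1) by (apply Rabs_le, SIN_bound); nra.
Qed.

(** The series of [|c n| - c n sin (n t)] has nonnegative terms, so its partial sums stay below its
    sum. The error does not depend on [t], which allows integration. *)
Lemma sine_tail (c : nat -> R) (N : nat) (t : R) : ex_series (fun n => Rabs (c n)) ->
  Series (fun n => c n * sin (INR n * t)) - tail c N <= sine_sum c N t.
Proof.
  intros Hc; unfold tail, sine_sum.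
  assert (E1 : ex_series (fun n => Rabs (c n * sin (INR n * t)))).
  { apply (ex_series_le (V := R_CompleteNormedModule) _ (fun n => Rabs (c n))); auto.
    intro n; change (Rabs (Rabs (c n * sin (INR n * t))) <= Rabs (c n)).
    rewrite Rabs_Rabsolu; apply sine_abs_le. }
  apply ex_series_Rabs in E1.
  set (v := fun n => Rabs (c n) - c n * sin (INR n * t)).
  assert (Hv : forall n, 0 <= v n).
  { intro n; unfold v; pose proof (sine_abs_le c t n); pose proof (Rle_abs (c n * sin (INR n * t))); lra. }
  pose proof (is_series_minus _ _ _ _ (Series_correct _ Hc) (Series_correct _ E1)) as I.
  assert (Hs : sum_n v N <= Series v) by (apply partial_sum_le; auto; eexists; exact I).
  assert (Es : Series v = Series (fun n => Rabs (c n)) - Series (fun n => c n * sin (INR n * t)))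
    by exact (is_series_unique v _ I).
  rewrite Es in Hs.
  assert (Ev : sum_n v N = sum_n (fun n => Rabs (c n)) N - sum_n (fun n => c n * sin (INR n * t)) N).
  { clear; induction N as [|N IH]; [rewrite !sum_O; reflexivity|].
    rewrite !sum_Sn, IH; unfold v.
    match goal with |- plus (?a - ?b) (?c - ?d) = plus _ _ - plus _ _ =>
      change (a - b + (c - d) = a + c - (b + d)) end; ring. }
  rewrite Ev in Hs; lra.
Qed.

Lemma sine_sum_bound (c : nat -> R) (N : nat) (t : R) : ex_series (fun n => Rabs (c n)) ->
  Rabs (sine_sum c N t) <= Series (fun n => Rabs (c n)).
Proof.
  intros Hc; eapply Rle_trans; [|apply (partial_sum_le _ N); [intro; apply Rabs_pos | auto]].
  unfold sine_sum; induction N as [|N IH].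
  - rewrite !sum_O; apply sine_abs_le.
  - rewrite !sum_Sn; eapply Rle_trans; [apply Rabs_triang|].
    apply Rplus_le_compat; [exact IH | apply sine_abs_le].
Qed.

Lemma sine_sum_ex_RInt (c : nat -> R) (N : nat) : ex_RInt (sine_sum c N) 0 PI.
Proof.
  apply (ex_RInt_continuous (V := R_CompleteNormedModule)); intros t _.
  apply (ex_derive_continuous (V := R_NormedModule)).
  induction N as [|N IH].
  - apply (ex_derive_ext (fun _ => 0)); [intro; rewrite sine_sum_0; auto | apply ex_derive_const].
  - apply (ex_derive_ext (fun t => sine_sum c N t + c (S N) * sin (INR (S N) * t))).
    { intro; rewrite sine_sum_S; auto. }
    apply (ex_derive_plus (V := R_NormedModule)); auto; auto_derive; auto.
Qed.

(* Positivity of the coefficient pairing: partial sums are almost nonnegative, and Parseval is a finite identity. *)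
Lemma sine_pairing_nonneg (g c : nat -> R) : g 0%nat = 0 ->
  ex_series (fun n => Rabs (g n)) -> ex_series (fun n => Rabs (c n)) ->
  (forall t, 0 <= t <= PI -> 0 <= Series (fun n => g n * sin (INR n * t))) ->
  (forall t, 0 <= t <= PI -> 0 <= Series (fun n => c n * sin (INR n * t))) ->
  forall s : R, is_series (fun n => g n * c n) s -> 0 <= s.
Proof.
  intros Hg0 Hg Hc Pg Pc s Hs; pose proof PI_RGT_0 as PP.
  set (G := Series (fun n => Rabs (g n))); set (D := Series (fun n => Rabs (c n))).
  assert (Key : forall N, - (tail c N * (PI * G) + tail g N * (PI * D) + tail g N * tail c N * PI)
                          <= PI / 2 * sum_n (fun n => g n * c n) N).
  { intro N.
    assert (Tg : 0 <= tail g N).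
    { unfold tail; pose proof (partial_sum_le (fun n => Rabs (g n)) N (fun n => Rabs_pos _) Hg); lra. }
    assert (Tc : 0 <= tail c N).
    { unfold tail; pose proof (partial_sum_le (fun n => Rabs (c n)) N (fun n => Rabs_pos _) Hc); lra. }
    destruct (sine_sum_ex_RInt g N) as [Ig HIg]; destruct (sine_sum_ex_RInt c N) as [Ic HIc].
    pose proof (sine_parseval g c N N Hg0 (Nat.le_refl _)) as IP.
    pose proof (is_RInt_const (V := R_NormedModule) 0 PI (tail g N * tail c N)) as I0.
    pose proof (is_RInt_plus (V := R_NormedModule) _ _ _ _ _ _
      (is_RInt_plus (V := R_NormedModule) _ _ _ _ _ _ IP I0)
      (is_RInt_plus (V := R_NormedModule) _ _ _ _ _ _
        (is_RInt_scal (V := R_NormedModule) _ _ _ (tail c N) _ HIg)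
        (is_RInt_scal (V := R_NormedModule) _ _ _ (tail g N) _ HIc))) as I.
    (* Raised by its tail, each partial sum is nonnegative, hence so is the integral of the product.
       Expanded, this is Parseval's sum plus three terms that vanish with the tails. *)
    assert (Pos : 0 <= PI / 2 * sum_n (fun n => g n * c n) N + (PI - 0) * (tail g N * tail c N)
                     + (tail c N * Ig + tail g N * Ic)).
    { assert (Z : is_RInt (fun _ => 0) 0 PI 0).
      { apply (is_RInt_ext_val _ _ _ _ _ _ (is_RInt_const (V := R_NormedModule) 0 PI 0));
          [reflexivity | change ((PI - 0) * 0 = 0); ring]. }
      refine (is_RInt_le _ _ 0 PI 0 _ _ Z I _); [lra |].
      intros t Ht.
      change (0 <= sine_sum g N t * sine_sum c N t + tail g N * tail c N
                   + (tail c N * sine_sum g N t + tail g N * sine_sum c N t)).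
      pose proof (sine_tail g N t Hg); pose proof (sine_tail c N t Hc).
      specialize (Pg t ltac:(lra)); specialize (Pc t ltac:(lra)).
      replace (sine_sum g N t * sine_sum c N t + tail g N * tail c N
                   + (tail c N * sine_sum g N t + tail g N * sine_sum c N t))
        with ((sine_sum g N t + tail g N) * (sine_sum c N t + tail c N)) by ring.
      apply Rmult_le_pos; lra. }
    assert (Bg : Rabs Ig <= (PI - 0) * G).
    { eapply (norm_RInt_le_const (V := R_NormedModule)); [lra | | exact HIg].
      intros; apply sine_sum_bound; auto. }
    assert (Bc : Rabs Ic <= (PI - 0) * D).
    { eapply (norm_RInt_le_const (V := R_NormedModule)); [lra | | exact HIc].
      intros; apply sine_sum_bound; auto. }
    pose proof (Rle_abs Ig); pose proof (Rle_abs Ic).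
    assert (tail c N * Ig <= tail c N * (PI * G)) by (apply Rmult_le_compat_l; lra).
    assert (tail g N * Ic <= tail g N * (PI * D)) by (apply Rmult_le_compat_l; lra).
    lra. }
  assert (L : 0 <= PI / 2 * s); [|nra].
  pose proof (tail_lim g Hg) as Lg; pose proof (tail_lim c Hc) as Lc.
  apply (is_lim_seq_le (fun _ => 0) (fun N => PI / 2 * sum_n (fun n => g n * c n) N
           + (tail c N * (PI * G) + tail g N * (PI * D) + tail g N * tail c N * PI)) 0 (PI / 2 * s)).
  - intro N; specialize (Key N); lra.
  - apply is_lim_seq_const.
  - replace (Finite (PI / 2 * s))
      with (Finite (PI / 2 * s + (0 * (PI * G) + 0 * (PI * D) + 0 * 0 * PI))) by (f_equal; ring).
    apply is_lim_seq_plus'; [apply (is_lim_seq_scal_l (sum_n (fun n => g n * c n)) (PI / 2) s Hs)|].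
    repeat apply is_lim_seq_plus'; repeat apply is_lim_seq_mult'; auto; apply is_lim_seq_const.
Qed.

Lemma is_series_eq (u v : nat -> R) (s l : R) :
  is_series u s -> (forall n, u n = v n) -> s = l -> is_series v l.
Proof. intros H E <-; revert H; apply is_series_ext, E. Qed.

Lemma circ_pow (n : nat) (s : R) : (circ s ^ n)%C = circ (INR n * s).
Proof.
  induction n as [|n IH].
  - unfold circ; simpl; rewrite Rmult_0_l, cos_0, sin_0; reflexivity.
  - rewrite Cpow_S, IH, S_INR, Rmult_plus_distr_r, Rmult_1_l; unfold circ.
    rewrite cos_plus, sin_plus; apply C_ext; unfold Re, Im; simpl; ring.
Qed.

Lemma geometric_Cseries (q : C) : Cmod q < 1 -> is_Cseries (fun n => q ^ n)%C (/ (1 - q))%C.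
Proof.
  intros Hy.
  assert (Hq1 : 1 - Cmod q <= Cmod (1 - q)).
  { pose proof (Cmod_triangle (1 - q) q) as T.
    replace (1 - q + q)%C with (RtoC 1) in T by ring; rewrite Cmod_1 in T; lra. }
  assert (Hq0 : (1 - q)%C <> 0) by (apply Cmod_gt_0; lra).
  apply (is_Cseries_Csum _ _ (fun N => / (1 - Cmod q) * Cmod q ^ S N)).
  - replace (Finite 0) with (Rbar_mult (/ (1 - Cmod q)) (Finite 0)) by (simpl; f_equal; ring).
    apply is_lim_seq_scal_l; apply (is_lim_seq_incr_1 (fun n => Cmod q ^ n)), is_lim_seq_geom.
    rewrite Rabs_pos_eq; auto using Cmod_ge_0.
  - intro N.
    assert (E : (/ (1 - q) - Csum (fun n => q ^ n) N = q ^ S N / (1 - q))%C).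
    { induction N as [|N IH]; [rewrite Csum_O; simpl; field; auto|].
      rewrite Csum_S.
      replace (/ (1 - q) - (Csum (fun n => q ^ n) N + q ^ S N))%C
        with (/ (1 - q) - Csum (fun n => q ^ n) N - q ^ S N)%C by ring.
      rewrite IH, (Cpow_S q (S N)); field; auto. }
    rewrite E, Cmod_div, Cmod_pow by auto; unfold Rdiv; rewrite Rmult_comm.
    apply Rmult_le_compat_r; [apply pow_le, Cmod_ge_0 | apply Rinv_le_contravar; lra].
Qed.

Lemma geometric_sine (y t : R) : Rabs y < 1 ->
  is_series (fun n => y ^ n * sin (INR n * t)) (y * sin t / (1 - 2 * y * cos t + y ^ 2)).
Proof.
  intros Hy.
  set (q := (RtoC y * circ t)%C).
  assert (Hq : Cmod q = Rabs y) by (unfold q; rewrite Cmod_mult, Cmod_R, Cmod_circ; ring).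
  assert (Hq1 : Cmod q < 1) by lra.
  destruct (geometric_Cseries q Hq1) as [_ S].
  apply (is_series_eq _ _ _ _ S).
  - intro n; unfold q; rewrite Cpow_mult_l, circ_pow, <- RtoC_pow, im_scal_l; reflexivity.
  - assert (D : (1 - y * cos t) ^ 2 + (y * sin t) ^ 2 = 1 - 2 * y * cos t + y ^ 2).
    { pose proof (sin2_cos2 t) as P; unfold Rsqr in P.
      replace ((1 - y * cos t) ^ 2 + (y * sin t) ^ 2)
        with (1 - 2 * y * cos t + y ^ 2 * (sin t * sin t + cos t * cos t)) by ring.
      rewrite P; ring. }
    assert (P : 0 < 1 - 2 * y * cos t + y ^ 2).
    { rewrite <- D; pose proof (pow2_ge_0 (y * sin t)).
      assert (0 < 1 - y * cos t).
      { pose proof (COS_bound t); apply Rabs_def2 in Hy; nra. }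
      assert (0 < (1 - y * cos t) ^ 2) by (apply pow_lt; auto); lra. }
    unfold q, circ, Im, Cinv; simpl.
    replace ((1 + - (y * cos t - 0 * sin t)) * ((1 + - (y * cos t - 0 * sin t)) * 1) +
      (0 + - (y * sin t + 0 * cos t)) * ((0 + - (y * sin t + 0 * cos t)) * 1))
      with (1 - 2 * y * cos t + y ^ 2) by (rewrite <- D; ring).
    simpl in P |- *; field; lra.
Qed.

Lemma is_series_delta (n : nat) (v : nat -> R) :
  is_series (fun k => if Nat.eqb k n then v k else 0) (v n).
Proof.
  enough (L : is_lim_seq (sum_n (fun k => if Nat.eqb k n then v k else 0)) (v n)) by exact L.
  apply (is_lim_seq_ext_loc (fun _ => v n)); [|apply is_lim_seq_const].
  exists n; intros N HN.
  assert (E : forall m, sum_n (fun k => if Nat.eqb k n then v k else 0) m = if Nat.leb n m then v n else 0).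
  { induction m as [|m IH].
    - rewrite sum_O; destruct n; reflexivity.
    - rewrite sum_Sn, IH.
      change ((if (n <=? m)%nat then v n else 0) + (if (S m =? n)%nat then v (S m) else 0)
        = if (n <=? S m)%nat then v n else 0).
      destruct (Nat.leb_spec n m), (Nat.eqb_spec (S m) n), (Nat.leb_spec n (S m)); try lia; subst; ring. }
  rewrite E; destruct (Nat.leb_spec n N); [reflexivity | lia].
Qed.

Lemma ex_series_Rabs_plus (u v : nat -> R) : ex_series (fun n => Rabs (u n)) ->
  ex_series (fun n => Rabs (v n)) -> ex_series (fun n => Rabs (u n + v n)).
Proof.
  intros Hu Hv.
  apply (ex_series_le (V := R_CompleteNormedModule) _ (fun n => Rabs (u n) + Rabs (v n))).
  - intro n; change (Rabs (Rabs (u n + v n)) <= Rabs (u n) + Rabs (v n)).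
    rewrite Rabs_Rabsolu; apply Rabs_triang.
  - exact (ex_series_plus _ _ Hu Hv).
Qed.

Lemma ex_series_Rabs_scal (c : R) (u : nat -> R) : ex_series (fun n => Rabs (u n)) ->
  ex_series (fun n => Rabs (c * u n)).
Proof.
  intros [s Hu]; exists (Rabs c * s).
  apply (is_series_eq _ _ _ _ (is_series_scal (Rabs c) _ _ Hu)); [|reflexivity].
  intro n; rewrite Rabs_mult; reflexivity.
Qed.

Lemma ex_series_Rabs_delta (n : nat) : ex_series (fun k => Rabs (if Nat.eqb k n then 1 else 0)).
Proof.
  exists 1; apply (is_series_eq _ _ _ _ (is_series_delta n (fun _ => 1))); [|reflexivity].
  intro k; destruct (Nat.eqb k n); [rewrite Rabs_R1 | rewrite Rabs_R0]; reflexivity.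
Qed.

Lemma ex_series_Rabs_geom (x : R) : Rabs x < 1 -> ex_series (fun n => Rabs (x ^ n)).
Proof.
  intros H; apply (ex_series_ext (fun n => Rabs x ^ n)); [intro; apply RPow_abs|].
  apply ex_series_geom; rewrite Rabs_Rabsolu; auto.
Qed.

Lemma sin_mult_le (n : nat) (t : R) : 0 <= t <= PI -> Rabs (sin (INR n * t)) <= INR n * sin t.
Proof.
  intros Ht; assert (Hs : 0 <= sin t) by (apply sin_ge_0; lra).
  induction n as [|n IH]; [simpl; rewrite Rmult_0_l, sin_0, Rabs_R0; lra|].
  rewrite S_INR, !Rmult_plus_distr_r, !Rmult_1_l, sin_plus.
  eapply Rle_trans; [apply Rabs_triang|]; rewrite !Rabs_mult, (Rabs_pos_eq (sin t)) by auto.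
  assert (Rabs (cos t) <= 1) by (apply Rabs_le, COS_bound).
  assert (Rabs (cos (INR n * t)) <= 1) by (apply Rabs_le, COS_bound).
  pose proof (Rabs_pos (sin (INR n * t))); nra.
Qed.

(** A condition on a single circle: [g n] stands for [a n * r ^ n], and the series for the imaginary
    part on the upper half of that circle. *)
Definition sine_nonneg (g : nat -> R) : Prop :=
  g 0%nat = 0 /\ ex_series (fun n => Rabs (g n)) /\
  forall t, 0 <= t <= PI -> 0 <= Series (fun n => g n * sin (INR n * t)).

Lemma sine_nonneg_coeff (g : nat -> R) (n : nat) : sine_nonneg g ->
  Rabs (g n) <= INR n * g 1%nat.
Proof.
  intros (Hg0 & Hg & Pg).
  assert (K : forall sg, Rabs sg <= 1 -> 0 <= INR n * g 1%nat + sg * g n).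
  { intros sg Hsg.
    set (c := fun k => INR n * (if Nat.eqb k 1 then 1 else 0) + sg * (if Nat.eqb k n then 1 else 0)).
    assert (Sc : forall v, is_series (fun k => c k * v k) (INR n * v 1%nat + sg * v n)).
    { intro v.
      apply (is_series_eq _ _ _ _ (is_series_plus _ _ _ _
         (is_series_scal (INR n) _ _ (is_series_delta 1 v)) (is_series_scal sg _ _ (is_series_delta n v))));
        [|reflexivity].
      intro k; unfold c.
      match goal with |- plus (scal ?p ?a) (scal ?q ?b) = _ => change (p * a + q * b = 
        (INR n * (if (k =? 1)%nat then 1 else 0) + sg * (if (k =? n)%nat then 1 else 0)) * v k) end.
      destruct (k =? 1)%nat, (k =? n)%nat; ring. }
    apply (sine_pairing_nonneg g c); auto.
    - apply ex_series_Rabs_plus; apply ex_series_Rabs_scal, ex_series_Rabs_delta.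
    - intros t Ht; rewrite (is_series_unique _ _ (Sc (fun k => sin (INR k * t)))).
      pose proof (sin_mult_le n t Ht); simpl (INR 1); rewrite Rmult_1_l.
      assert (Rabs (sg * sin (INR n * t)) <= INR n * sin t).
      { rewrite Rabs_mult; pose proof (Rabs_pos (sin (INR n * t))); nra. }
      apply Rabs_le_between in H0; lra.
    - apply (is_series_eq _ _ _ _ (Sc g)); [intro; ring | reflexivity]. }
  pose proof (K 1 ltac:(rewrite Rabs_R1; lra)); pose proof (K (-1) ltac:(rewrite Rabs_left; lra)).
  apply Rabs_le; lra.
Qed.

Lemma kernel_den_pos (x t : R) : 0 < x < 1 -> -1 <= t <= 1 -> 0 < 1 - 2 * x * t + x ^ 2.
Proof. intros; nra. Qed.

(* [x / (1 - 2 x t + x^2) = 1 / (s - 2 t)] with [s = x + 1/x] is the Koebe-type kernel of a typically real function. *)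
Lemma sine_nonneg_kernel (g : nat -> R) (al be ka x : R) : sine_nonneg g -> 0 < x < 1 ->
  (forall t, -1 <= t <= 1 ->
     ka <= al * (x / (1 - 2 * x * t + x ^ 2)) + be * (x / (1 + 2 * x * t + x ^ 2))) ->
  ka * g 1%nat <= al * Series (fun n => g n * x ^ n) - be * Series (fun n => g n * (- x) ^ n).
Proof.
  intros (Hg0 & Hg & Pg) Hx Hk.
  assert (Ax : Rabs x < 1) by (rewrite Rabs_pos_eq; lra).
  assert (Anx : Rabs (- x) < 1) by (rewrite Rabs_Ropp; auto).
  set (c := fun n => al * x ^ n + (- be * (- x) ^ n + - ka * (if Nat.eqb n 1 then 1 else 0))).
  assert (Hgx : forall y, Rabs y < 1 -> ex_series (fun n => g n * y ^ n)).
  { intros y Hy; apply (ex_series_le (V := R_CompleteNormedModule) _ (fun n => Rabs (g n))); auto.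
    intro n; change (Rabs (g n * y ^ n) <= Rabs (g n)); rewrite Rabs_mult, <- RPow_abs.
    assert (Rabs y ^ n <= 1) by (rewrite <- (pow1 n); apply pow_incr; split; [apply Rabs_pos | lra]).
    pose proof (Rabs_pos (g n)); nra. }
  assert (Sc : forall v s1 s2, is_series (fun n => x ^ n * v n) s1 -> is_series (fun n => (- x) ^ n * v n) s2 ->
     is_series (fun k => c k * v k) (al * s1 + (- be * s2 + - ka * v 1%nat))).
  { intros v s1 s2 H1 H2.
    apply (is_series_eq _ _ _ _ (is_series_plus _ _ _ _ (is_series_scal al _ _ H1)
       (is_series_plus _ _ _ _ (is_series_scal (- be) _ _ H2)
         (is_series_scal (- ka) _ _ (is_series_delta 1 v))))); [|reflexivity].
    intro k; unfold c.
    change (al * (x ^ k * v k) + (- be * ((- x) ^ k * v k) + - ka * (if (k =? 1)%nat then v k else 0))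
      = (al * x ^ k + (- be * (- x) ^ k + - ka * (if (k =? 1)%nat then 1 else 0))) * v k).
    destruct (k =? 1)%nat; ring. }
  assert (P : 0 <= al * Series (fun n => g n * x ^ n) + (- be * Series (fun n => g n * (- x) ^ n) + - ka * g 1%nat)).
  { apply (sine_pairing_nonneg g c); auto.
    - repeat apply ex_series_Rabs_plus; apply ex_series_Rabs_scal;
        [apply ex_series_Rabs_geom | apply ex_series_Rabs_geom | apply ex_series_Rabs_delta]; auto.
    - intros t Ht.
      rewrite (is_series_unique _ _ (Sc (fun k => sin (INR k * t)) _ _ (geometric_sine x t Ax) (geometric_sine (- x) t Anx))).
      simpl (INR 1); rewrite Rmult_1_l.
      assert (Hs : 0 <= sin t) by (apply sin_ge_0; lra).
      specialize (Hk (cos t) (COS_bound t)).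
      replace (1 - 2 * - x * cos t + (- x) ^ 2) with (1 + 2 * x * cos t + x ^ 2) by ring.
      replace (al * (x * sin t / (1 - 2 * x * cos t + x ^ 2)) +
        (- be * (- x * sin t / (1 + 2 * x * cos t + x ^ 2)) + - ka * sin t))
        with (sin t * (al * (x / (1 - 2 * x * cos t + x ^ 2)) + be * (x / (1 + 2 * x * cos t + x ^ 2)) - ka))
        by (unfold Rdiv; ring).
      apply Rmult_le_pos; lra.
    - refine (is_series_eq _ _ _ _ (Sc g _ _ _ _) _ eq_refl).
      + apply (is_series_eq (fun n => g n * x ^ n) _ (Series (fun n => g n * x ^ n)));
          [apply Series_correct; auto | intro; ring | reflexivity].
      + apply (is_series_eq (fun n => g n * (- x) ^ n) _ (Series (fun n => g n * (- x) ^ n)));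
          [apply Series_correct; auto | intro; ring | reflexivity].
      + intro; ring. }
  lra.
Qed.

Definition sine_nonneg_on (a : nat -> R) (rho : R) : Prop :=
  a 0%nat = 0 /\ Rbar_le rho (CV_radius a) /\
  forall r t, 0 < r < rho -> 0 <= t <= PI -> 0 <= Series (fun n => a n * r ^ n * sin (INR n * t)).

Lemma sine_nonneg_scale (a : nat -> R) (rho r : R) : sine_nonneg_on a rho -> 0 < r < rho ->
  sine_nonneg (fun n => a n * r ^ n).
Proof.
  intros (H0 & Hc & Hp) Hr; repeat split.
  - rewrite H0; ring.
  - apply CV_disk_inside; rewrite Rabs_pos_eq by lra.
    eapply Rbar_lt_le_trans; [|exact Hc]; simpl; lra.
  - intros t Ht; apply Hp; auto.
Qed.

(** The point of evaluation is a product [r * x]: the factor [r] moves the coefficients to a circle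
    of absolute convergence, and [x] is the parameter of the kernel. *)
Lemma sine_nonneg_on_kernel (a : nat -> R) (rho r al be ka x : R) :
  sine_nonneg_on a rho -> 0 < r < rho -> 0 < x < 1 ->
  (forall t, -1 <= t <= 1 ->
     ka <= al * (x / (1 - 2 * x * t + x ^ 2)) + be * (x / (1 + 2 * x * t + x ^ 2))) ->
  ka * (a 1%nat * r) <= al * PSeries a (r * x) - be * PSeries a (- (r * x)).
Proof.
  intros Ha Hr Hx Hk.
  pose proof (sine_nonneg_kernel _ al be ka x (sine_nonneg_scale a rho r Ha Hr) Hx Hk) as K.
  simpl in K; rewrite Rmult_1_r in K.
  unfold PSeries.
  rewrite (Series_ext (fun k => a k * (r * x) ^ k) (fun n => a n * r ^ n * x ^ n))
    by (intro; rewrite Rpow_mult_distr; ring).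
  rewrite (Series_ext (fun k => a k * (- (r * x)) ^ k) (fun n => a n * r ^ n * (- x) ^ n)); auto.
  intro n; replace (- (r * x)) with (r * - x) by ring; rewrite Rpow_mult_distr; ring.
Qed.

(** Absolute convergence is available on circles of radius [r < 1] only; the bound found there is
    passed to the limit along radii tending to 1. *)
Lemma sine_nonneg_on_coeff (a : nat -> R) (n : nat) : sine_nonneg_on a 1 ->
  Rabs (a n) <= INR n * a 1%nat.
Proof.
  intros Ha.
  assert (K : forall r, 0 < r < 1 -> Rabs (a n) * r ^ n <= INR n * a 1%nat * r).
  { intros r Hr; pose proof (sine_nonneg_coeff _ n (sine_nonneg_scale a 1 r Ha Hr)) as K.
    simpl in K; rewrite Rabs_mult, (Rabs_pos_eq (r ^ n)) in K by (apply pow_le; lra); lra. }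
  set (u := fun k : nat => 1 - / (INR k + 2)).
  assert (Hu : forall k, 0 < u k < 1).
  { intro k; unfold u; pose proof (pos_INR k).
    assert (0 < / (INR k + 2) < 1); [|lra].
    split; [apply Rinv_0_lt_compat; lra|]; rewrite <- Rinv_1; apply Rinv_lt_contravar; lra. }
  assert (Lu : is_lim_seq u 1).
  { unfold u; replace (Finite 1) with (Finite (1 - 0)) by (f_equal; ring).
    apply is_lim_seq_minus'; [apply is_lim_seq_const|].
    replace (Finite 0) with (Rbar_inv p_infty) by reflexivity.
    apply is_lim_seq_inv; [|discriminate].
    apply (is_lim_seq_plus _ _ p_infty 2); [apply is_lim_seq_INR | apply is_lim_seq_const | reflexivity]. }
  apply (is_lim_seq_le (fun k => Rabs (a n) * u k ^ n) (fun k => INR n * a 1%nat * u k)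
    (Rabs (a n)) (INR n * a 1%nat)).
  - intro k; apply K, Hu.
  - replace (Finite (Rabs (a n))) with (Finite (Rabs (a n) * 1 ^ n)) by (rewrite pow1; f_equal; ring).
    apply is_lim_seq_mult'; [apply is_lim_seq_const|].
    clear K; induction n as [|n IH]; simpl; [apply is_lim_seq_const|].
    apply is_lim_seq_mult'; auto.
  - replace (Finite (INR n * a 1%nat)) with (Finite (INR n * a 1%nat * 1)) by (f_equal; ring).
    apply is_lim_seq_mult'; [apply is_lim_seq_const | auto].
Qed.

(** * Typically real functions *)

Lemma pow_n_Cpow (z : C) (n : nat) : @pow_n C_Ring z n = (z ^ n)%C.
Proof. induction n as [|n IH]; [reflexivity|]; simpl; rewrite IH; reflexivity. Qed.

Lemma sum_n_Csum (u : nat -> C) (N : nat) : @sum_n C_AbelianMonoid u N = Csum u N.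
Proof.
  induction N as [|N IH]; [rewrite sum_O; reflexivity|]; rewrite sum_Sn, IH; reflexivity.
Qed.

(** Links the power series of the theorem with convergence by parts: a limit in the product uniform
    structure is a limit of both components. *)
Lemma is_pseries_Cseries (a : nat -> C) (z l : C) :
  @is_pseries C_AbsRing C_NormedModule a z l <-> is_Cseries (fun n => a n * z ^ n)%C l.
Proof.
  assert (E : forall N, @sum_n C_AbelianMonoid (fun k => @scal C_AbsRing C_NormedModule (@pow_n C_AbsRing z k) (a k)) N
     = Csum (fun n => a n * z ^ n)%C N).
  { intro N; rewrite <- sum_n_Csum; apply sum_n_ext; intro n.
    rewrite <- pow_n_Cpow; apply Cmult_comm. }
  unfold is_pseries, is_series, is_Cseries; split.
  - intros H; split.
    + apply (filterlim_ext (fun N => Re (Csum (fun n => a n * z ^ n)%C N))); [intro; apply Csum_re|].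
      apply (filterlim_comp _ _ _ (Csum (fun n => a n * z ^ n)%C) fst eventually (locally (l : C_UniformSpace))).
      * revert H; apply filterlim_ext; exact E.
      * destruct l; apply continuous_fst.
    + apply (filterlim_ext (fun N => Im (Csum (fun n => a n * z ^ n)%C N))); [intro; apply Csum_im|].
      apply (filterlim_comp _ _ _ (Csum (fun n => a n * z ^ n)%C) snd eventually (locally (l : C_UniformSpace))).
      * revert H; apply filterlim_ext; exact E.
      * destruct l; apply continuous_snd.
  - intros [H1 H2].
    apply (filterlim_ext (Csum (fun n => a n * z ^ n)%C)); [intro; symmetry; apply E|].
    apply (filterlim_locally (U := C_UniformSpace)); intro eps.
    apply (filterlim_locally (U := R_UniformSpace)) with (eps := eps) in H1.
    apply (filterlim_locally (U := R_UniformSpace)) with (eps := eps) in H2.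
    generalize (filter_and _ _ H1 H2); apply filter_imp; intros N [B1 B2].
    rewrite <- Csum_re in B1; rewrite <- Csum_im in B2; split; assumption.
Qed.

Lemma crad_ge (a : nat -> C) (r M : R) : 0 <= r ->
  (forall n, Cmod (a n) * r ^ n <= M) -> Rbar_le r (crad a).
Proof.
  intros Hr H; destruct (CV_radius_bounded (fun n => Cmod (a n))) as [B _].
  apply B; exists M; intro n; rewrite Rabs_pos_eq; auto.
  apply Rmult_le_pos; [apply Cmod_ge_0 | apply pow_le; lra].
Qed.

Lemma Rbar_le_sup (rho : R) (l : Rbar) : 0 < rho ->
  (forall r, 0 < r < rho -> Rbar_le r l) -> Rbar_le rho l.
Proof.
  intros H0 H; destruct l as [l| |]; simpl; auto.
  - apply Rnot_lt_le; intro Hl.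
    specialize (H (Rmax (rho / 2) ((rho + l) / 2))); simpl in H.
    assert (Rmax (rho / 2) ((rho + l) / 2) < rho) by (apply Rmax_lub_lt; lra).
    pose proof (Rmax_l (rho / 2) ((rho + l) / 2)); pose proof (Rmax_r (rho / 2) ((rho + l) / 2)).
    lra.
  - specialize (H (rho / 2)); simpl in H; apply H; lra.
Qed.

(** Abel's argument: the terms of a convergent series are bounded, and bounded terms at radius [r]
    put the radius of convergence at [r] or above. *)
Lemma crad_disc (a : nat -> C) (rho : R) : 0 < rho ->
  (forall x, 0 < x < rho -> exists l, is_Cseries (fun n => a n * RtoC x ^ n)%C l) -> Rbar_le rho (crad a).
Proof.
  intros H0 H; apply Rbar_le_sup; auto; intros r Hr.
  destruct (H r Hr) as [l [S1 S2]].
  assert (B : forall v s, is_series v s -> exists M, forall n, Rabs (v n) <= M).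
  { intros v s Hv.
    assert (L : is_lim_seq v 0) by (apply ex_series_lim_0; exists s; auto).
    apply is_lim_seq_Reals in L; destruct (maj_by_pos v) as [M [_ HM]]; [exists 0; auto|].
    exists M; exact HM. }
  destruct (B _ _ S1) as [M1 H1]; destruct (B _ _ S2) as [M2 H2].
  apply (crad_ge a r (M1 + M2)); [lra|]; intro n.
  replace (Cmod (a n) * r ^ n) with (Cmod (a n * RtoC r ^ n)).
  - eapply Rle_trans; [apply Cmod_le_parts|]; specialize (H1 n); specialize (H2 n); lra.
  - rewrite Cmod_mult, Cmod_pow, Cmod_R, Rabs_pos_eq; lra.
Qed.

Lemma CV_radius_le (a b : nat -> R) : (forall n, Rabs (b n) <= Rabs (a n)) ->
  Rbar_le (CV_radius a) (CV_radius b).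
Proof.
  intros H; destruct (CV_radius_bounded a) as [_ A]; destruct (CV_radius_bounded b) as [B _].
  apply A; intros r [M HM]; apply B; exists M; intro n.
  eapply Rle_trans; [|apply HM]; rewrite !Rabs_mult; apply Rmult_le_compat_r; auto; apply Rabs_pos.
Qed.

Lemma Cps_real_axis (a : nat -> C) (x : R) : Cps a x = (PSeries (fun n => Re (a n)) x, PSeries (fun n => Im (a n)) x).
Proof.
  unfold Cps, PSeries; f_equal; apply Series_ext; intro n; rewrite <- RtoC_pow;
    [apply re_scal_r | apply im_scal_r].
Qed.

(** On the axis the imaginary part is the real power series with coefficients [Im (a n)], which
    vanish by uniqueness of the expansion. *)
Lemma real_coeffs (a : nat -> C) (rho : R) : 0 < rho -> Rbar_le rho (crad a) ->
  (forall x, Rabs x < rho -> Im (Cps a x) = 0) -> forall n, Im (a n) = 0.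
Proof.
  intros H0 Hr H n.
  apply (PSeries_ext_recip (fun n => Im (a n)) (fun _ => 0) n).
  - apply Rbar_lt_le_trans with rho; [exact H0|].
    eapply Rbar_le_trans; [exact Hr|]; apply CV_radius_le; intro k.
    rewrite (Rabs_pos_eq (Cmod (a k))) by apply Cmod_ge_0; apply im_le_Cmod.
  - rewrite CV_radius_const_0; reflexivity.
  - exists (mkposreal rho H0); intros x Hx.
    assert (Hx' : Rabs x < rho) by (change (Rabs (x - 0) < rho) in Hx; rewrite Rminus_0_r in Hx; auto).
    specialize (H x Hx'); rewrite Cps_real_axis in H.
    rewrite (PSeries_const_0); exact H.
Qed.

Lemma Cps_polar_im (al : nat -> R) (r t : R) :
  Im (Cps (fun n => RtoC (al n)) (RtoC r * circ t)%C) = Series (fun n => al n * r ^ n * sin (INR n * t)).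
Proof.
  unfold Cps, Im at 1; simpl; apply Series_ext; intro n.
  rewrite Cpow_mult_l, circ_pow, <- RtoC_pow, !im_scal_l; unfold circ, Im; simpl; ring.
Qed.

Lemma Cps_0 (a : nat -> C) : Cps a 0 = a 0%nat.
Proof. rewrite Cps_real_axis, !PSeries_0; destruct (a 0%nat); reflexivity. Qed.

Lemma Cps_conj (al : nat -> R) (z : C) :
  Cps (fun n => RtoC (al n)) (Cconj z) = Cconj (Cps (fun n => RtoC (al n)) z).
Proof.
  apply C_ext.
  - change (Series (fun n => Re (RtoC (al n) * Cconj z ^ n)) = Series (fun n => Re (RtoC (al n) * z ^ n))).
    apply Series_ext; intro n; rewrite <- Cpow_conj, !re_scal_l, re_conj; reflexivity.
  - change (Series (fun n => Im (RtoC (al n) * Cconj z ^ n)) = - Series (fun n => Im (RtoC (al n) * z ^ n))).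
    rewrite <- Series_opp; apply Series_ext; intro n; rewrite <- Cpow_conj, !im_scal_l, im_conj; ring.
Qed.

Lemma typically_real_series (a : nat -> C) (f : C -> C) : typically_real a f ->
  exists al : nat -> R, (forall n, a n = RtoC (al n)) /\ al 1%nat = 1 /\ sine_nonneg_on al 1 /\
    Rbar_le 1 (crad (fun n => RtoC (al n))) /\
    (forall z, Cmod z < 1 -> f z = Cps (fun n => RtoC (al n)) z) /\
    (forall z, Cmod z < 1 -> 0 <= Im z -> 0 <= Im (f z)).
Proof.
  intros [(Ha0 & Ha1 & Hf) Ht].
  assert (Hs : forall z, Cmod z < 1 -> is_Cseries (fun n => a n * z ^ n)%C (f z))
    by (intros z Hz; apply is_pseries_Cseries, Hf; auto).
  assert (Hr : Rbar_le 1 (crad a)).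
  { apply crad_disc; [lra|]; intros x Hx; exists (f x); apply Hs.
    rewrite Cmod_R, Rabs_pos_eq; lra. }
  assert (Hin : forall z, Cmod z < 1 -> Rbar_lt (Cmod z) (crad a))
    by (intros z Hz; eapply Rbar_lt_le_trans; [|exact Hr]; exact Hz).
  assert (HfE : forall z, Cmod z < 1 -> f z = Cps a z).
  { intros z Hz; apply (is_Cseries_unique (fun n => a n * z ^ n)%C); auto; apply Cps_correct; auto. }
  assert (Hax : forall x, Rabs x < 1 -> Im (Cps a x) = 0).
  { intros x Hx; apply NNPP; intro Hne.
    assert (Hx1 : Cmod x < 1) by (rewrite Cmod_R; auto).
    set (v := Im (Cps a x)) in *.
    destruct (cderiv_continuous _ _ _ (cderiv_Cps a x (Hin x Hx1)) (Rabs v)) as [d [Hd Hc]];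
      [apply Rabs_pos_lt; auto|].
    set (e := Rmin (d / 2) ((1 - Rabs x) / 2)).
    assert (He : 0 < e) by (apply Rmin_pos; lra).
    (* The point is moved off the axis to the side where [Im u] and [v] have opposite signs, so
       little that [Im f] keeps the sign of [v]: this contradicts typical realness. *)
    set (y := if Rlt_dec 0 v then - e else e).
    set (u := (x + Ci * y)%C).
    assert (Hy : Rabs y = e) by (unfold y; destruct (Rlt_dec 0 v); [rewrite Rabs_Ropp|]; apply Rabs_pos_eq; lra).
    assert (Hu1 : Cmod u < 1).
    { unfold u; eapply Rle_lt_trans; [apply Cmod_triangle|].
      rewrite Cmod_mult, Cmod_Ci, !Cmod_R, Hy.
      pose proof (Rmin_r (d / 2) ((1 - Rabs x) / 2)) as Q; fold e in Q; lra. }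
    assert (Hux : Cmod (u - x) < d).
    { unfold u; replace (x + Ci * y - x)%C with (Ci * y)%C by ring.
      rewrite Cmod_mult, Cmod_Ci, Cmod_R, Hy.
      pose proof (Rmin_l (d / 2) ((1 - Rabs x) / 2)) as Q; fold e in Q; lra. }
    assert (Iu : Im u = y) by (unfold u, Im; simpl; ring).
    assert (Hy0 : y <> 0) by (intro E; rewrite E, Rabs_R0 in Hy; lra).
    specialize (Ht u Hu1); rewrite Iu in Ht; specialize (Ht Hy0); rewrite HfE in Ht by auto.
    specialize (Hc u Hux).
    assert (Hd2 : Rabs (Im (Cps a u) - v) < Rabs v).
    { eapply Rle_lt_trans; [|exact Hc].
      eapply Rle_trans; [|apply im_le_Cmod]; right; f_equal. }
    unfold y in Ht; destruct (Rlt_dec 0 v) as [Hv|Hv].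
    - rewrite (Rabs_pos_eq v) in Hd2 by lra; apply Rabs_def2 in Hd2; nra.
    - rewrite (Rabs_left1 v) in Hd2 by lra; apply Rabs_def2 in Hd2; nra. }
  assert (Him : forall n, Im (a n) = 0) by (apply (real_coeffs a 1); auto; lra).
  assert (Hal : forall n, a n = RtoC (Re (a n))).
  { intro n; apply C_ext; [reflexivity | rewrite Him; reflexivity]. }
  assert (Hps : forall z, Cps a z = Cps (fun n => RtoC (Re (a n))) z).
  { intro z; unfold Cps; f_equal; apply Series_ext; intro n; rewrite <- Hal; reflexivity. }
  assert (Hcr : crad a = crad (fun n => RtoC (Re (a n)))).
  { unfold crad; apply CV_radius_ext; intro n; rewrite <- Hal; reflexivity. }
  assert (Hpos : forall z, Cmod z < 1 -> 0 <= Im z -> 0 <= Im (f z)).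
  { intros z Hz [Hi|Hi].
    - specialize (Ht z Hz ltac:(lra)); nra.
    - rewrite HfE by auto.
      replace z with (RtoC (Re z)) by (apply C_ext; [reflexivity | rewrite <- Hi; reflexivity]).
      right; symmetry; apply Hax.
      eapply Rle_lt_trans; [apply re_le_Cmod | exact Hz]. }
  exists (fun n => Re (a n)); split; [exact Hal|]; split; [rewrite Ha1; reflexivity|].
  split; [|split; [rewrite <- Hcr; auto|]; split; [intros; rewrite <- Hps; auto | exact Hpos]].
  repeat split.
  - rewrite Ha0; reflexivity.
  - eapply Rbar_le_trans; [exact Hr|]; apply CV_radius_le; intro n.
    rewrite (Rabs_pos_eq (Cmod (a n))) by apply Cmod_ge_0; apply re_le_Cmod.
  - intros r t Hrt Ht'; rewrite <- Cps_polar_im, <- Hps.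
    assert (Hz : Cmod (RtoC r * circ t) < 1)
      by (rewrite Cmod_mult, Cmod_R, Cmod_circ, Rabs_pos_eq; lra).
    rewrite <- HfE by auto; apply Hpos; auto.
    rewrite im_scal_l; apply Rmult_le_pos; [lra|]; apply sin_ge_0; lra.
Qed.

(** * The Koebe disc of a typically real function *)

(** The difference [k] vanishes at both ends. Were it negative at [x], the mean value theorem would
    give it a negative slope before [x] and a positive one after, while its derivative decreases. *)
Lemma jordan_le (x : R) : 0 <= x <= PI / 2 -> 2 * x <= PI * sin x.
Proof.
  intros Hx; pose proof PI_RGT_0 as PP.
  apply Rnot_lt_le; intro Hlt.
  set (k := fun y => PI * sin y - 2 * y); set (dk := fun y => PI * cos y - 2).
  assert (D : forall c, derivable_pt_lim k c (dk c)).
  { intro c; apply is_derive_Reals; unfold k, dk; auto_derive; auto; ring. }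
  assert (K0 : k 0 = 0) by (unfold k; rewrite sin_0; ring).
  assert (K1 : k (PI / 2) = 0) by (unfold k; rewrite sin_PI2; field).
  assert (Kx : k x < 0) by (unfold k; lra).
  assert (X0 : 0 < x) by (destruct (Req_dec x 0) as [->|]; lra).
  assert (X1 : x < PI / 2) by (destruct (Req_dec x (PI / 2)) as [->|]; lra).
  destruct (MVT_cor2 k dk 0 x X0 (fun c _ => D c)) as [c1 [E1 C1]].
  destruct (MVT_cor2 k dk x (PI / 2) X1 (fun c _ => D c)) as [c2 [E2 C2]].
  assert (dk c2 < dk c1).
  { unfold dk; assert (cos c2 < cos c1) by (apply cos_decreasing_1; lra). nra. }
  assert (dk c1 < 0) by nra.
  assert (0 < dk c2) by nra.
  lra.
Qed.

(** On the right half the difference vanishes at [PI / 2] and is nonincreasing by [jordan_le];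
    evenness gives the left half. Equality at the ends, the limit of real omitted values, is what
    preserves the sharp constant 1/4. *)
Lemma cos_ge_parabola (x : R) : - (PI / 2) <= x <= PI / 2 -> PI ^ 2 - 4 * x ^ 2 <= 4 * PI * cos x.
Proof.
  pose proof PI_RGT_0 as PP.
  assert (P : forall y, 0 <= y <= PI / 2 -> PI ^ 2 - 4 * y ^ 2 <= 4 * PI * cos y).
  { intros y Hy; destruct (Req_dec y (PI / 2)) as [->|Hne].
    { rewrite cos_PI2; right; field. }
    destruct (MVT_cor2 (fun y => 4 * PI * cos y - (PI ^ 2 - 4 * y ^ 2))
      (fun y => 8 * y - 4 * PI * sin y) y (PI / 2)) as [c [E C]]; [lra| |].
    - intros c _; apply is_derive_Reals; auto_derive; auto; ring.
    - cbv beta in E; rewrite cos_PI2 in E.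
      pose proof (jordan_le c ltac:(lra)).
      replace (4 * PI * 0 - (PI ^ 2 - 4 * (PI / 2) ^ 2)) with 0 in E by field.
      assert ((8 * c - 4 * PI * sin c) * (PI / 2 - y) <= 0) by nra. lra. }
  intros Hx; destruct (Rle_dec 0 x).
  - apply P; lra.
  - rewrite <- cos_neg; replace (x ^ 2) with ((- x) ^ 2) by ring; apply P; lra.
Qed.

(** The kernels at [y] and [- y] are at least [y / (1 + y) ^ 2], so the function is at least
    [y^2 / (1 + y)^2] at [y * y] and at most its opposite at [- (y * y)]. These bounds approach 1/4,
    and the intermediate value theorem does the rest. *)
Lemma real_value_covered (al : nat -> R) (c : R) : al 1%nat = 1 -> sine_nonneg_on al 1 ->
  Rabs c < 1 / 4 -> exists x, Rabs x < 1 /\ PSeries al x = c.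
Proof.
  intros H1 Hal Hc.
  set (d := Rabs c) in *; assert (Hd0 : 0 <= d) by apply Rabs_pos.
  (* Chosen so that [4 d = 2 y - 1 < y^2], while [(1 + y)^2 < 4]. *)
  set (y := (1 + 4 * d) / 2); assert (Hy : 0 < y < 1) by (unfold y; lra).
  assert (Hyd : d * (1 + y) ^ 2 < y ^ 2).
  { assert (4 * d < y ^ 2) by (unfold y; nra). nra. }
  assert (Q : 0 < (1 + y) ^ 2) by nra.
  assert (Hdy : d < y / (1 + y) ^ 2 * y).
  { apply Rmult_lt_reg_r with ((1 + y) ^ 2); auto.
    replace (y / (1 + y) ^ 2 * y * (1 + y) ^ 2) with (y ^ 2) by (field; lra). lra. }
  assert (Den : forall t, -1 <= t <= 1 -> y / (1 + y) ^ 2 <= y / (1 - 2 * y * t + y ^ 2)).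
  { intros t Ht; apply Rmult_le_compat_l; [lra|].
    apply Rinv_le_contravar; [apply kernel_den_pos; auto | nra]. }
  pose proof (sine_nonneg_on_kernel al 1 y 1 0 (y / (1 + y) ^ 2) y Hal Hy Hy) as K1.
  pose proof (sine_nonneg_on_kernel al 1 y 0 1 (y / (1 + y) ^ 2) y Hal Hy Hy) as K2.
  rewrite H1 in K1, K2.
  assert (B1 : d < PSeries al (y * y)).
  { eapply Rlt_le_trans; [exact Hdy|]; eapply Rle_trans; [|eapply Rle_trans; [apply K1|]]; [lra| |lra].
    intros t Ht; specialize (Den t Ht); lra. }
  assert (B2 : PSeries al (- (y * y)) < - d).
  { assert (y / (1 + y) ^ 2 * (1 * y) <= 0 * PSeries al (y * y) - 1 * PSeries al (- (y * y))); [|lra].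
    apply K2; intros t Ht; specialize (Den (- t) ltac:(lra)).
    replace (1 - 2 * y * - t + y ^ 2) with (1 + 2 * y * t + y ^ 2) in Den by ring; lra. }
  assert (Hcd : - d <= c <= d) by (apply Rabs_le_between; apply Rle_refl).
  destruct (IVT_interv (fun x => PSeries al x - c) (- (y * y)) (y * y)) as [x [Hx E]]; [| nra | lra | lra |].
  - intros x Hx; apply derivable_continuous_pt.
    exists (PSeries (PS_derive al) x - 0); apply is_derive_Reals.
    apply (is_derive_minus (V := R_NormedModule)); [|apply @is_derive_const].
    apply is_derive_PSeries; apply Rbar_lt_le_trans with 1; [|apply Hal].
    simpl; apply Rabs_def1; nra.
  - exists x; split; [apply Rabs_def1; nra | lra].
Qed.

(** The real part of the logarithmic derivative is the derivative of [ln |w|], which involves no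
    branch. *)
Lemma is_derive_half_ln_mod (w : R -> C) (t : R) (l : C) : w t <> 0 ->
  is_derive (V := C_R_NormedModule) w t l ->
  is_derive (fun s => ln (Re (w s) ^ 2 + Im (w s) ^ 2) / 2) t (Re (l / w t)).
Proof.
  intros Hw Hl; destruct (is_derive_re_im w t l Hl) as [D1 D2].
  assert (P : 0 < Re (w t) ^ 2 + Im (w t) ^ 2).
  { rewrite <- Cmod2_alt; apply pow_lt, Cmod_gt_0; auto. }
  assert (DN : is_derive (fun s => Re (w s) ^ 2 + Im (w s) ^ 2) t
                 (2 * Re (w t) * Re l + 2 * Im (w t) * Im l)).
  { evar_last.
    - apply (is_derive_plus (V := R_NormedModule)); apply is_derive_pow; eassumption.
    - change (INR 2 * Re l * Re (w t) ^ 1 + INR 2 * Im l * Im (w t) ^ 1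
        = 2 * Re (w t) * Re l + 2 * Im (w t) * Im l); simpl; ring. }
  pose proof (is_derive_comp ln (fun s => Re (w s) ^ 2 + Im (w s) ^ 2) t _ _ (is_derive_ln _ P) DN) as DL.
  pose proof (is_derive_scal _ _ (/ 2) _ DL) as DS.
  evar_last.
  - eapply is_derive_ext; [|exact DS]; intro s; simpl; field.
  - change (/ 2 * ((2 * Re (w t) * Re l + 2 * Im (w t) * Im l) * / (Re (w t) ^ 2 + Im (w t) ^ 2))
      = Re (l / w t)).
    destruct (w t) as [u v]; destruct l as [m n]; unfold Cdiv, Cinv, Cmult, Re, Im in *; cbn [fst snd] in *.
    field; lra.
Qed.

Lemma is_derive_ray (h : C -> C) (z l : C) (t : R) : cderiv h (RtoC t * z)%C l ->
  is_derive (V := C_R_NormedModule) (fun s => h (RtoC s * z)%C) t (l * z)%C.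
Proof.
  intros Hh; apply (is_derive_comp_curve h (fun s => RtoC s * z)%C); auto.
  apply is_derive_parts; unfold Re, Im; simpl; auto_derive; auto; ring.
Qed.

(** Partial fractions: [m / w1 - m / w2] has numerator [m (w2 - w1) = 2 i q m]. With [w1] and [w2]
    the distances of [F] to [c] and to its conjugate as complex differences, the left-hand side is
    the derivative of [Im g] along a ray. *)
Lemma Re_Im_log_derivative (q : R) (w1 w2 m : C) : w1 <> 0 -> w2 <> 0 ->
  (w2 - w1)%C = (2 * Ci * RtoC q)%C ->
  Im (RtoC (2 * q) * m / (w1 * w2)) = Re (m / w2) - Re (m / w1).
Proof.
  intros H1 H2 E.
  replace (RtoC (2 * q) * m / (w1 * w2))%C with (- Ci * (m / w1 - m / w2))%C.
  - unfold Im, Re; simpl; ring.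
  - assert (E2 : (m / w1 - m / w2)%C = (m * (2 * Ci * RtoC q) / (w1 * w2))%C)
      by (rewrite <- E; field; auto).
    rewrite E2, RtoC_mult.
    replace (- Ci * (m * (2 * Ci * RtoC q) / (w1 * w2)))%C
      with ((- Ci * Ci) * (2 * RtoC q * m / (w1 * w2)))%C by (field; auto).
    replace (- Ci * Ci)%C with (RtoC 1) by (apply C_ext; unfold Re, Im; simpl; ring); ring.
Qed.

Lemma Cconj_parts (c : C) : (Cconj c = c - 2 * Ci * RtoC (Im c))%C.
Proof. apply C_ext; unfold Cconj, Re, Im; simpl; ring. Qed.

Section Omitted_value.

Variables (al : nat -> R) (c : C) (r : R).
Let F := Cps (fun n => RtoC (al n)).
Let dF := Cps (CPS_derive (fun n => RtoC (al n))).
Let p := Re c.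
Let q := Im c.
Hypothesis H0 : al 0%nat = 0.
Hypothesis H1 : al 1%nat = 1.
Hypothesis Hrad : Rbar_le 1 (crad (fun n => RtoC (al n))).
Hypothesis Hpos : forall z, Cmod z < 1 -> 0 <= Im z -> 0 <= Im (F z).
Hypothesis Hq : 0 < q.
Hypothesis Hom : forall z, Cmod z < 1 -> F z <> c.
Hypothesis Hr : 0 < r < 1.

Lemma in_rad (z : C) : Cmod z < 1 -> Rbar_lt (Cmod z) (crad (fun n => RtoC (al n))).
Proof. intros Hz; eapply Rbar_lt_le_trans; [|exact Hrad]; exact Hz. Qed.

Lemma omit1 (z : C) : Cmod z < 1 -> (F z - c)%C <> 0.
Proof. intros Hz E; apply Ceq_minus in E; exact (Hom z Hz E). Qed.

Lemma omit2 (z : C) : Cmod z < 1 -> (F z - Cconj c)%C <> 0.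
Proof.
  intros Hz E; apply Ceq_minus in E; apply (Hom (Cconj z)); [rewrite Cmod_conj; auto|].
  unfold F; rewrite Cps_conj; fold F; rewrite E; apply Cconj_conj.
Qed.

(* The derivative of [-i log ((F - c) / (F - conj c))], which is again typically real up to normalization. *)
Let k (z : C) : C := (RtoC (2 * q) * dF z / ((F z - c) * (F z - Cconj c)))%C.

Lemma F_cderiv (z : C) : Cmod z < 1 -> cderiv F z (dF z).
Proof. intros Hz; apply cderiv_Cps, in_rad; auto. Qed.

Lemma F_sub_cderiv (a z : C) : Cmod z < 1 -> cderiv (fun u => F u - a)%C z (dF z).
Proof.
  intros Hz; replace (dF z) with (dF z + 0)%C by ring.
  apply (cderiv_plus F (fun _ => (- a)%C)); [apply F_cderiv; auto | apply cderiv_const].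
Qed.

Lemma k_holo : holo k 1.
Proof.
  intros z Hz.
  assert (D : exists l, cderiv dF z l).
  { eexists; apply cderiv_Cps; rewrite crad_derive; apply in_rad; auto. }
  destruct D as [l Hl]; eexists.
  apply (cderiv_mult (fun z => RtoC (2 * q) * dF z)%C (fun z => / ((F z - c) * (F z - Cconj c)))%C).
  - apply (cderiv_mult (fun _ => RtoC (2 * q)) dF); [apply cderiv_const | exact Hl].
  - apply (cderiv_inv (fun z => (F z - c) * (F z - Cconj c))%C).
    + apply Cmult_neq_0; [apply omit1 | apply omit2]; auto.
    + apply (cderiv_mult (fun z => F z - c)%C (fun z => F z - Cconj c)%C); apply F_sub_cderiv; auto.
Qed.

Lemma F_real (x : R) : Im (F x) = 0.
Proof.
  unfold F; rewrite Cps_real_axis; unfold Im at 1; simpl.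
  apply PSeries_const_0.
Qed.

Lemma dF_real (x : R) : Im (dF x) = 0.
Proof.
  unfold dF; rewrite Cps_real_axis.
  eapply eq_trans; [|exact (PSeries_const_0 x)].
  change (PSeries (fun n => Im (CPS_derive (fun n => RtoC (al n)) n)) x = PSeries (fun _ => 0) x).
  apply PSeries_ext; intro n; unfold CPS_derive; rewrite <- RtoC_mult; reflexivity.
Qed.

Lemma k_real (x : R) : k x = RtoC (2 * q * Re (dF x) / ((Re (F x) - p) ^ 2 + q ^ 2)).
Proof.
  assert (EF : F x = RtoC (Re (F x))) by (apply C_ext; [reflexivity | apply F_real]).
  assert (Ed : dF x = RtoC (Re (dF x))) by (apply C_ext; [reflexivity | apply dF_real]).
  assert (P : 0 < (Re (F x) - p) ^ 2 + q ^ 2) by (pose proof (pow2_ge_0 (Re (F x) - p)); pose proof (pow_lt q 2 Hq); lra).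
  set (u := Re (F x)) in *; set (v := Re (dF x)) in *.
  unfold k; rewrite EF, Ed, RtoC_div by lra.
  f_equal; [apply eq_sym, RtoC_mult|].
  apply C_ext; unfold p, q, Cconj, Re, Im; simpl; ring.
Qed.

Lemma omitted_log_series : exists g : nat -> R,
  g 1%nat = 2 * q / (p ^ 2 + q ^ 2) /\ sine_nonneg_on g r /\
  forall x, Rabs x < r -> PSeries g x = 2 * (atan ((Re (F x) - p) / q) + atan (p / q)).
Proof.
  destruct (holo_taylor k 1 r k_holo Hr) as [b [Hb Hser]].
  assert (Hin : forall z, Cmod z < r -> Rbar_lt (Cmod z) (crad b))
    by (intros z Hz; eapply Rbar_lt_le_trans; [|exact Hb]; exact Hz).
  assert (Hk : forall z, Cmod z < r -> Cps b z = k z).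
  { intros z Hz; apply (is_Cseries_unique (fun n => b n * z ^ n)%C); auto; apply Cps_correct; auto. }
  assert (Hbi : forall n, Im (b n) = 0).
  { apply (real_coeffs b r); [lra | auto |].
    intros x Hx; rewrite Hk by (rewrite Cmod_R; auto); rewrite k_real; reflexivity. }
  (* The termwise primitive of the expansion of [k], vanishing at 0; the real parts lose nothing,
     since [k] is real on the axis. *)
  set (g := fun n => match n with O => 0 | S m => Re (b m) / INR (S m) end).
  set (B := fun n => RtoC (g n)).
  assert (EB : forall n, CPS_derive B n = b n).
  { intro n; unfold CPS_derive, B, g; rewrite <- RtoC_mult.
    apply C_ext; [|rewrite Hbi; reflexivity].
    rewrite re_RtoC; field; apply not_0_INR; lia. }
  assert (CB : crad B = crad b).
  { rewrite <- crad_derive; unfold crad; apply CV_radius_ext; intro n; rewrite EB; reflexivity. }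
  set (G := Cps B).
  assert (DG : forall z, Cmod z < r -> cderiv G z (k z)).
  { intros z Hz; rewrite <- Hk by auto.
    replace (Cps b z) with (Cps (CPS_derive B) z)
      by (unfold Cps; f_equal; apply Series_ext; intro n; rewrite EB; reflexivity).
    apply cderiv_Cps; rewrite CB; auto. }
  assert (G0 : G 0 = 0) by (unfold G; rewrite Cps_0; reflexivity).
  assert (F0 : F 0 = 0) by (unfold F; rewrite Cps_0, H0; reflexivity).
  assert (ImG : forall z, Cmod z < r -> 0 <= Im z -> 0 <= Im (G z)).
  { intros z Hz Hi.
    set (w1 := fun t => (F (RtoC t * z) - c)%C); set (w2 := fun t => (F (RtoC t * z) - Cconj c)%C).
    (* Along the ray from 0 to [z], [Im G] is compared with [ln |w2| - ln |w1|]. The difference has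
       derivative 0 and vanishes at [t = 0], where [F = 0] is equidistant from [c] and its
       conjugate. *)
    set (D := fun t => Im (G (RtoC t * z)%C) - ln (Re (w2 t) ^ 2 + Im (w2 t) ^ 2) / 2
                         + ln (Re (w1 t) ^ 2 + Im (w1 t) ^ 2) / 2).
    assert (Hm : forall t, 0 <= t <= 1 -> Cmod (RtoC t * z) < r).
    { intros t Ht; rewrite Cmod_mult, Cmod_R, Rabs_pos_eq by lra; pose proof (Cmod_ge_0 z); nra. }
    assert (ED : D 0 = D 1).
    { apply (eq_is_derive D 0 1); [|lra]; intros t Ht.
      assert (Hm1 : Cmod (RtoC t * z) < 1) by (specialize (Hm t Ht); lra).
      pose proof (proj2 (is_derive_re_im _ _ _ (is_derive_ray G z _ t (DG _ (Hm t Ht))))) as D0.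
      pose proof (is_derive_half_ln_mod w1 t _ (omit1 _ Hm1)
        (is_derive_ray (fun u => F u - c)%C z _ t (F_sub_cderiv c _ Hm1))) as D1.
      pose proof (is_derive_half_ln_mod w2 t _ (omit2 _ Hm1)
        (is_derive_ray (fun u => F u - Cconj c)%C z _ t (F_sub_cderiv (Cconj c) _ Hm1))) as D2.
      pose proof (is_derive_plus _ _ _ _ _ (is_derive_minus _ _ _ _ _ D0 D2) D1) as DD.
      evar_last; [exact DD|].
      set (m := (dF (RtoC t * z) * z)%C) in *.
      change (Im (k (RtoC t * z) * z) - Re (m / w2 t) + Re (m / w1 t) = 0).
      replace (k (RtoC t * z) * z)%C with (RtoC (2 * q) * m / (w1 t * w2 t))%C.
      - rewrite Re_Im_log_derivative; [ring | apply omit1; auto | apply omit2; auto |].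
        unfold w1, w2; rewrite Cconj_parts; fold q; ring.
      - unfold k, m, w1, w2; field; split; [apply omit2 | apply omit1]; auto. }
    assert (D0 : D 0 = 0).
    { unfold D, w1, w2; rewrite Cmult_0_l, G0, F0.
      replace (Re (0 - Cconj c) ^ 2 + Im (0 - Cconj c) ^ 2) with (Re (0 - c) ^ 2 + Im (0 - c) ^ 2)
        by (unfold Cconj, Re, Im; simpl; ring).
      rewrite im_RtoC; ring. }
    rewrite D0 in ED; unfold D, w1, w2 in ED; rewrite Cmult_1_l in ED.
    assert (Hz1 : Cmod z < 1) by lra.
    pose proof (Hpos z Hz1 Hi) as HF.
    assert (P1 : 0 < Re (F z - c) ^ 2 + Im (F z - c) ^ 2)
      by (rewrite <- Cmod2_alt; apply pow_lt, Cmod_gt_0, omit1; auto).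
    (* The two squared distances differ by [4 q Im (F z)], which is nonnegative in the upper half of
       the disc. *)
    assert (Hln : ln (Re (F z - c) ^ 2 + Im (F z - c) ^ 2)
                  <= ln (Re (F z - Cconj c) ^ 2 + Im (F z - Cconj c) ^ 2)).
    { apply ln_le; auto.
      replace (Re (F z - Cconj c) ^ 2 + Im (F z - Cconj c) ^ 2)
        with (Re (F z - c) ^ 2 + Im (F z - c) ^ 2 + 4 * (q * Im (F z)))
        by (unfold q, Cconj, Re, Im; simpl; ring).
      pose proof (Rmult_le_pos q (Im (F z)) ltac:(lra) HF); lra. }
    lra. }
  exists g; split; [|split; [repeat split|]].
  - assert (E1 : g 1%nat = Re (k 0)).
    { rewrite <- Hk, Cps_0 by (rewrite Cmod_0; lra); unfold g; simpl; field. }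
    rewrite E1, k_real, re_RtoC, F0, re_RtoC.
    replace (dF 0) with (RtoC 1).
    + rewrite re_RtoC; f_equal; [ring | f_equal; ring].
    + unfold dF; rewrite Cps_0; unfold CPS_derive; rewrite H1; simpl; ring.
  - eapply Rbar_le_trans; [exact Hb|]; rewrite <- CB; apply CV_radius_le; intro n.
    unfold B; rewrite Cmod_R, Rabs_Rabsolu; apply Rle_refl.
  - intros r' t Hr' Ht; rewrite <- Cps_polar_im; apply ImG.
    + rewrite Cmod_mult, Cmod_R, Cmod_circ, Rabs_pos_eq; lra.
    + rewrite im_scal_l; apply Rmult_le_pos; [lra|]; apply sin_ge_0; lra.
  (* On the axis [k] is the derivative of twice the arctangent of [(F - p) / q]; the added
     [atan (p / q)] makes the primitive vanish at 0. *)
  - set (D := fun x : R => Re (G (RtoC x)) - 2 * (atan ((Re (F (RtoC x)) - p) / q) + atan (p / q))).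
    assert (DD : forall x, Rabs x < r -> is_derive D x 0).
    { intros x Hx.
      assert (Hxr : Cmod (RtoC x * 1) < r) by (rewrite Cmult_1_r, Cmod_R; auto).
      assert (Hx1 : Cmod (RtoC x * 1) < 1) by lra.
      pose proof (proj1 (is_derive_re_im _ _ _ (is_derive_ray G 1 _ x (DG _ Hxr)))) as D1.
      pose proof (proj1 (is_derive_re_im _ _ _ (is_derive_ray F 1 _ x (F_cderiv _ Hx1)))) as D2.
      assert (D3 : is_derive (fun s => Re (F (RtoC s))) x (Re (dF x))).
      { rewrite !Cmult_1_r in D2; revert D2; apply is_derive_ext; intro s; rewrite Cmult_1_r; reflexivity. }
      assert (D4 : is_derive (fun s => Re (G (RtoC s))) x (Re (k x))).
      { rewrite !Cmult_1_r in D1; revert D1; apply is_derive_ext; intro s; rewrite Cmult_1_r; reflexivity. }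
      assert (D5 : is_derive (fun s => 2 * (atan ((Re (F (RtoC s)) - p) / q) + atan (p / q))) x
                    (2 * (/ q * Re (dF x) * / (1 + Rsqr ((Re (F x) - p) / q))))).
      { assert (Dq : is_derive (fun s => (Re (F (RtoC s)) - p) / q) x (/ q * Re (dF x))).
        { pose proof (is_derive_scal _ _ (/ q) _ (is_derive_minus _ _ _ _ _ D3 (is_derive_const p x))) as DS.
          evar_last.
          - eapply is_derive_ext; [|exact DS]; intro s.
            change (/ q * (Re (F (RtoC s)) - p) = (Re (F (RtoC s)) - p) / q); unfold Rdiv; ring.
          - change (/ q * (Re (dF x) - 0) = / q * Re (dF x)); ring. }
        pose proof (is_derive_comp atan _ x _ _ (is_derive_atan _) Dq) as DA.
        pose proof (is_derive_scal _ _ 2 _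
          (is_derive_plus _ _ _ _ _ DA (is_derive_const (atan (p / q)) x))) as DS.
        evar_last; [exact DS|].
        match goal with |- _ = ?rhs => change (2 * (/ q * Re (dF x) * / (1 + Rsqr ((Re (F x) - p) / q)) + 0) = rhs) end.
        ring. }
      pose proof (is_derive_minus _ _ _ _ _ D4 D5) as D6.
      evar_last; [exact D6|].
      rewrite k_real, re_RtoC.
      match goal with |- minus ?a ?b = 0 => change (a - b = 0) end.
      unfold Rsqr; field; repeat split; try lra;
        pose proof (Rle_0_sqr (Re (F x) - p)) as Sq; unfold Rsqr in Sq; nra. }
    assert (D0 : D 0 = 0).
    { unfold D; rewrite G0, F0, !re_RtoC.
      replace ((0 - p) / q) with (- (p / q)) by (field; lra).
      rewrite atan_opp; ring. }
    intros x Hx.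
    assert (EP : PSeries g x = Re (G x)) by (unfold G; rewrite Cps_real_axis; reflexivity).
    assert (EDx : D x = 0).
    { destruct (Rtotal_order x 0) as [L|[E|L]].
      - rewrite (eq_is_derive D x 0); auto; intros t Ht; apply DD.
        rewrite Rabs_left in Hx by lra; rewrite Rabs_left1; lra.
      - rewrite E; auto.
      - rewrite <- (eq_is_derive D 0 x); auto; intros t Ht; apply DD.
        rewrite Rabs_pos_eq in Hx by lra; rewrite Rabs_pos_eq; lra. }
    unfold D in EDx; rewrite EP; lra.
Qed.

End Omitted_value.

Lemma nonreal_value_covered (al : nat -> R) (c : C) : al 0%nat = 0 -> al 1%nat = 1 ->
  Rbar_le 1 (crad (fun n => RtoC (al n))) ->
  (forall z, Cmod z < 1 -> 0 <= Im z -> 0 <= Im (Cps (fun n => RtoC (al n)) z)) ->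
  0 < Im c -> Cmod c < 1 / 4 ->
  exists z, Cmod z < 1 /\ Cps (fun n => RtoC (al n)) z = c.
Proof.
  intros H0 H1 Hrad Hpos Hq Hc; apply NNPP; intro Hno.
  assert (Hom : forall z, Cmod z < 1 -> Cps (fun n => RtoC (al n)) z <> c)
    by (intros z Hz E; apply Hno; exists z; auto).
  pose proof PI_RGT_0 as PP.
  set (p := Re c) in *; set (q := Im c) in *.
  set (psi := atan (p / q)).
  pose proof (atan_bound (p / q)) as Hpsi; fold psi in Hpsi.
  set (A := PI - 2 * psi); set (B := PI + 2 * psi).
  assert (HA : 0 < A) by (unfold A; lra).
  assert (HB : 0 < B) by (unfold B; lra).
  assert (HS : 0 < p ^ 2 + q ^ 2) by (pose proof (pow2_ge_0 p); nra).
  assert (Y : forall y, 0 < y < 1 -> (2 * PI * q / (p ^ 2 + q ^ 2)) * y ^ 2 <= A * B * 2).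
  { intros y Hy.
    (* The radius [(1 + y) / 2] leaves room for the circle of radius [y]. The kernel is taken at [y]
       too, so [g] is evaluated at [y * y] and [- (y * y)]. *)
    destruct (omitted_log_series al c ((1 + y) / 2) H0 H1 Hrad Hpos Hq Hom ltac:(lra)) as [g (G1 & G2 & G3)].
    fold p q in G1, G3.
    set (P := 1 + y ^ 2); assert (HP : 0 < P) by (unfold P; nra).
    pose proof (sine_nonneg_on_kernel g ((1 + y) / 2) y (A ^ 2) (B ^ 2) ((A + B) ^ 2 * (y / (2 * P))) y G2 ltac:(lra) Hy) as K.
    assert (Ky : - (y * y) < 0) by nra.
    rewrite !G3 in K by (try rewrite Rabs_Ropp; rewrite Rabs_pos_eq; nra).
    fold psi in K.
    set (a1 := atan ((Re (Cps (fun n => RtoC (al n)) (y * y)%R) - p) / q)) in *.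
    set (a2 := atan ((Re (Cps (fun n => RtoC (al n)) (- (y * y))%R) - p) / q)) in *.
    assert (B1 : a1 < PI / 2) by apply atan_bound.
    assert (B2 : - PI / 2 < a2) by apply atan_bound.
    rewrite G1 in K.
    assert (K' : (A + B) ^ 2 * (y / (2 * P)) * (2 * q / (p ^ 2 + q ^ 2) * y)
                  <= A ^ 2 * (2 * (a1 + psi)) - B ^ 2 * (2 * (a2 + psi))).
    { apply K; intros t Ht.
      pose proof (kernel_den_pos y t Hy Ht) as D1.
      pose proof (kernel_den_pos y (- t) Hy ltac:(lra)) as D2.
      replace (1 - 2 * y * - t + y ^ 2) with (1 + 2 * y * t + y ^ 2) in D2 by ring.
      set (U := 1 - 2 * y * t + y ^ 2) in *; set (V := 1 + 2 * y * t + y ^ 2) in *.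
      replace (2 * P) with (U + V) by (unfold U, V, P; ring).
      (* Cauchy-Schwarz: [(A + B)^2 / (U + V) <= A^2 / U + B^2 / V] *)
      apply Rminus_le_0.
      replace (A ^ 2 * (y / U) + B ^ 2 * (y / V) - (A + B) ^ 2 * (y / (U + V)))
        with (y * (A * V - B * U) ^ 2 / (U * V * (U + V))) by (field; repeat split; lra).
      apply Rdiv_le_0_compat.
      - apply Rmult_le_pos; [lra | apply pow2_ge_0].
      - repeat apply Rmult_lt_0_compat; lra. }
    (* An arctangent stays between [- PI / 2] and [PI / 2], so the value on the right is at most [B]
       and the one on the left at least [- A]; the weighted sum is at most [A * B * (A + B)]. *)
    assert (U1 : A ^ 2 * (2 * (a1 + psi)) <= A ^ 2 * B)
      by (apply Rmult_le_compat_l; [apply pow2_ge_0 | unfold B; lra]).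
    assert (U2 : B ^ 2 * (- (2 * (a2 + psi))) <= B ^ 2 * A)
      by (apply Rmult_le_compat_l; [apply pow2_ge_0 | unfold A; lra]).
    assert (AB : A + B = 2 * PI) by (unfold A, B; ring).
    assert (U3 : (2 * PI) ^ 2 * (y / (2 * P)) * (2 * q / (p ^ 2 + q ^ 2) * y) <= A * B * (2 * PI)).
    { rewrite <- AB; replace (A * B * (A + B)) with (A ^ 2 * B + B ^ 2 * A) by ring; lra. }
    replace ((2 * PI) ^ 2 * (y / (2 * P)) * (2 * q / (p ^ 2 + q ^ 2) * y))
      with (2 * PI * q / (p ^ 2 + q ^ 2) * y ^ 2 / P * (2 * PI)) in U3 by (field; split; lra).
    apply Rmult_le_reg_r in U3; [|lra].
    assert (P2 : P <= 2) by (unfold P; nra).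
    set (X := 2 * PI * q / (p ^ 2 + q ^ 2) * y ^ 2) in *.
    assert (X <= A * B * P).
    { apply Rmult_le_compat_r with (r := P) in U3; [|lra].
      unfold Rdiv in U3; rewrite Rmult_assoc, Rinv_l in U3; lra. }
    assert (0 < A * B) by (apply Rmult_lt_0_compat; auto). nra. }
  assert (Lim : 2 * PI * q / (p ^ 2 + q ^ 2) <= A * B * 2).
  { apply Rnot_lt_le; intro HL.
    assert (HAB : 0 < A * B * 2) by nra.
    set (X := 2 * PI * q / (p ^ 2 + q ^ 2)) in *.
    (* The limit [y] to 1, by contradiction: at [y = (1 + z) / 2] the inequality says [y ^ 2 <= z],
       whereas [((1 + z) / 2) ^ 2 > z] for [z < 1]. *)
    set (z := A * B * 2 / X).
    assert (Hz : 0 < z < 1).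
    { unfold z; split; [apply Rdiv_lt_0_compat; lra|].
      apply Rmult_lt_reg_r with X; [lra|]; unfold Rdiv; rewrite Rmult_assoc, Rinv_l; lra. }
    specialize (Y ((1 + z) / 2) ltac:(lra)).
    assert (E : A * B * 2 = X * z) by (unfold z; field; lra).
    rewrite E in Y; apply Rmult_le_reg_l in Y; [nra | lra]. }
  assert (Hcos : cos psi = q / Cmod c).
  { unfold psi; rewrite cos_atan.
    assert (E : Cmod c = q * sqrt (1 + Rsqr (p / q))).
    { assert (S0 : 0 <= sqrt (1 + Rsqr (p / q))) by apply sqrt_pos.
      apply Rsqr_inj; [apply Cmod_ge_0 | nra |].
      rewrite Rsqr_mult, Rsqr_sqrt by (pose proof (Rle_0_sqr (p / q)); lra).
      rewrite Rsqr_pow2, Cmod2_alt; fold p q; unfold Rsqr; field; lra. }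
    assert (S1 : 0 < sqrt (1 + Rsqr (p / q))) by (apply sqrt_lt_R0; pose proof (Rle_0_sqr (p / q)); lra).
    rewrite E; field; split; lra. }
  pose proof (cos_ge_parabola psi ltac:(lra)) as CG.
  rewrite Hcos in CG.
  replace (PI ^ 2 - 4 * psi ^ 2) with (A * B) in CG by (unfold A, B; ring).
  rewrite <- (Cmod2_alt c : _ = p ^ 2 + q ^ 2) in Lim.
  assert (Rc : 0 < Cmod c) by (apply Cmod_gt_0; intro E; unfold q in Hq; rewrite E, im_RtoC in Hq; lra).
  set (rho := Cmod c) in *.
  (* Both sides share the positive factor [2 PI q / rho ^ 2]; what remains is [1 <= 4 * rho],
     against [rho < 1 / 4]. *)
  assert (L2 : 2 * PI * q / rho ^ 2 <= 4 * PI * (q / rho) * 2) by lra.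
  replace (4 * PI * (q / rho) * 2) with (2 * PI * q / rho ^ 2 * (4 * rho)) in L2 by (field; lra).
  assert (0 < 2 * PI * q / rho ^ 2).
  { apply Rdiv_lt_0_compat; [apply Rmult_lt_0_compat; [lra | exact Hq] | apply pow_lt; auto]. }
  nra.
Qed.

Theorem typically_real_covers (a : nat -> C) (f : C -> C) (c : C) : typically_real a f ->
  Cmod c < 1 / 4 -> exists z, Cmod z < 1 /\ f z = c.
Proof.
  intros Ht Hc; destruct (typically_real_series a f Ht) as [al (_ & H1 & Hal & Hrad & Hf & Hpos)].
  assert (Hpos' : forall z, Cmod z < 1 -> 0 <= Im z -> 0 <= Im (Cps (fun n => RtoC (al n)) z))
    by (intros z Hz Hi; rewrite <- Hf by auto; auto).
  assert (Hup : forall d, Cmod d < 1 / 4 -> 0 < Im d -> exists z, Cmod z < 1 /\ Cps (fun n => RtoC (al n)) z = d).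
  { intros d Hd Hi; apply nonreal_value_covered; auto; apply Hal. }
  enough (E : exists z, Cmod z < 1 /\ Cps (fun n => RtoC (al n)) z = c).
  { destruct E as [z [Hz E]]; exists z; split; auto; rewrite Hf; auto. }
  destruct (Rtotal_order (Im c) 0) as [L|[E|L]].
  - destruct (Hup (Cconj c)) as [z [Hz E]]; [rewrite Cmod_conj; auto | rewrite im_conj; lra |].
    exists (Cconj z); split; [rewrite Cmod_conj; auto|].
    rewrite Cps_conj, E; apply Cconj_conj.
  - assert (Ec : c = RtoC (Re c)) by (apply C_ext; [reflexivity | rewrite E; reflexivity]).
    rewrite Ec, Cmod_R in Hc.
    destruct (real_value_covered al (Re c) H1 Hal Hc) as [x [Hx Ex]].
    exists (RtoC x); split; [rewrite Cmod_R; auto|].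
    rewrite Ec, Cps_real_axis, <- Ex; apply C_ext; [reflexivity|].
    exact (PSeries_const_0 x).
  - apply Hup; auto.
Qed.

(** * The radius *)

Lemma is_derive_cderiv (h : C -> C) (z l : C) :
  @is_derive C_AbsRing C_NormedModule h z l <-> cderiv h z l.
Proof.
  split.
  - intros [_ H] e He.
    destruct (H z (fun P HP => HP) (mkposreal e He)) as [d Hd].
    exists d; split; [apply d|]; intros u Hu.
    specialize (Hd u Hu).
    replace (l * (u - z))%C with ((u - z) * l)%C by ring; exact Hd.
  - intros H; split; [apply (is_linear_scal_l (K := C_AbsRing) (V := C_NormedModule))|].
    intros x Hx; apply (is_filter_lim_locally_unique (V := AbsRing_NormedModule C_AbsRing)) in Hx; subst x.
    intros e; destruct (H e (cond_pos e)) as [d [Hd Hu]].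
    exists (mkposreal d Hd); intros u Huz; specialize (Hu u Huz).
    replace (l * (u - z))%C with ((u - z) * l)%C in Hu by ring; exact Hu.
Qed.

Lemma schwarz_le (w : C -> C) (z : C) : schwarz w -> Cmod z < 1 -> Cmod (w z) <= Cmod z.
Proof.
  intros (Hd & Hb & H0) Hz; apply schwarz_lemma; auto.
  intros u Hu; destruct (Hd u Hu) as [l Hl]; exists l; apply is_derive_cderiv; exact Hl.
Qed.

Lemma schwarz_id : schwarz (fun z => z).
Proof.
  repeat split; auto; intros z _; exists (RtoC 1); apply is_derive_cderiv, cderiv_id.
Qed.

(** * Closed forms of the extremal sums and the root of [F_fun] *)

Lemma CV_radius_1 : Rbar_le 1 (CV_radius (fun _ => 1)).
Proof.
  destruct (CV_radius_bounded (fun _ => 1)) as [B _]; apply B.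
  exists 1; intro n; rewrite pow1, Rmult_1_l, Rabs_R1; lra.
Qed.

Lemma ex_series_pow_geom (k : nat) (x : R) : 0 <= x < 1 -> ex_series (fun n => INR n ^ k * x ^ n).
Proof.
  intros Hx; apply (ex_series_ext (fun n => 1 * (INR n ^ k * x ^ n))); [intro; apply Rmult_1_l|].
  apply ex_series_pow_weight; [lra | intro; lra |].
  eapply Rbar_lt_le_trans; [|apply CV_radius_1]; simpl; lra.
Qed.

(** Expanding [(n + 1) ^ (k + 1)] makes this a linear equation for the sum in terms of those with
    lower powers, from which the closed forms follow. The positive exponent removes the term of
    index 0. *)
Lemma Series_pow_shift (k : nat) (x : R) : 0 <= x < 1 ->
  Series (fun n => INR n ^ S k * x ^ n) = x * Series (fun n => (INR n + 1) ^ S k * x ^ n).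
Proof.
  intros Hx; rewrite Series_incr_1 by (apply ex_series_pow_geom; auto).
  simpl INR at 1; rewrite <- Series_scal_l, pow_i, Rmult_0_l, Rplus_0_l by lia.
  apply Series_ext; intro n; rewrite S_INR; simpl; ring.
Qed.

Lemma Series_n (x : R) : 0 <= x < 1 -> Series (fun n => INR n * x ^ n) = x / (1 - x) ^ 2.
Proof.
  intros Hx.
  assert (E0 : Series (fun n => INR n ^ 0 * x ^ n) = / (1 - x)).
  { rewrite <- (Series_geom x) by (rewrite Rabs_pos_eq; lra).
    apply Series_ext; intro; simpl; ring. }
  pose proof (Series_pow_shift 0 x Hx) as E1.
  rewrite (Series_ext (fun n => (INR n + 1) ^ 1 * x ^ n)
    (fun n => INR n ^ 1 * x ^ n + INR n ^ 0 * x ^ n)) in E1 by (intro; ring).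
  rewrite Series_plus, E0 in E1 by (apply ex_series_pow_geom; auto).
  rewrite (Series_ext _ (fun n => INR n ^ 1 * x ^ n)) by (intro; ring).
  apply Rmult_eq_reg_l with (1 - x); [|lra].
  set (S1 := Series (fun n => INR n ^ 1 * x ^ n)) in *.
  replace ((1 - x) * (x / (1 - x) ^ 2)) with (x * / (1 - x)) by (field; lra). lra.
Qed.

Lemma Series_n3 (x : R) : 0 <= x < 1 ->
  Series (fun n => INR n ^ 3 * x ^ n) = x * (1 + 4 * x + x ^ 2) / (1 - x) ^ 4.
Proof.
  intros Hx.
  assert (E0 : Series (fun n => INR n ^ 0 * x ^ n) = / (1 - x)).
  { rewrite <- (Series_geom x) by (rewrite Rabs_pos_eq; lra).
    apply Series_ext; intro; simpl; ring. }
  assert (E1 : Series (fun n => INR n ^ 1 * x ^ n) = x / (1 - x) ^ 2).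
  { rewrite <- Series_n by auto; apply Series_ext; intro; ring. }
  pose proof (Series_pow_shift 1 x Hx) as E2.
  rewrite (Series_ext (fun n => (INR n + 1) ^ 2 * x ^ n)
    (fun n => INR n ^ 2 * x ^ n + (2 * (INR n ^ 1 * x ^ n) + INR n ^ 0 * x ^ n))) in E2 by (intro; ring).
  pose proof (Series_pow_shift 2 x Hx) as E3.
  rewrite (Series_ext (fun n => (INR n + 1) ^ 3 * x ^ n)
    (fun n => INR n ^ 3 * x ^ n + (3 * (INR n ^ 2 * x ^ n)
              + (3 * (INR n ^ 1 * x ^ n) + INR n ^ 0 * x ^ n)))) in E3 by (intro; ring).
  pose proof (fun k => ex_series_pow_geom k x Hx) as X.
  assert (Xs : forall c k, ex_series (fun n => c * (INR n ^ k * x ^ n)))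
    by (intros c k; exact (ex_series_scal c _ (X k))).
  rewrite !Series_plus, !Series_scal_l in E2 by
    (repeat (apply (ex_series_plus (V := R_NormedModule)) || apply X || apply Xs)).
  rewrite !Series_plus, !Series_scal_l in E3 by
    (repeat (apply (ex_series_plus (V := R_NormedModule)) || apply X || apply Xs)).
  rewrite E0, E1 in E2, E3.
  set (S2 := Series (fun n => INR n ^ 2 * x ^ n)) in *.
  set (S3 := Series (fun n => INR n ^ 3 * x ^ n)) in *.
  assert (F2 : S2 = x * (2 * (x / (1 - x) ^ 2) + / (1 - x)) / (1 - x)).
  { apply Rmult_eq_reg_l with (1 - x); [|lra].
    replace ((1 - x) * (x * (2 * (x / (1 - x) ^ 2) + / (1 - x)) / (1 - x)))
      with (x * (2 * (x / (1 - x) ^ 2) + / (1 - x))) by (field; lra). lra. }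
  rewrite F2 in E3.
  apply Rmult_eq_reg_l with (1 - x); [|lra].
  transitivity (x * (3 * (x * (2 * (x / (1 - x) ^ 2) + / (1 - x)) / (1 - x)) + (3 * (x / (1 - x) ^ 2) + / (1 - x))));
    [lra | field; lra].
Qed.

(** The value of [S_r / pi] for the Koebe function, that is the sum of [n * n^2 * r^(2n)]. *)
Definition bohr_area (r : R) : R := r ^ 2 * (1 + 4 * r ^ 2 + r ^ 4) / (1 - r ^ 2) ^ 4.

Lemma bohr_area_series (r : R) : 0 <= r < 1 ->
  is_series (fun n => INR n ^ 3 * r ^ (2 * n)) (bohr_area r).
Proof.
  intros Hr; assert (Hx : 0 <= r ^ 2 < 1) by nra.
  pose proof (Series_correct _ (ex_series_pow_geom 3 (r ^ 2) Hx)) as S.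
  rewrite Series_n3 in S by auto.
  apply (is_series_eq _ _ _ _ S).
  - intro n; rewrite pow_mult; reflexivity.
  - unfold bohr_area; f_equal; ring.
Qed.

Lemma linear_series_tail (u : R) : 0 <= u < 1 ->
  u + Series (fun n => INR (n + 2) * u ^ (n + 2)) = u / (1 - u) ^ 2.
Proof.
  intros Hu; rewrite <- Series_n by auto.
  assert (X : ex_series (fun n => INR n * u ^ n)).
  { apply (ex_series_ext (fun n => INR n ^ 1 * u ^ n)); [intro; simpl; ring | apply ex_series_pow_geom; auto]. }
  rewrite (Series_incr_n (fun n => INR n * u ^ n) 2) by (auto; lia).
  f_equal; [simpl; ring|].
  apply Series_ext; intro n; rewrite (Nat.add_comm n 2); reflexivity.
Qed.

Lemma bohr_area_le (x y : R) : 0 <= x -> x <= y -> y < 1 -> 0 <= bohr_area x <= bohr_area y.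
Proof.
  intros Hx Hxy Hy; unfold bohr_area.
  assert (A2 : 0 <= x ^ 2 <= y ^ 2) by (split; [apply pow2_ge_0 | apply pow_incr; lra]).
  assert (A4 : 0 <= x ^ 4 <= y ^ 4) by (split; [apply pow_le; lra | apply pow_incr; lra]).
  assert (D : 0 < (1 - y ^ 2) ^ 4 <= (1 - x ^ 2) ^ 4).
  { assert (y ^ 2 < 1) by nra.
    split; [apply pow_lt; lra | apply pow_incr; lra]. }
  assert (N : 0 <= x ^ 2 * (1 + 4 * x ^ 2 + x ^ 4) <= y ^ 2 * (1 + 4 * y ^ 2 + y ^ 4)).
  { split; [apply Rmult_le_pos; lra | apply Rmult_le_compat; lra]. }
  assert (I : 0 < / (1 - x ^ 2) ^ 4) by (apply Rinv_0_lt_compat; lra).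
  split; [apply Rmult_le_pos; lra|].
  apply Rmult_le_compat; try lra; apply Rinv_le_contravar; lra.
Qed.

Lemma koebe_lt (x y : R) : 0 <= x -> x < y -> y < 1 -> x / (1 - x) ^ 2 < y / (1 - y) ^ 2.
Proof.
  intros Hx Hxy Hy.
  assert (P : 0 < (1 - y) ^ 2) by (apply pow_lt; lra).
  assert (Q : (1 - y) ^ 2 <= (1 - x) ^ 2) by (apply pow_incr; lra).
  apply Rle_lt_trans with (x / (1 - y) ^ 2).
  - apply Rmult_le_compat_l; auto; apply Rinv_le_contravar; lra.
  - apply Rmult_lt_compat_r; auto; apply Rinv_0_lt_compat; auto.
Qed.

Lemma F_fun_bohr (Phi : R -> R) (r : R) :
  F_fun Phi r = r / (1 - r) ^ 2 + Phi r * bohr_area r - 1 / 4.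
Proof. reflexivity. Qed.

(** Strictness comes from the summand [r / (1 - r) ^ 2]; the other is a product of nonnegative
    nondecreasing factors, and [Phi] may be constant. *)
Lemma F_fun_lt (Phi : R -> R) (x y : R) : admissible_Phi Phi ->
  0 <= x -> x < y -> y < 1 -> F_fun Phi x < F_fun Phi y.
Proof.
  intros (P0 & P1 & _) Hx Hxy Hy; rewrite !F_fun_bohr.
  pose proof (koebe_lt x y Hx Hxy Hy); pose proof (bohr_area_le x y Hx (Rlt_le _ _ Hxy) Hy).
  pose proof (P0 x ltac:(lra)); pose proof (P1 x y ltac:(lra) ltac:(lra) ltac:(lra)).
  assert (Phi x * bohr_area x <= Phi y * bohr_area y) by (apply Rmult_le_compat; lra).
  lra.
Qed.

Lemma F_fun_root (Phi : R -> R) : admissible_Phi Phi ->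
  exists r, 0 < r < 1 /\ F_fun Phi r = 0.
Proof.
  intros (P0 & _ & P2).
  (* Continuity of [Phi] is known only within the unit interval, while the intermediate value
     theorem asks for two-sided continuity at the endpoint 0; composing with this 1-Lipschitz
     retraction supplies it. *)
  set (cl := fun x => Rmax 0 (Rmin 1 x)).
  assert (Hcl : forall x, 0 <= cl x <= 1).
  { intro x; unfold cl, Rmax, Rmin; destruct (Rle_dec 1 x), (Rle_dec 0 _); lra. }
  assert (Hid : forall x, 0 <= x <= 1 -> cl x = x).
  { intros x Hx; unfold cl; rewrite Rmin_right, Rmax_right; lra. }
  set (G := fun x => F_fun (fun y => Phi (cl y)) x).
  assert (EG : forall x, 0 <= x <= 1 -> G x = F_fun Phi x)
    by (intros x Hx; unfold G, F_fun; rewrite Hid; auto).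
  (* The value at 0 is [- 1 / 4], and at [1 / 2] the first summand is already 2; stopping there
     avoids the pole at 1. *)
  destruct (IVT_interv G 0 (1 / 2)) as [r [Hr Er]].
  - intros x Hx; unfold G, F_fun.
    apply continuity_pt_minus; [|apply continuity_pt_const; intros ? ?; reflexivity].
    apply continuity_pt_plus.
    { apply derivable_continuous_pt; apply ex_derive_Reals_0; auto_derive; nra. }
    apply (continuity_pt_mult (fun y => Phi (cl y)) (fun r => r ^ 2 * (1 + 4 * r ^ 2 + r ^ 4) / (1 - r ^ 2) ^ 4)).
    + intros e He; destruct (P2 x ltac:(lra) e He) as [d [Hd HP]].
      exists d; split; auto; intros y [_ Hy]; simpl in *; unfold R_dist in *.
      rewrite (Hid x) by lra; apply HP; auto.
      eapply Rle_lt_trans; [|exact Hy].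
      unfold cl, Rmax, Rmin; destruct (Rle_dec 1 y), (Rle_dec 0 _); unfold Rabs;
        repeat destruct (Rcase_abs _); lra.
    + apply derivable_continuous_pt; apply ex_derive_Reals_0; auto_derive.
      assert (0 < 1 - x * x) by nra.
      repeat split; auto; apply Rgt_not_eq; repeat apply Rmult_lt_0_compat; lra.
  - lra.
  - rewrite EG by lra; unfold F_fun.
    replace (0 / (1 - 0) ^ 2 + Phi 0 * (0 ^ 2 * (1 + 4 * 0 ^ 2 + 0 ^ 4) / (1 - 0 ^ 2) ^ 4) - 1 / 4)
      with (- 1 / 4) by field.
    lra.
  - rewrite EG, F_fun_bohr by lra.
    pose proof (P0 (1 / 2) ltac:(lra)) as Q0.
    pose proof (proj1 (bohr_area_le (1 / 2) (1 / 2) ltac:(lra) ltac:(lra) ltac:(lra))) as Q1.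
    pose proof (Rmult_le_pos _ _ Q0 Q1).
    replace (1 / 2 / (1 - 1 / 2) ^ 2) with 2 by field; lra.
  - rewrite EG in Er by lra.
    exists r; split; auto; split; [|lra].
    destruct (Req_dec r 0) as [E|E]; [|lra].
    rewrite E in Er; unfold F_fun in Er.
    replace (0 / (1 - 0) ^ 2 + Phi 0 * (0 ^ 2 * (1 + 4 * 0 ^ 2 + 0 ^ 4) / (1 - 0 ^ 2) ^ 4) - 1 / 4)
      with (- 1 / 4) in Er by field.
    lra.
Qed.

(** By the covering theorem a point of modulus below 1/4 has a whole disc around it inside the
    image, hence is not on the boundary. *)
Lemma dist0_boundary_ge (a : nat -> C) (f : C -> C) : typically_real a f ->
  Rbar_le (1 / 4) (dist0_boundary f).
Proof.
  intros Ht; unfold dist0_boundary.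
  apply (proj2 (Glb_Rbar_correct _)); intros d [w [[_ Hw] ->]]; simpl.
  apply Rnot_lt_le; intro Hlt; apply Hw.
  exists (1 / 4 - Cmod w); split; [lra|]; intros u Hu.
  destruct (typically_real_covers a f u Ht) as [z Hz]; [|exists z; exact Hz].
  replace u with ((u - w) + w)%C by ring.
  eapply Rle_lt_trans; [apply Cmod_triangle|]; lra.
Qed.

Lemma lhs_sum_le (Phi : R -> R) (a : nat -> C) (f w : C -> C) (z : C) :
  admissible_Phi Phi -> typically_real a f -> schwarz w -> Cmod z < 1 ->
  lhs_sum Phi a w z <= F_fun Phi (Cmod z) + 1 / 4.
Proof.
  intros (P0 & P1 & _) Ht Hw Hz.
  destruct (typically_real_series a f Ht) as [al (Hal & H1 & Hs & _)].
  assert (Ha : forall n, Cmod (a n) <= INR n).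
  { intro n; rewrite Hal, Cmod_R; pose proof (sine_nonneg_on_coeff al n Hs) as K; rewrite H1 in K; lra. }
  pose proof (schwarz_le w z Hw Hz) as Hu.
  pose proof (Cmod_ge_0 (w z)) as Hu0.
  rewrite F_fun_bohr; unfold lhs_sum, S_area.
  set (u := Cmod (w z)) in *; set (r := Cmod z) in *.
  assert (Hu1 : 0 <= u < 1) by lra.
  (* Two comparisons: the coefficients with those of the Koebe function at [u], then [u] with [r] by
     monotonicity. *)
  assert (B1 : u + Series (fun n => Cmod (a (n + 2)%nat) * u ^ (n + 2)) <= r / (1 - r) ^ 2).
  { apply Rle_trans with (u / (1 - u) ^ 2).
    - rewrite <- linear_series_tail by auto; apply Rplus_le_compat_l, Series_le.
      + intro n; pose proof (pow_le u (n + 2) Hu0).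
        split; [apply Rmult_le_pos; auto; apply Cmod_ge_0 | apply Rmult_le_compat_r; auto].
      + apply (ex_series_ext (fun n => INR (2 + n) ^ 1 * u ^ (2 + n))).
        { intro n; rewrite (Nat.add_comm 2 n), pow_1; reflexivity. }
        apply (ex_series_incr_n (fun n => INR n ^ 1 * u ^ n) 2), ex_series_pow_geom; auto.
    - destruct (Req_dec u r) as [->|]; [lra | left; apply koebe_lt; lra]. }
  set (S := Series (fun n => INR n * Cmod (a n) ^ 2 * r ^ (2 * n))).
  assert (Sn : forall n, 0 <= INR n * Cmod (a n) ^ 2 * r ^ (2 * n) <= INR n ^ 3 * r ^ (2 * n)).
  { intro n; pose proof (pow_le r (2 * n) ltac:(lra)); pose proof (pos_INR n); specialize (Ha n).
    pose proof (Cmod_ge_0 (a n)).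
    split; [apply Rmult_le_pos; auto; apply Rmult_le_pos; auto; apply pow2_ge_0|].
    apply Rmult_le_compat_r; auto.
    replace (INR n ^ 3) with (INR n * INR n ^ 2) by ring.
    apply Rmult_le_compat_l; auto; apply pow_incr; auto. }
  pose proof (bohr_area_series r ltac:(lra)) as SA.
  assert (B2 : 0 <= S <= bohr_area r).
  { split.
    - eapply is_series_ge_0; [apply Series_correct|intro n; apply Sn].
      apply (ex_series_le (V := R_CompleteNormedModule) _ (fun n => INR n ^ 3 * r ^ (2 * n)));
        [|eexists; exact SA].
      intro n; change (Rabs (INR n * Cmod (a n) ^ 2 * r ^ (2 * n)) <= INR n ^ 3 * r ^ (2 * n)).
      rewrite Rabs_pos_eq; apply Sn.
    - rewrite <- (is_series_unique _ _ SA); apply Series_le; [exact Sn | eexists; exact SA]. }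
  replace (PI * S / PI) with S by (field; apply PI_neq0).
  pose proof (P0 u ltac:(lra)); pose proof (P1 u r ltac:(lra) ltac:(lra) Hu).
  assert (Phi u * S <= Phi r * bohr_area r) by (apply Rmult_le_compat; lra).
  lra.
Qed.

(** * The Koebe function as extremal function *)

Definition koebe (z : C) : C := (z / ((1 - z) * (1 - z)))%C.
Definition koebe_coeff (n : nat) : C := RtoC (INR n).

Lemma one_sub_neq_0 (z : C) : Cmod z < 1 -> (1 - z)%C <> 0.
Proof.
  intros Hz E; apply Ceq_minus in E; rewrite <- E, Cmod_1 in Hz; lra.
Qed.

Lemma koebe_typically_real : typically_real koebe_coeff koebe.
Proof.
  split; [split; [reflexivity|split; [reflexivity|]]|].
  - intros z Hz; unfold in_disc in Hz; apply is_pseries_Cseries.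
    assert (Hc : Rbar_lt (Cmod z) (crad koebe_coeff)).
    { unfold crad; rewrite (CV_radius_ext _ (fun n => INR n ^ 1 * 1)).
      - rewrite (CV_radius_pow_weight (fun _ => 1) 1).
        eapply Rbar_lt_le_trans; [|apply CV_radius_1]; exact Hz.
      - intro n; unfold koebe_coeff; rewrite Cmod_R, Rabs_pos_eq by apply pos_INR; ring. }
    pose proof (Cps_correct koebe_coeff z Hc) as S0.
    set (l := Cps koebe_coeff z) in *.
    assert (S1 : is_Cseries (fun n => koebe_coeff (S n) * z ^ S n)%C l).
    { apply (is_Cseries_shift (fun n => koebe_coeff n * z ^ n)%C); auto.
      unfold koebe_coeff; simpl; ring. }
    (* Multiplying the series by [1 - z] takes differences of consecutive coefficients and leaves a
       geometric series. *)
    assert (E : (l - z * l)%C = (z * / (1 - z))%C).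
    { apply (is_Cseries_unique (fun n => z * z ^ n)%C).
      - apply (is_Cseries_ext (fun n => koebe_coeff (S n) * z ^ S n - z * (koebe_coeff n * z ^ n))%C).
        + intro n; unfold koebe_coeff; rewrite S_INR, RtoC_plus, Cpow_S; ring.
        + apply is_Cseries_minus; auto; apply is_Cseries_scal; auto.
      - apply is_Cseries_scal, geometric_Cseries; auto. }
    pose proof (one_sub_neq_0 z Hz) as Hn.
    replace (koebe z) with l; auto.
    unfold koebe; replace l with ((l - z * l) / (1 - z))%C by (field; auto).
    rewrite E; field; auto.
  - intros z Hz Hi; unfold in_disc in Hz; pose proof (one_sub_neq_0 z Hz) as Hn.
    assert (Hm : 0 < Cmod (1 - z)) by (apply Cmod_gt_0; auto).
    set (m := Cmod (1 - z)) in *.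
    assert (Hc : Cconj (1 - z) <> 0).
    { intro E; apply (f_equal Cmod) in E; rewrite Cmod_conj, Cmod_0 in E; fold m in E; lra. }
    (* The denominator is made real, equal to [|1 - z|^4]; the sign then lies in [Im (z * conj (1 -
       z)^2) = Im z * (1 - |z|^2)]. *)
    assert (E : koebe z = (RtoC (/ (m ^ 2 * m ^ 2)) * (z * (Cconj (1 - z) * Cconj (1 - z))))%C).
    { rewrite RtoC_inv, RtoC_mult by (apply Rgt_not_eq, Rmult_lt_0_compat; apply pow_lt; auto).
      unfold m; rewrite Cmod2_conj; unfold koebe; field; auto. }
    rewrite E, im_scal_l.
    assert (Q : 0 < / (m ^ 2 * m ^ 2))
      by (apply Rinv_0_lt_compat, Rmult_lt_0_compat; apply pow_lt; auto).
    assert (I : Im (z * (Cconj (1 - z) * Cconj (1 - z))) = Im z * (1 - Cmod z ^ 2)).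
    { rewrite Cmod2_alt; destruct z as [x y]; unfold Cconj, Re, Im; simpl; ring. }
    rewrite I.
    assert (0 < 1 - Cmod z ^ 2) by (pose proof (Cmod_ge_0 z); nra).
    replace (/ (m ^ 2 * m ^ 2) * (Im z * (1 - Cmod z ^ 2)) * Im z)
      with (/ (m ^ 2 * m ^ 2) * (1 - Cmod z ^ 2) * (Im z * Im z)) by ring.
    apply Rmult_lt_0_compat; [apply Rmult_lt_0_compat; auto | nra].
Qed.

(** The identity [koebe z + 1/4 = (1 + z)^2 / (4 (1 - z)^2)] shows that [- 1/4] is approached as [z]
    tends to [- 1] along the axis, and would be attained only at [- 1], outside the disc. *)
Lemma koebe_dist : Rbar_le (dist0_boundary koebe) (1 / 4).
Proof.
  unfold dist0_boundary; apply (proj1 (Glb_Rbar_correct _)).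
  exists (RtoC (- (1 / 4))); split; [|rewrite Cmod_R, Rabs_Ropp, Rabs_pos_eq; lra].
  split.
  - intros e He.
    set (d := Rmin e 1 / 2).
    assert (Hd : 0 < d /\ d < 1 /\ d < e).
    { unfold d; pose proof (Rmin_l e 1); pose proof (Rmin_r e 1).
      assert (0 < Rmin e 1) by (apply Rmin_pos; lra); lra. }
    exists (RtoC (- (1 - d))); split.
    { unfold in_disc; rewrite Cmod_R, Rabs_Ropp, Rabs_pos_eq; lra. }
    replace (koebe (RtoC (- (1 - d))) - RtoC (- (1 / 4)))%C with (RtoC (d ^ 2 / (4 * (2 - d) ^ 2))).
    + rewrite Cmod_R, Rabs_pos_eq.
      * apply Rle_lt_trans with (d ^ 2 / 1); [|nra].
        apply Rmult_le_compat_l; [apply pow2_ge_0|]; apply Rinv_le_contravar; nra.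
      * apply Rdiv_le_0_compat; [apply pow2_ge_0 | nra].
    + unfold koebe.
      rewrite <- RtoC_minus, <- RtoC_mult, <- RtoC_div, <- RtoC_minus by nra.
      f_equal; field; lra.
  - intros [e [He H]].
    destruct (H (RtoC (- (1 / 4)))) as [z [Hz E]].
    { replace (RtoC (- (1 / 4)) - RtoC (- (1 / 4)))%C with (RtoC 0) by ring; rewrite Cmod_0; auto. }
    unfold in_disc in Hz; pose proof (one_sub_neq_0 z Hz) as Hn.
    assert (Z : ((1 + z) * (1 + z))%C = 0).
    { replace ((1 + z) * (1 + z))%C with (4 * ((1 - z) * (1 - z)) * (koebe z + / 4))%C
        by (unfold koebe; field; auto).
      rewrite E, RtoC_opp, RtoC_div by lra; field. }
    assert (Z1 : (1 + z)%C = 0).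
    { apply NNPP; intro Hne; exact (Cmult_neq_0 _ _ Hne Hne Z). }
    assert (Zm : z = (- (1))%C) by (replace z with ((1 + z) - 1)%C by ring; rewrite Z1; ring).
    rewrite Zm, Cmod_m1 in Hz; lra.
Qed.

Lemma koebe_lhs (Phi : R -> R) (r : R) : 0 <= r < 1 ->
  lhs_sum Phi koebe_coeff (fun z => z) (RtoC r) = F_fun Phi r + 1 / 4.
Proof.
  intros Hr; rewrite F_fun_bohr; unfold lhs_sum, S_area.
  assert (Er : Cmod r = r) by (rewrite Cmod_R, Rabs_pos_eq; lra).
  assert (En : forall n, Cmod (koebe_coeff n) = INR n)
    by (intro n; unfold koebe_coeff; rewrite Cmod_R, Rabs_pos_eq; auto; apply pos_INR).
  rewrite Er, <- linear_series_tail by auto.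
  rewrite <- (is_series_unique _ _ (bohr_area_series r Hr)).
  rewrite (Series_ext (fun n => Cmod (koebe_coeff (n + 2)) * r ^ (n + 2)) (fun n => INR (n + 2) * r ^ (n + 2)))
    by (intro; rewrite En; reflexivity).
  rewrite (Series_ext (fun n => INR n * Cmod (koebe_coeff n) ^ 2 * r ^ (2 * n)) (fun n => INR n ^ 3 * r ^ (2 * n)))
    by (intro; rewrite En; ring).
  field; apply PI_neq0.
Qed.

Theorem theorem5p2 (Phi : R -> R) (hPhi : admissible_Phi Phi) :
  (exists! R0 : R, 0 < R0 < 1 /\ F_fun Phi R0 = 0) /\
  (forall R0 : R, 0 < R0 < 1 -> F_fun Phi R0 = 0 ->
     (forall (a : nat -> C) (f : C -> C) (w : C -> C),
        typically_real a f -> schwarz w ->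
        forall z : C, Cmod z <= R0 ->
          Rbar_le (Finite (lhs_sum Phi a w z)) (dist0_boundary f)) /\
     (forall r : R, R0 < r < 1 ->
        exists (a : nat -> C) (f : C -> C) (w : C -> C) (z : C),
          typically_real a f /\ schwarz w /\ Cmod z = r /\
          Rbar_lt (dist0_boundary f) (Finite (lhs_sum Phi a w z)))).
Proof.
  split.
  - destruct (F_fun_root Phi hPhi) as [r [Hr Er]]; exists r; split; [auto|].
    intros s [Hs Es]; destruct (Rtotal_order r s) as [L|[E|L]]; auto.
    + pose proof (F_fun_lt Phi r s hPhi ltac:(lra) L ltac:(lra)); lra.
    + pose proof (F_fun_lt Phi s r hPhi ltac:(lra) L ltac:(lra)); lra.
  - intros R0 HR0 E0; split.
    + intros a f w Ht Hw z Hz.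
      apply Rbar_le_trans with (1 / 4); [|apply (dist0_boundary_ge a); auto].
      pose proof (lhs_sum_le Phi a f w z hPhi Ht Hw ltac:(lra)) as L.
      assert (F_fun Phi (Cmod z) <= F_fun Phi R0); [|simpl; lra].
      destruct (Req_dec (Cmod z) R0) as [->|]; [lra|].
      left; apply F_fun_lt; auto; try lra; apply Cmod_ge_0.
    + intros r Hr; exists koebe_coeff, koebe, (fun z => z), (RtoC r).
      split; [apply koebe_typically_real|]; split; [apply schwarz_id|].
      split; [rewrite Cmod_R, Rabs_pos_eq; lra|].
      apply Rbar_le_lt_trans with (1 / 4); [apply koebe_dist|].
      rewrite koebe_lhs by lra.
      pose proof (F_fun_lt Phi R0 r hPhi ltac:(lra) ltac:(lra) ltac:(lra)); simpl; lra.
Qed.
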